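(* Let $\sigma\ge 2$ be an integer, let $C$ be the invasion percolation cluster on the rooted regular tree $\mathcal{T}_\sigma$, and let $C_\infty$ be the incipient infinite cluster on $\mathcal{T}_\sigma$. Then the incipient infinite cluster stochastically dominates the invasion percolation cluster: there exists a coupling of $C_\infty$ and $C$ (i.e. a probability space carrying random subgraphs having the law of $C_\infty$ and the law of $C$, respectively) such that $C_\infty\supset C$ with probability $1$.
   Context: $\mathcal{T}_\sigma$ is the infinite rooted tree in which every vertex has exactly $\sigma$ children (the root $o$ has degree $\sigma$, all other vertices have degree $\sigma+1$). $\|v\|$ is the graph distance of $v$ from $o$ (the height of $v$). Invasion percolation cluster (IPC): assign i.i.d. uniform $(0,1)$ weights to the edges of $\mathcal{T}_\sigma$. Let $I_0=\{o\}$ and, given $I_N$, let $I_{N+1}$ be obtained by adjoining to $I_N$ the edge in its boundary (edges with exactly one endpoint in $I_N$) with smallest weight, together with its other endpoint. Then $C=\bigcup_{N\ge 0} I_N$. Incipient infinite cluster (IIC): let $p_c=1/\sigma$ and let $\mathbb{P}_{p_c}$ be the law of independent bond percolation on $\mathcal{T}_\sigma$ with parameter $p_c$. $C_\infty$ is the random infinite subgraph (cluster of the root) whose law $\mathbb{P}_\infty$ is the limit as $n\to\infty$ of the law of the open cluster of $o$ under $\mathbb{P}_{p_c}$ conditioned on $o$ being connected by open edges to some vertex at height $n$ (limit in the sense of convergence of probabilities of cylinder events). Equivalently, $C_\infty$ consists of a uniformly random infinite self-avoiding path from $o$ (the backbone), with independent critical percolation clusters attached at each backbone vertex in each direction away from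 the backbone. *)

(* Defs.v *)
From mathcomp Require Import all_boot all_order all_algebra.
From mathcomp Require Import all_classical all_reals all_analysis.

Set Implicit Arguments.
Unset Strict Implicit.
Unset Printing Implicit Defensive.

Import Order.TTheory GRing.Theory Num.Theory.
Import numFieldNormedType.Exports.

Local Open Scope classical_set_scope.
Local Open Scope ring_scope.

(* A vertex of the rooted tree in which every vertex has sigma children is the
   word of child indices read from the root, so that its height is its size. *)
Definition vertex (sigma : nat) : Type := seq 'I_sigma.

Definition root (sigma : nat) : vertex sigma := [::].

Definition height (sigma : nat) (v : vertex sigma) : nat := size v.

(* The edge (v, i) joins v to its i-th child. *)
Definition edge (sigma : nat) : Type := (vertex sigma * 'I_sigma)%type.

Definition endpoints (sigma : nat) (e : edge sigma) : set (vertex sigma) :=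
  [set e.1; rcons e.1 e.2].

(* A vertex set together with an edge set. *)
Definition subgraph (sigma : nat) : Type :=
  (set (vertex sigma) * set (edge sigma))%type.

Definition vertices (sigma : nat) (G : subgraph sigma) : set (vertex sigma) :=
  G.1.

Definition edges (sigma : nat) (G : subgraph sigma) : set (edge sigma) := G.2.

Definition is_subgraph (sigma : nat) (G H : subgraph sigma) : Prop :=
  vertices G `<=` vertices H /\ edges G `<=` edges H.

(* Cylinder events: those determined by the presence or absence of finitely
   many vertices and edges. *)
Definition cylinder (sigma : nat) : set (set (subgraph sigma)) :=
  [set A | exists (s : seq (vertex sigma)) (t : seq (edge sigma)),
    forall G H : subgraph sigma,
      (forall v, v \in s -> (vertices G v <-> vertices H v)) ->
      (forall e, e \in t -> (edges G e <-> edges H e)) ->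
      (A G <-> A H)].

Definition subgraph_space (sigma : nat) := g_sigma_algebraType (@cylinder sigma).

Definition iid (R : realType) (d : measure_display) (T : measurableType d)
    (P : probability T R) (d' : measure_display) (T' : measurableType d')
    (I : eqType) (X : I -> {RV P >-> T'}) (mu : set T' -> \bar R) : Prop :=
  (forall (i : I) (A : set T'), measurable A -> distribution P (X i) A = mu A) /\
  (forall (s : seq I) (A : I -> set T'), uniq s ->
    (forall i, measurable (A i)) ->
    P (\bigcap_(i in [set` s]) (X i @^-1` A i)) =
      (\prod_(i <- s) P (X i @^-1` A i))%E).

(** Invasion percolation *)

Definition boundary (sigma : nat) (G : subgraph sigma) : set (edge sigma) :=
  [set e | exists x y : vertex sigma,
    [/\ endpoints e = [set x; y], vertices G x & ~ vertices G y]].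

Definition min_boundary (R : realType) (sigma : nat) (w : edge sigma -> R)
    (G : subgraph sigma) : set (edge sigma) :=
  [set e | boundary G e /\ forall f, boundary G f -> w e <= w f].

(* If the weights are pairwise distinct, as i.i.d. uniform weights almost surely
   are, min_boundary w G is a singleton for each of the finite graphs G of the
   process; in the null event of ties all minimizers are adjoined. *)
Definition invade (R : realType) (sigma : nat) (w : edge sigma -> R)
    (G : subgraph sigma) : subgraph sigma :=
  (vertices G `|` \bigcup_(e in min_boundary w G) endpoints e,
   edges G `|` min_boundary w G).

Definition invasion (R : realType) (sigma : nat) (w : edge sigma -> R)
    (N : nat) : subgraph sigma :=
  iter N (invade w) ([set root sigma], set0).

Definition invasion_cluster (R : realType) (sigma : nat) (w : edge sigma -> R) :
    subgraph sigma :=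
  (\bigcup_N vertices (invasion w N), \bigcup_N edges (invasion w N)).

Definition IPC_law (R : realType) (sigma : nat)
    (mu : probability (subgraph_space sigma) R) : Prop :=
  exists (d : measure_display) (T : measurableType d) (P : probability T R)
    (W : edge sigma -> {RV P >-> R}),
    iid W (uniform_prob (@ltr01 R)) /\
    forall A : set (subgraph_space sigma), measurable A ->
      mu A = P [set t | A (invasion_cluster (fun e => W e t))].

(** Bernoulli bond percolation and the incipient infinite cluster *)

Inductive connected_to_root (sigma : nat) (eta : edge sigma -> bool) :
    vertex sigma -> Prop :=
| connected_root : connected_to_root eta (root sigma)
| connected_step (x y : vertex sigma) (e : edge sigma) :
    connected_to_root eta x -> eta e -> endpoints e x -> endpoints e y ->
    connected_to_root eta y.

Definition open_cluster (sigma : nat) (eta : edge sigma -> bool) :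
    subgraph sigma :=
  ([set v | connected_to_root eta v],
   [set e | eta e /\ forall v, endpoints e v -> connected_to_root eta v]).

Definition reaches_height (sigma : nat) (eta : edge sigma -> bool) (n : nat) :
    Prop :=
  exists v : vertex sigma, height v = n /\ connected_to_root eta v.

Definition cond_prob (R : realType) (d : measure_display) (T : measurableType d)
    (P : probability T R) (A B : set T) : R :=
  fine (P (A `&` B)) / fine (P B).

(* Convergence on cylinder events determines mu, since they form a pi-system
   generating the sigma-algebra. *)
Definition IIC_law (R : realType) (sigma : nat)
    (mu : probability (subgraph_space sigma) R) : Prop :=
  exists (d : measure_display) (T : measurableType d) (P : probability T R)
    (X : edge sigma -> {RV P >-> bool}),
    iid X (bernoulli_prob (sigma%:R^-1 : R)) /\
    forall A : set (subgraph sigma), cylinder A ->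
      cond_prob P [set t | A (open_cluster (fun e => X e t))]
                  [set t | reaches_height (fun e => X e t) n]
        @[n --> \oo] --> fine (mu A).

(* Main.v *)
(* Cut the tree at height n. Let t be the least level such that the root is
   joined to height n by edges of weight at most t. The branch through which
   this level is attained is uniform, and the invasion continues recursively
   inside it; each other branch carries percolation at level t conditioned not
   to reach height n, which is a percolation whose edge probabilities never
   exceed 1/sigma, because p (1 - p)^(sigma - 1) is maximal at p = 1/sigma.
   By induction on n, the invaded cluster is dominated by the size-biased
   critical cluster, which is the incipient infinite cluster cut at height n.
   Strassen's theorem turns this into a monotone coupling at each height, and an
   ultrafilter limit with Kolmogorov extension couples the infinite clusters.
   The weights are discretised, so that everything below height n is a finite
   sum; ties between weights vanish as the mesh tends to 0. *)
Require Import Defs.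
From mathcomp Require Import all_boot all_order all_algebra.
From mathcomp Require Import all_classical all_reals all_analysis.
From mathcomp Require Import ring lra.

Set Implicit Arguments.
Unset Strict Implicit.
Unset Printing Implicit Defensive.

Import Order.TTheory GRing.Theory Num.Theory.
Import numFieldNormedType.Exports.

Local Open Scope ring_scope.

(** * Stochastic domination of product laws *)

(** The level of the invasion and the shape of the invaded cluster are dependent, so a bound on the
    law of the cluster alone does not pass from a branch to the whole tree: selecting the best
    branch biases its level by the chance that the other branches are worse. The induction therefore
    bounds the cluster against every nonnegative weight of the level, that is, conditionally on each
    value of the level, and the bias becomes part of the weight. Conditional laws appear with
    denominators cleared, as sums restricted to an event, so that null events need no separate
    treatment. The inclusion of the first stages of the invasion in the finite cluster is
    deterministic; ties only spoil the bound on the law, by at most a constant depending on the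
    height times the mesh. Couplings at different heights need not be restrictions of one another,
    only their marginals are: hence a limit before the extension. In the final coupling neither
    cluster is built from weights or percolation on the coupling space; both are recognised by their
    laws. *)

Section ProductDomination.
Variables (R : realFieldType) (I Y : finType) (le : rel Y).
Hypothesis le_refl : reflexive le.

Definition ffun_upd (y : {ffun I -> Y}) (i0 : I) (z : Y) : {ffun I -> Y} :=
  [ffun i => if i == i0 then z else y i].

(** Resampling one coordinate. Exchanging [y i0] with [z] is an involution of the pairs that turns
    the updated function back into [y], so each function is counted [#|Y|] times. *)
Lemma sum_ffun_upd (G : {ffun I -> Y} -> R) (i0 : I) :
  \sum_y \sum_z G (ffun_upd y i0 z) = (\sum_y G y) *+ #|Y|.
Proof.
rewrite pair_bigA /=.
pose h (p : {ffun I -> Y} * Y) := (ffun_upd p.1 i0 p.2, p.1 i0).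
have hK : involutive h.
  move=> [y z]; rewrite /h /=; congr pair; last by rewrite ffunE eqxx.
  by apply/ffunP => i; rewrite !ffunE; case: eqP => // ->.
rewrite (reindex_inj (inv_inj hK)) /= -sumrMnl.
transitivity (\sum_(p : {ffun I -> Y} * Y) G p.1).
  apply: eq_bigr => -[y z] _ /=; congr G.
  by apply/ffunP => i; rewrite !ffunE; case: eqP => // ->.
rewrite -(pair_bigA _ (fun y z => G y)) /=.
by apply: eq_bigr => y _; rewrite sumr_const.
Qed.

(** Total masses are left free, because the measures compared later are probabilities restricted to
    an event; this is why test functions are nonnegative. *)
Definition dominated (a b : Y -> R) :=
  forall h : Y -> R, (forall y, 0 <= h y) ->
    (forall y z, le y z -> h y <= h z) -> \sum_y a y * h y <= \sum_y b y * h y.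

Definition ffun_le (x y : {ffun I -> Y}) := [forall i, le (x i) (y i)].

Lemma dominated_prod1 (i0 : I) (a b : I -> Y -> R) (f : {ffun I -> Y} -> R) :
  (forall i y, i != i0 -> a i y = b i y) -> (forall i y, 0 <= a i y) ->
  dominated (a i0) (b i0) -> (forall y, 0 <= f y) ->
  (forall x y, ffun_le x y -> f x <= f y) ->
  \sum_(y : {ffun I -> Y}) (\prod_i a i (y i)) * f y <=
  \sum_(y : {ffun I -> Y}) (\prod_i b i (y i)) * f y.
Proof.
move=> ab a0 dab f0 fmono.
case: (posnP #|Y|) => [Y0|Ypos].
  by rewrite !big1 // => y _; have := fintype0 (y i0) Y0.
rewrite -(ler_pMn2r Ypos) -!(@sum_ffun_upd _ i0); apply: ler_sum => y _.
have prodE (c : I -> Y -> R) z : \prod_i c i (ffun_upd y i0 z i) =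
    (\prod_(i | i != i0) c i (y i)) * c i0 z.
  rewrite (bigD1 i0) //= ffunE eqxx mulrC; congr (_ * _).
  by apply: eq_bigr => i /negPf ii0; rewrite ffunE ii0.
under eq_bigr do rewrite prodE -mulrA.
under [leRHS]eq_bigr do rewrite prodE -mulrA.
have -> : \prod_(i | i != i0) b i (y i) = \prod_(i | i != i0) a i (y i).
  by apply: eq_bigr => i ii0; rewrite ab.
rewrite -!mulr_sumr ler_wpM2l ?prodr_ge0 //.
apply: dab => // z z' zz'; apply: fmono; apply/forallP => i.
by rewrite !ffunE; case: eqP => //.
Qed.

Lemma dominated_prod (a b : I -> Y -> R) (f : {ffun I -> Y} -> R) :
  (forall i y, 0 <= a i y) -> (forall i y, 0 <= b i y) ->
  (forall i, dominated (a i) (b i)) -> (forall y, 0 <= f y) ->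
  (forall x y, ffun_le x y -> f x <= f y) ->
  \sum_(y : {ffun I -> Y}) (\prod_i a i (y i)) * f y <=
  \sum_(y : {ffun I -> Y}) (\prod_i b i (y i)) * f y.
Proof.
move=> a0 b0 dab f0 fmono.
(* Hybrid measures: the factors in [J] come from [a], the others from [b], and elements leave [J]
   one at a time. *)
pose c (J : {set I}) i := if i \in J then a i else b i.
have c0 J i y : 0 <= c J i y by rewrite /c; case: ifP.
have cP n : forall J : {set I}, #|J| = n ->
    \sum_(y : {ffun I -> Y}) (\prod_i c J i (y i)) * f y <=
    \sum_(y : {ffun I -> Y}) (\prod_i b i (y i)) * f y.
  elim: n => [|n IHn] J.
    move/cards0_eq => ->; apply: ler_sum => y _; rewrite le_eqVlt; apply/orP; left.
    by apply/eqP; congr (_ * _); apply: eq_bigr => i _; rewrite /c finset.in_set0.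
  move=> Jn; have /card_gt0P[i iJ] : (0 < #|J|)%N by rewrite Jn.
  apply: le_trans (IHn (J :\ i) _); last by move: Jn; rewrite (cardsD1 i) iJ => -[].
  apply: (@dominated_prod1 i) => //.
    by move=> k y ki; rewrite /c !inE ki.
  by rewrite /c !inE eqxx iJ /=; apply: dab.
have := cP _ [set: I] erefl; congr (_ <= _).
by apply: eq_bigr => y _; congr (_ * _); apply: eq_bigr => i _; rewrite /c inE.
Qed.

Variables (Z : finType) (phi : I -> Z -> Y).

Lemma sum_prod_pushforward (a : I -> Z -> R) (f : {ffun I -> Y} -> R) :
  \sum_(w : {ffun I -> Z}) (\prod_i a i (w i)) * f [ffun i => phi i (w i)] =
  \sum_(y : {ffun I -> Y})
     (\prod_i \sum_(z | phi i z == y i) a i z) * f y.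
Proof.
rewrite (partition_big (fun w : {ffun I -> Z} => [ffun i => phi i (w i)]) xpredT) //=.
apply: eq_bigr => y _; rewrite bigA_distr_big_dep /= mulr_suml.
apply: eq_big => [w|w /eqP -> //].
apply/eqP/familyP => [<- i|wy]; first by rewrite unfold_in ffunE.
by apply/ffunP => i; rewrite ffunE; apply/eqP/wy.
Qed.

Lemma dominated_prod_pushforward (a : I -> Z -> R) (b : I -> Y -> R)
    (f : {ffun I -> Y} -> R) :
  (forall i z, 0 <= a i z) -> (forall i y, 0 <= b i y) ->
  (forall i (h : Y -> R), (forall y, 0 <= h y) ->
     (forall y z, le y z -> h y <= h z) ->
     \sum_z a i z * h (phi i z) <= \sum_y b i y * h y) ->
  (forall y, 0 <= f y) -> (forall x y, ffun_le x y -> f x <= f y) ->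
  \sum_(w : {ffun I -> Z}) (\prod_i a i (w i)) * f [ffun i => phi i (w i)] <=
  \sum_(y : {ffun I -> Y}) (\prod_i b i (y i)) * f y.
Proof.
move=> a0 b0 dab f0 fmono; rewrite sum_prod_pushforward.
apply: (@dominated_prod (fun i y => \sum_(z | phi i z == y) a i z)) => //.
  by move=> i y; apply: sumr_ge0.
move=> i h h0 hmono; apply: le_trans (dab i h h0 hmono).
rewrite (partition_big (phi i) xpredT) //= le_eqVlt; apply/orP; left; apply/eqP.
by apply: eq_bigr => y _; rewrite mulr_suml; apply: eq_bigr => z /eqP ->.
Qed.

End ProductDomination.

(** * Clusters and labelings of bounded height *)

Section Clusters.
Variable sigma : nat.

(* The subtrees of height at most n containing the root, encoded by the subtrees
   hanging at each child (None for an absent child). *)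
Fixpoint hcluster (n : nat) : finType :=
  if n is n'.+1 then {ffun 'I_sigma -> option (hcluster n')} else unit.

Definition branch n (s : hcluster n.+1) : {ffun 'I_sigma -> option (hcluster n)} := s.

Definition ole (T : Type) (le : rel T) : rel (option T) := fun x y =>
  match x, y with
  | None, _ => true
  | Some a, Some b => le a b
  | Some _, None => false
  end.

Fixpoint cle n : rel (hcluster n) :=
  match n return rel (hcluster n) with
  | 0%N => fun _ _ => true
  | n'.+1 => ffun_le (ole (@cle n'))
  end.

Lemma ole_refl T (le : rel T) : reflexive le -> reflexive (ole le).
Proof. by move=> h [x|] /=. Qed.

Lemma cle_refl n : reflexive (@cle n).
Proof.
elim: n => [|n IHn] //= s; apply/forallP => i; exact: ole_refl.
Qed.

Lemma cle_trans n : transitive (@cle n).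
Proof.
elim: n => [|n IHn] //= t s u /forallP st /forallP tu; apply/forallP => i.
move: (st i) (tu i); case: (s i) (t i) (u i) => [a|] [b|] [c|] //=; exact: IHn.
Qed.

Section Laws.
Variables (R : realFieldType) (p : R).

Definition branch_law (T : Type) (law : T -> R) (y : option T) : R :=
  if y is Some t then p * law t else 1 - p.

Fixpoint perc_law n : hcluster n -> R :=
  match n return hcluster n -> R with
  | 0%N => fun _ => 1
  | n'.+1 => fun s => \prod_i branch_law (@perc_law n') (branch s i)
  end.

Fixpoint frontier n : hcluster n -> nat :=
  match n return hcluster n -> nat with
  | 0%N => fun _ => 1%N
  | n'.+1 => fun s =>
      (\sum_i if branch s i is Some t then @frontier n' t else 0)%N
  end.

(* For p = 1 / sigma this size-biased law is the law of the incipient infinite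
   cluster cut at height n. *)
Definition iic_law n (s : hcluster n) : R := perc_law s * (frontier s)%:R.

Lemma sum_cluster n (F : hcluster n.+1 -> R) :
  \sum_s F s = \sum_(y : {ffun 'I_sigma -> option (hcluster n)}) F y.
Proof. by []. Qed.

Lemma sum_option (T : finType) (F : option T -> R) :
  \sum_y F y = F None + \sum_t F (Some t).
Proof.
rewrite (bigD1 None) //=; congr (_ + _).
rewrite (reindex_omap Some id) /=; last by case.
by apply: eq_bigl => t; rewrite eqxx.
Qed.

Lemma sum_branch_law n :
  \sum_(s : hcluster n) perc_law s = 1 -> \sum_y branch_law (@perc_law n) y = 1.
Proof. by move=> h; rewrite sum_option /= -mulr_sumr h mulr1 subrK. Qed.

Lemma sum_perc_law n : \sum_(s : hcluster n) perc_law s = 1.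
Proof.
elim: n => [|n IHn]; first by rewrite big_const card_unit /= addr0.
rewrite sum_cluster -(bigA_distr_bigA (fun=> branch_law (@perc_law n))) /=.
by rewrite big1 // => i _; apply: sum_branch_law.
Qed.

Hypothesis p01 : 0 <= p <= 1.

Lemma branch_law_ge0 T (law : T -> R) : (forall t, 0 <= law t) ->
  forall y, 0 <= branch_law law y.
Proof. by case/andP: p01 => p0 p1 h [t|] /=; rewrite ?mulr_ge0 // subr_ge0. Qed.

Lemma perc_law_ge0 n (s : hcluster n) : 0 <= perc_law s.
Proof.
by elim: n s => [|n IHn] //= s; apply: prodr_ge0 => i _; apply: branch_law_ge0.
Qed.

Lemma iic_law_ge0 n (s : hcluster n) : 0 <= iic_law s.
Proof. by rewrite mulr_ge0 // perc_law_ge0. Qed.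

End Laws.

Section Labels.
Variable L : finType.

Fixpoint labeling (n : nat) : finType :=
  if n is n'.+1 then {ffun 'I_sigma -> L * labeling n'} else unit.

Definition lbranch n (w : labeling n.+1) : {ffun 'I_sigma -> L * labeling n} := w.

Variables (R : realFieldType) (q : L -> R).

Fixpoint lab_law n : labeling n -> R :=
  match n return labeling n -> R with
  | 0%N => fun _ => 1
  | n'.+1 => fun w => \prod_i (q (lbranch w i).1 * @lab_law n' (lbranch w i).2)
  end.

Definition lbranch_law n (z : L * labeling n) : R := q z.1 * lab_law z.2.

Lemma sum_labeling n (F : labeling n.+1 -> R) :
  \sum_w F w = \sum_(w : {ffun 'I_sigma -> L * labeling n}) F w.
Proof. by []. Qed.

Hypothesis q0 : forall l, 0 <= q l.

Lemma lab_law_ge0 n (w : labeling n) : 0 <= lab_law w.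
Proof.
by elim: n w => [|n IHn] //= w; apply: prodr_ge0 => i _; apply: mulr_ge0.
Qed.

Lemma lbranch_law_ge0 n (z : L * labeling n) : 0 <= lbranch_law z.
Proof. by rewrite mulr_ge0 // lab_law_ge0. Qed.

Hypothesis q1 : \sum_l q l = 1.

Lemma sum_lbranch n (F : L * labeling n -> R) :
  \sum_z F z = \sum_l \sum_w F (l, w).
Proof. by rewrite pair_bigA; apply: eq_bigr => -[]. Qed.

Lemma sum_lbranch_law n :
  \sum_(w : labeling n) lab_law w = 1 -> \sum_z @lbranch_law n z = 1.
Proof.
move=> h; rewrite sum_lbranch /lbranch_law /=.
by under eq_bigr do rewrite -mulr_sumr h mulr1.
Qed.

Lemma sum_lab_law n : \sum_(w : labeling n) lab_law w = 1.
Proof.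
elim: n => [|n IHn]; first by rewrite big_const card_unit /= addr0.
rewrite sum_labeling -(bigA_distr_bigA (fun=> @lbranch_law n)) /=.
by rewrite big1 // => i _; apply: sum_lbranch_law.
Qed.

End Labels.

Fixpoint label_map (L L' : finType) (h : L -> L') n : labeling L n -> labeling L' n :=
  match n return labeling L n -> labeling L' n with
  | 0%N => fun w => w
  | n'.+1 => fun w =>
      [ffun i => (h (lbranch w i).1, @label_map L L' h n' (lbranch w i).2)]
  end.

End Clusters.

Section ProductSums.
Variables (R : realFieldType) (I Z : finType) (q : Z -> R).
Hypothesis q1 : \sum_z q z = 1.

Lemma sum_prod_marginal (j : I) (F : Z -> R) :
  \sum_(w : {ffun I -> Z}) (\prod_i q (w i)) * F (w j) = \sum_z q z * F z.
Proof.
pose a i z := if i == j then q z * F z else q z.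
transitivity (\sum_(w : {ffun I -> Z}) \prod_i a i (w i)).
  apply: eq_bigr => w _; rewrite (bigD1 j) //= [RHS](bigD1 j) //= /a eqxx mulrAC.
  by congr (_ * _); apply: eq_bigr => i /negPf ->.
rewrite -(bigA_distr_bigA a) (bigD1 j) //= [X in _ * X]big1 ?mulr1 => [|i /negPf ij].
  by apply: eq_bigr => z _; rewrite /a eqxx.
by rewrite -[RHS]q1; apply: eq_bigr => z _; rewrite /a ij.
Qed.

Lemma sum_fix_coord (j : I) (G : {ffun I -> Z} -> R) :
  \sum_w G w = \sum_z \sum_(w : {ffun I -> Z}) (w j == z)%:R * G w.
Proof.
rewrite exchange_big /=; apply: eq_bigr => w _.
rewrite (bigD1 (w j)) //= eqxx mul1r big1 ?addr0 // => z /negPf.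
by rewrite eq_sym => ->; rewrite mul0r.
Qed.

Lemma sum_prod_marginal2 (j k : I) (F : Z -> Z -> R) : j != k ->
  \sum_(w : {ffun I -> Z}) (\prod_i q (w i)) * F (w j) (w k) =
  \sum_z q z * \sum_z' q z' * F z z'.
Proof.
move=> jk; rewrite (sum_fix_coord j); apply: eq_bigr => z _.
pose a i z' := if i == j then (z' == z)%:R * q z' else
  if i == k then q z' * F z z' else q z'.
transitivity (\sum_(w : {ffun I -> Z}) \prod_i a i (w i)).
  apply: eq_bigr => w _; rewrite (bigD1 j) //= (bigD1 k) ?(eq_sym k) //=.
  rewrite [RHS](bigD1 j) //= [in RHS](bigD1 k) ?(eq_sym k) //= /a !eqxx.
  rewrite (eq_sym k) (negPf jk).
  case: eqP => [->|]; last by rewrite !mul0r.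
  rewrite !mul1r -!mulrA; congr (_ * (_ * _)); rewrite mulrC; congr (_ * _).
  by apply: eq_bigr => i /andP[/negPf -> /negPf ->].
rewrite -(bigA_distr_bigA a) (bigD1 j) //= (bigD1 k) ?(eq_sym k) //=.
rewrite [X in _ * (_ * X)]big1 ?mulr1 => [|i /andP[/negPf ij /negPf ik]].
  congr (_ * _); last first.
    by apply: eq_bigr => z' _; rewrite /a (eq_sym k) (negPf jk) eqxx.
  rewrite (bigD1 z) //= /a !eqxx mul1r big1 ?addr0 // => z' /negPf ->.
  by rewrite mul0r.
rewrite -[RHS]q1.
by apply: eq_bigr => z' _; rewrite /a ij ik.
Qed.

End ProductSums.

(** * Domination of the invaded cluster *)

Section Bernoulli.
Variable R : realFieldType.

(** With y = (1 - p) (r + 1) / r this is the maximality of p (1 - p)^r at p = 1 / (r + 1). Passing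
    from r to r + 1 lowers the left side by (r + 1) y^r (1 - y)^2. *)
Lemma bernoulli_expr (r : nat) (y : R) : 0 <= y ->
  (1 + r%:R * (1 - y)) * y ^+ r <= 1.
Proof.
move=> y0; elim: r => [|r IHr]; first by rewrite mul0r addr0 mul1r expr0.
apply: le_trans IHr; rewrite -subr_ge0 -natr1 exprS.
set t := y ^+ r; set c : R := r%:R.
have -> : (1 + c * (1 - y)) * t - (1 + (c + 1) * (1 - y)) * (y * t) =
          (c + 1) * (t * (1 - y) ^+ 2) by ring.
apply: mulr_ge0; first by rewrite addr_ge0 ?ler0n.
by apply: mulr_ge0; [apply: exprn_ge0 | apply: sqr_ge0].
Qed.

(* In terms of f = p e / (1 - p) the recursion reads f' = p (1 - p)^r (1 + f)^(r+1),
   and p (1 - p)^r is maximal at p = 1 / (r + 1), where f = 1 / r is a fixed point. *)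
Lemma dual_parameter_step (r : nat) (p e : R) : 0 <= p <= 1 -> 0 <= e ->
  r%:R * (p * e) <= 1 - p -> r%:R * (p * (1 - p + p * e) ^+ r.+1) <= 1 - p.
Proof.
case/andP=> p0 p1 e0; case: r => [|r]; first by rewrite !mul0r subr_ge0.
have := bernoulli_expr r.+1; have : 0 < r.+1%:R :> R by rewrite ltr0n.
move: r.+1%:R => c c0 hb h.
have c_neq0 : c != 0 by rewrite gt_eqF.
have c1_neq0 : c + 1 != 0 by rewrite gt_eqF // addr_gt0.
(* [y] is 1 - p rescaled to equal 1 at p = 1 / (c + 1); the hypothesis on [e] amounts to
   [z <= y]. *)
set z := 1 - p + p * e; pose y := (c + 1) / c * (1 - p).
have z0 : 0 <= z by rewrite addr_ge0 ?subr_ge0 ?mulr_ge0.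
have zy : z <= y.
  by rewrite /y mulrAC ler_pdivlMr // /z; lra.
have y0 : 0 <= y by apply: le_trans zy.
move: {hb}(hb _ y0) => hb.
have -> : 1 - p = c / (c + 1) * y.
  by rewrite /y; field; rewrite c_neq0 c1_neq0.
have pE : p = (1 + c * (1 - y)) / (c + 1).
  by rewrite /y; field; rewrite c_neq0 c1_neq0.
apply: (@le_trans _ _ (c * (p * y ^+ r.+2))).
  apply: ler_wpM2l; first exact: ltW.
  by apply: ler_wpM2l => //; apply: lerXn2r.
rewrite exprSr [in leLHS]pE.
have -> : c * ((1 + c * (1 - y)) / (c + 1) * (y ^+ r.+1 * y)) =
    c / (c + 1) * y * ((1 + c * (1 - y)) * y ^+ r.+1) by ring.
by rewrite ler_piMr // mulr_ge0 // divr_ge0 // ?addr_ge0 ?ltW.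
Qed.

End Bernoulli.

Section Invasion.
Variables (r M : nat).
Notation sigma := r.+1.
Notation label := 'I_M.+1.

Section Definitions.

(* A label l stands for the weight l + 1, so that the empty maximum 0 lies below
   all weights; pathmin w is the least k such that the edges of weight at most k
   connect the root to height n. *)
Definition edgemax (T : Type) (m : T -> nat) (z : label * T) : nat := maxn z.1.+1 (m z.2).

Fixpoint pathmin n : labeling sigma label n -> nat :=
  match n return labeling sigma label n -> nat with
  | 0%N => fun _ => 0%N
  | n'.+1 => fun w =>
      edgemax (@pathmin n')
        (lbranch w [arg min_(j < ord0) edgemax (@pathmin n') (lbranch w j)])
  end.

Definition argpath n (w : labeling sigma label n.+1) : 'I_sigma :=
  [arg min_(j < ord0) edgemax (@pathmin n) (lbranch w j)].

Definition bmin n : label * labeling sigma label n -> nat := edgemax (@pathmin n).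

Fixpoint level n (k : nat) : labeling sigma label n -> hcluster sigma n :=
  match n return labeling sigma label n -> hcluster sigma n with
  | 0%N => fun w => w
  | n'.+1 => fun w => [ffun i => if (lbranch w i).1 < k then
                          Some (@level n' k (lbranch w i).2) else None]
  end%N.

Definition blevel n (k : nat) (z : label * labeling sigma label n) :
    option (hcluster sigma n) :=
  if (z.1 < k)%N then Some (level k z.2) else None.

(* The invasion cluster at the time it reaches height n (in the absence of ties). *)
Fixpoint invaded n : labeling sigma label n -> hcluster sigma n :=
  match n return labeling sigma label n -> hcluster sigma n with
  | 0%N => fun w => w
  | n'.+1 => fun w =>
      [ffun i => if i == @argpath n' w then Some (@invaded n' (lbranch w i).2)
                 else blevel (@pathmin n'.+1 w) (lbranch w i)]
  end.

(** Only ties along the optimal path count: at each of its vertices the best branch must be strictly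
    better than the others. Labels elsewhere may repeat. *)
Fixpoint noties n : labeling sigma label n -> bool :=
  match n return labeling sigma label n -> bool with
  | 0%N => fun w => true
  | n'.+1 => fun w =>
      noties (lbranch w (@argpath n' w)).2 &&
      [forall i, (i != @argpath n' w) ==>
         (bmin (lbranch w (@argpath n' w)) < bmin (lbranch w i))%N]
  end.

Lemma pathminS n (w : labeling sigma label n.+1) :
  pathmin w = bmin (lbranch w (argpath w)).
Proof. by []. Qed.

Lemma notiesS n (w : labeling sigma label n.+1) :
  noties w = noties (lbranch w (argpath w)).2 &&
    [forall i, (i != argpath w) ==>
       (bmin (lbranch w (argpath w)) < bmin (lbranch w i))%N].
Proof. by []. Qed.

Lemma invadedS n (w : labeling sigma label n.+1) :
  invaded w = [ffun i => if i == argpath w then Some (invaded (lbranch w i).2)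
                 else blevel (pathmin w) (lbranch w i)] :> hcluster _ n.+1.
Proof. by []. Qed.

Lemma pathmin_le n (w : labeling sigma label n.+1) i :
  (pathmin w <= bmin (lbranch w i))%N.
Proof. by rewrite pathminS /argpath; case: arg_minnP => // j _; apply. Qed.

Lemma lt_pathmin n (w : labeling sigma label n.+1) k :
  (k < pathmin w)%N = [forall i, (k < bmin (lbranch w i))%N].
Proof.
apply/idP/forallP => [h i|]; last by rewrite pathminS; apply.
exact: leq_trans h (pathmin_le w i).
Qed.

End Definitions.

Variables (R : realFieldType) (q : label -> R).
Hypotheses (q0 : forall l, 0 <= q l) (q1 : \sum_l q l = 1).

Let p : R := sigma%:R^-1.
Let p01 : 0 <= p <= 1.
Proof. by rewrite invr_ge0 ler0n invf_le1 ?ler1n ?ltr0n. Qed.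

Definition below (k : nat) (l : label) : bool := (l < k)%N.

Definition subcdf (k : nat) : R := \sum_(l | below k l) q l.

Definition blocked n (k : nat) : R :=
  \sum_(w : labeling sigma label n | (k < pathmin w)%N) lab_law q w.

Definition bblocked n (k : nat) : R := 
  \sum_(z : label * labeling sigma label n | (k < bmin z)%N) lbranch_law q z.

Lemma subcdf_itv k : 0 <= subcdf k <= 1.
Proof.
rewrite sumr_ge0 //= -q1 [leRHS](bigID (below k)) /=.
by rewrite lerDl sumr_ge0.
Qed.

(** Split on the top edge of the branch. If its weight exceeds [k], the branch is blocked and its
    cluster absent; otherwise the subtree below has to be blocked. *)
Lemma sum_blocked n k (h : option (hcluster sigma n) -> R) :
  \sum_(z | (k < bmin z)%N) lbranch_law q z * h (blevel k z) =
  (1 - subcdf k) * h None +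
  subcdf k * \sum_(w : labeling sigma label n | (k < pathmin w)%N)
                lab_law q w * h (Some (level k w)).
Proof.
rewrite big_mkcond sum_lbranch (bigID (below k)) /= addrC.
congr (_ + _).
  have -> : 1 - subcdf k = \sum_(l : label | ~~ below k l) q l.
    by apply/eqP; rewrite subr_eq -q1 [in eqbLHS](bigID (below k)) /= addrC.
  rewrite mulr_suml; apply: eq_bigr => l; rewrite -leqNgt => kl.
  transitivity (\sum_(w : labeling sigma label n) q l * h None * lab_law q w).
    apply: eq_bigr => w _; rewrite /bmin /edgemax /= leq_max ltnS kl /=.
    by rewrite /lbranch_law /blevel /= ltnNge kl /= mulrAC.
  by rewrite -mulr_sumr sum_lab_law // mulr1.
rewrite mulr_suml; apply: eq_bigr => l; rewrite /below => lk.
rewrite mulr_sumr [RHS]big_mkcond; apply: eq_bigr => w _.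
rewrite /bmin /edgemax /= leq_max ltnS leqNgt lk /= /lbranch_law /blevel /= lk.
by case: ifP => // _; rewrite mulrA.
Qed.

Lemma bblockedE n k : bblocked n k = 1 - subcdf k + subcdf k * blocked n k.
Proof.
have := @sum_blocked n k (fun=> 1); rewrite mulr1.
rewrite /bblocked /blocked.
by under eq_bigr do rewrite mulr1; under [in X in _ + X]eq_bigr do rewrite mulr1.
Qed.

Lemma blockedS n k : blocked n.+1 k = bblocked n k ^+ sigma.
Proof.
rewrite /blocked /bblocked -[X in _ ^+ X](card_ord sigma) -prodr_const.
under [in RHS]eq_bigr do rewrite big_mkcond.
rewrite bigA_distr_bigA /= big_mkcond sum_labeling; apply: eq_bigr => w _.
rewrite lt_pathmin; case: ifPn => [/forallP h|].
  by apply: eq_bigr => i _; rewrite h.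
rewrite negb_forall => /existsP[i /negPf hi].
by rewrite (bigD1 i) //= [X in if X then _ else _]hi mul0r.
Qed.

Lemma blocked_ge0 n k : 0 <= blocked n k.
Proof. by apply: sumr_ge0 => w _; apply: lab_law_ge0. Qed.

Lemma bblocked_ge0 n k : 0 <= bblocked n k.
Proof. by apply: sumr_ge0 => w _; apply: lbranch_law_ge0. Qed.

(** Equivalent to c e / (1 - c + c e) <= 1 / (r + 1), with c = [subcdf k] and e = [blocked n k]:
    given that a branch is blocked at level [k], its top edge is open with probability at most the
    critical one. *)
Lemma blocked_bound n k : r%:R * (subcdf k * blocked n k) <= 1 - subcdf k.
Proof.
have /andP[_ c1] := subcdf_itv k.
elim: n => [|n IHn].
  by rewrite /blocked big_pred0 // !mulr0 subr_ge0.
rewrite blockedS bblockedE; apply: dual_parameter_step => //.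
- exact: subcdf_itv.
- exact: blocked_ge0.
Qed.

Lemma perc_sum_ge n (h : option (hcluster sigma n) -> R) :
  (forall x y, ole (@cle sigma n) x y -> h x <= h y) ->
  h None <= \sum_s perc_law p s * h (Some s).
Proof.
move=> hm; rewrite -[leLHS]mul1r -(sum_perc_law sigma p n) mulr_suml.
by apply: ler_sum => s _; rewrite ler_wpM2l ?perc_law_ge0 // hm.
Qed.

Definition cle_mono n (f : hcluster sigma n -> R) :=
  forall s t, cle s t -> f s <= f t.

(** Percolation at level [k] conditioned not to reach height [n] is dominated by critical
    percolation, with the probability of the condition multiplied out. *)
Let level_dom n k := forall f : hcluster sigma n -> R,
  (forall s, 0 <= f s) -> cle_mono f ->
  \sum_(w : labeling sigma label n | (k < pathmin w)%N) lab_law q w * f (level k w)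
  <= blocked n k * \sum_s perc_law p s * f s.

Let blevel_dom n k := forall h : option (hcluster sigma n) -> R,
  (forall y, 0 <= h y) -> (forall y z, ole (@cle sigma n) y z -> h y <= h z) ->
  \sum_(z | (k < bmin z)%N) lbranch_law q z * h (blevel k z) <=
  bblocked n k * \sum_y branch_law p (@perc_law sigma R p n) y * h y.

Let blevel_dom_of_level_dom n k : level_dom n k -> blevel_dom n k.
Proof.
move=> IHn h h0 hm; rewrite sum_blocked bblockedE sum_option /=.
have /andP[c0 c1] := subcdf_itv k.
have := IHn (fun s => h (Some s)) (fun s => h0 _) (fun s t st => hm (Some s) (Some t) st).
move=> /(ler_wpM2l c0).
under [in X in _ -> _ <= _ * (_ + X)]eq_bigr do rewrite -mulrA.
rewrite -mulr_sumr.
have := perc_sum_ge hm; have := blocked_bound n k; have := blocked_ge0 n k.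
set c := subcdf k in c0 c1 *; set e := blocked n k.
set H0 := h None; set H1 := \sum_s _ * _; set X := \sum_(w | _) _.
move=> e0 ce H01 cX.
apply: (@le_trans _ _ ((1 - c) * H0 + c * (e * H1))); first by rewrite lerD2l.
(* The gap factors. The first factor is nonnegative by [blocked_bound], since 1 - p = p r, and the
   second because an absent branch is the least cluster. *)
rewrite -subr_ge0.
have -> : (1 - c + c * e) * ((1 - p) * H0 + p * H1) - ((1 - c) * H0 + c * (e * H1)) =
  (p * (1 - c) - (1 - p) * (c * e)) * (H1 - H0) by ring.
rewrite mulr_ge0 ?subr_ge0 //.
have -> : 1 - p = p * r%:R.
  by rewrite /p -natr1; field; rewrite ?(addrC 1) natr1 pnatr_eq0.
by rewrite -mulrA ler_wpM2l //; case/andP: p01.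
Qed.

Lemma level_dominated n k : level_dom n k.
Proof.
elim: n => [|n IHn] f f0 fm.
  (* At height 0 [pathmin] is 0, so nothing is blocked and the left sum is empty. *)
  by rewrite big_pred0 // mulr_ge0 ?blocked_ge0 // sumr_ge0 // => s _; rewrite mulr_ge0 ?perc_law_ge0.
rewrite blockedS.
(* Blocking the root means blocking every branch, so restricting to this event leaves a product
   measure, with unnormalised factors. *)
pose a (i : 'I_sigma) (z : label * labeling sigma label n) :=
  if (k < bmin z)%N then lbranch_law q z else 0.
pose b (i : 'I_sigma) y := bblocked n k * branch_law p (@perc_law sigma R p n) y.
have := @dominated_prod_pushforward R _ _ _ (ole_refl (@cle_refl sigma n)) _
  (fun=> @blevel n k) a b f.
move=> /(_ _ _ _ f0 fm) dom.
apply: le_trans; last apply: (le_trans (dom _ _ _)).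
- rewrite big_mkcond sum_labeling; apply: ler_sum => w _.
  rewrite lt_pathmin; case: ifPn => [/forallP h|_].
    rewrite le_eqVlt; apply/orP; left; apply/eqP; congr (_ * _).
    by apply: eq_bigr => i _; have := h i; rewrite /a /lbranch => ->.
  by rewrite mulr_ge0 // prodr_ge0 // => i _; rewrite /a; case: ifP => // _; apply: lbranch_law_ge0.
- by move=> i z; rewrite /a; case: ifP => // _; apply: lbranch_law_ge0.
- by move=> i y; rewrite mulr_ge0 ?bblocked_ge0 // branch_law_ge0 // => t; apply: perc_law_ge0.
- move=> i h h0 hm; have := blevel_dom_of_level_dom IHn h0 hm; rewrite big_mkcond mulr_sumr.
  under [in X in _ <= X -> _]eq_bigr do rewrite mulrA.
  congr (_ <= _); apply: eq_bigr => z _; rewrite /a; case: ifP => //; by rewrite mul0r.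
- rewrite sum_cluster mulr_sumr; apply: ler_sum => y _.
  by rewrite /b big_split /= prodr_const card_ord mulrA.
Qed.

Lemma blevel_dominated n k : blevel_dom n k.
Proof. exact/blevel_dom_of_level_dom/level_dominated. Qed.

End Invasion.

Section InvadedLaw.
Variables (r M : nat) (R : realFieldType) (q : 'I_M.+1 -> R).
Notation sigma := r.+1.
Notation label := 'I_M.+1.
Hypotheses (q0 : forall l, 0 <= q l) (q1 : \sum_l q l = 1).

Let p : R := sigma%:R^-1.
Let p01 : 0 <= p <= 1.
Proof. by rewrite invr_ge0 ler0n invf_le1 ?ler1n ?ltr0n. Qed.

Notation zlaw := (lbranch_law q).
Notation ylaw n := (branch_law p (@perc_law sigma R p n)).

Let zlaw_ge0 n (z : label * labeling sigma label n) : 0 <= zlaw z.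
Proof. exact: lbranch_law_ge0. Qed.

Let ylaw_ge0 n y : 0 <= ylaw n y.
Proof. by apply: branch_law_ge0 => // t; apply: perc_law_ge0. Qed.

(** The mean of [f] when branch [j] is present and equal to [s] and the other branches are
    independent critical percolations. *)
Definition rest n (j : 'I_sigma) (f : hcluster sigma n.+1 -> R) (s : hcluster sigma n) : R :=
  \sum_(y : {ffun 'I_sigma -> option (hcluster sigma n)})
    (\prod_i if i == j then (y i == Some s)%:R else ylaw n (y i)) * f y.

Lemma rest_ge0 n j f : (forall s, 0 <= f s) -> forall s, 0 <= @rest n j f s.
Proof.
move=> f0 s; apply: sumr_ge0 => y _; rewrite mulr_ge0 // prodr_ge0 // => i _.
by case: ifP.
Qed.

Lemma rest_mono n j f : (forall s, 0 <= f s) -> cle_mono f -> cle_mono (@rest n j f).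
Proof.
move=> f0 fm s t st; apply: (dominated_prod (ole_refl (@cle_refl sigma n))
  (a := fun i y => if i == j then (y == Some s)%:R else ylaw n y)
  (b := fun i y => if i == j then (y == Some t)%:R else ylaw n y)) => //.
- by move=> i y; case: ifP.
- by move=> i y; case: ifP.
- move=> i h h0 hm; case: (i == j) => //.
  have E (u : hcluster sigma n) : \sum_y (y == Some u)%:R * h y = h (Some u) :> R.
    rewrite (bigD1 (Some u)) //= eqxx mul1r big1 ?addr0 // => y /negPf ->.
    by rewrite mul0r.
  by rewrite !E; apply: hm.
Qed.

(** Backbone decomposition of the size-biased law: the frontier is a sum over the children, and term
    [j] biases branch [j] alone. The factor [sigma] is 1 / p, because the edge to the backbone child
    costs p in [perc_law] and nothing in [rest]. *)
Lemma sum_rest n (f : hcluster sigma n.+1 -> R) :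
  \sum_j \sum_s iic_law p s * rest j f s =
  sigma%:R * \sum_s iic_law p s * f s.
Proof.
transitivity (\sum_j \sum_(y : {ffun 'I_sigma -> option (hcluster sigma n)})
   (\prod_(i | i != j) ylaw n (y i)) *
   (if y j is Some s then iic_law p s else 0) * f y).
  apply: eq_bigr => j _; under eq_bigr do rewrite mulr_sumr.
  rewrite exchange_big /=; apply: eq_bigr => y _.
  under eq_bigr do rewrite mulrA; rewrite -mulr_suml; congr (_ * _).
  have E s : iic_law p s * \prod_i (if i == j then (y i == Some s)%:R else ylaw n (y i)) =
      (\prod_(i | i != j) ylaw n (y i)) * (iic_law p s * (y j == Some s)%:R).
    rewrite (bigD1 j) //= eqxx [LHS]mulrA [LHS]mulrC; congr (_ * _).
    by apply: eq_bigr => i /negPf ->.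
  rewrite (eq_bigr _ (fun s _ => E s)) -mulr_sumr; congr (_ * _).
  case: (y j) => [s|]; last by rewrite big1 // => s _; rewrite mulr0.
  rewrite (bigD1 s) //= eqxx mulr1 big1 ?addr0 // => t /negPf ts.
  by rewrite (inj_eq (@Some_inj _)) eq_sym ts mulr0.
rewrite exchange_big /= mulr_sumr sum_cluster; apply: eq_bigr => y _.
rewrite -mulr_suml /iic_law /= !mulrA natr_sum !mulr_sumr; congr (_ * _).
apply: eq_bigr => j _; rewrite [in RHS](bigD1 j) //= /branch.
case: (y j) => [s|]; last by rewrite !mulr0.
rewrite /= /p; field.
by rewrite addrC natr1 pnatr_eq0.
Qed.

Definition unique_argmin n (w : {ffun 'I_sigma -> label * labeling sigma label n}) j :=
  [forall i, (i != j) ==> (bmin (w j) < bmin (w i))%N].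

(** By symmetry the left side sums over [j] the contribution of the event that branch [j] is
    strictly best. These events are disjoint and leave out the ties, hence an inequality. *)
Lemma sum_unique_argmin n (g : nat -> R) : (forall k, 0 <= g k) ->
  sigma%:R * (\sum_z @lbranch_law sigma _ _ q n z * (g (bmin z) * bblocked r q n (bmin z) ^+ r)) <=
  \sum_(w : labeling sigma label n.+1) lab_law q w * g (pathmin w).
Proof.
move=> g0; rewrite -[X in X%:R * _](card_ord sigma) mulr_natl -sumr_const.
(* The weight of the value [z'] on branch [i] when branch [j] carries [z] and is strictly best. *)
pose a (j : 'I_sigma) (z : label * labeling sigma label n) (i : 'I_sigma) z' :=
  if i == j then (z' == z)%:R * zlaw z' else if (bmin z < bmin z')%N then zlaw z' else 0.
have E j : \sum_z @lbranch_law sigma _ _ q n z * (g (bmin z) * bblocked r q n (bmin z) ^+ r) =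
  \sum_(w : {ffun 'I_sigma -> label * labeling sigma label n})
     (unique_argmin w j)%:R * (lab_law q (w : labeling sigma label n.+1) * g (bmin (w j))).
  rewrite [RHS](sum_fix_coord j); apply: eq_bigr => z _.
  transitivity (g (bmin z) * \prod_i \sum_z' a j z i z').
    rewrite mulrCA; congr (_ * _); rewrite (bigD1 j) //=; congr (_ * _).
      rewrite (bigD1 z) //= /a !eqxx mul1r big1 ?addr0 // => z' /negPf ->.
      by rewrite mul0r.
    rewrite (eq_bigr (fun=> bblocked r q n (bmin z))).
      by rewrite prodr_const cardC1 card_ord.
    by move=> i /negPf ij; rewrite /bblocked [RHS]big_mkcond /a ij.
  rewrite bigA_distr_bigA mulr_sumr; apply: eq_bigr => w _.
  have -> : lab_law q (w : labeling sigma label n.+1) =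
      zlaw (w j) * \prod_(i | i != j) zlaw (w i) by exact: bigD1.
  rewrite (bigD1 j) //= {1}/a eqxx.
  case: (eqVneq (w j) z) => [wj|_]; last by rewrite !mul0r mulr0.
  suff -> : \prod_(i | i != j) a j z i (w i) =
      (unique_argmin w j)%:R * \prod_(i | i != j) zlaw (w i) by rewrite wj; ring.
  case: (boolP (unique_argmin w j)) => [/forallP u|].
    rewrite mul1r; apply: eq_bigr => i ij; rewrite /a (negPf ij).
    by have := u i; rewrite ij wj /= => ->.
  rewrite negb_forall => /existsP[i]; rewrite negb_imply wj => /andP[ij /negPf u].
  by rewrite mul0r (bigD1 i) //= /a (negPf ij) u mul0r.
rewrite (eq_bigr _ (fun j _ => E j)) exchange_big /= sum_labeling.
apply: ler_sum => w _.
have lg0 : 0 <= lab_law q (w : labeling sigma label n.+1) * g (pathmin (w : labeling sigma label n.+1)).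
  by rewrite mulr_ge0 ?lab_law_ge0.
case: (pickP (unique_argmin w)) => [j uj|no]; last first.
  by rewrite big1 // => j _; rewrite no mul0r.
have ujE i : i != j -> unique_argmin w i = false.
  move=> ij; apply/negP => /forallP /(_ j); rewrite eq_sym ij /=.
  by move/forallP: uj => /(_ i); rewrite ij /= => h1 h2; have := ltn_trans h1 h2; rewrite ltnn.
rewrite (bigD1 j) //= [X in _ + X]big1 ?addr0 => [|i ij]; last by rewrite (ujE _ ij) mul0r.
rewrite uj mul1r le_eqVlt; apply/orP; left; apply/eqP; congr (_ * g _).
apply/eqP; rewrite eqn_leq (pathmin_le (w : labeling sigma label n.+1) j) andbT.
rewrite leqNgt; apply/negP; rewrite -/(bmin _) -/(argpath (w : labeling sigma label n.+1)) /lbranch => k.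
have [ij|ij] := eqVneq (argpath (w : labeling sigma label n.+1)) j.
  by rewrite ij ltnn in k.
by move/forallP: uj => /(_ _)/implyP/(_ ij) /(ltn_trans k); rewrite ltnn.
Qed.

(** As [g] is arbitrary, this is domination given each value of the level. That the [r] other
    branches are strictly worse than the best one has a probability depending only on the level, so
    it is absorbed into the weight [h] used for the best branch. *)
Lemma invaded_dominated n (f : hcluster sigma n -> R) (g : nat -> R) :
  (forall s, 0 <= f s) -> cle_mono f -> (forall k, 0 <= g k) ->
  \sum_(w : labeling sigma label n | noties w)
     lab_law q w * (f (invaded w) * g (pathmin w)) <=
  (\sum_s iic_law p s * f s) * \sum_(w : labeling sigma label n) lab_law q w * g (pathmin w).
Proof.
elim: n f g => [|n IHn] f g f0 fm g0.
  have sum_unit (F : unit -> R) : \sum_(x : unit) F x = F tt.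
    by rewrite (bigD1 tt) //= big1 ?addr0 //; case.
  rewrite [leLHS]big_mkcond [leLHS]sum_unit [X in _ <= X * _]sum_unit.
  by rewrite [X in _ <= _ * X]sum_unit /iic_law /= !mul1r.
pose h (k : nat) := g k * bblocked r q n k ^+ r.
have h0 k : 0 <= h k by rewrite mulr_ge0 // exprn_ge0 // bblocked_ge0.
have step j : \sum_(w : labeling sigma label n.+1 | noties w && (argpath w == j))
     lab_law q w * (f (invaded w) * g (pathmin w)) <=
     (\sum_s iic_law p s * rest j f s) * \sum_(z : label * labeling sigma label n) zlaw z * h (bmin z).
  rewrite big_mkcond sum_labeling (sum_fix_coord j).
  (* Fix the content [z] of the best branch. The others are then independent and blocked at level
     [bmin z], hence dominated by critical branches; averaging over them turns [f] into
     [rest j f]. *)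
  apply: (@le_trans _ _ (\sum_z (noties z.2)%:R * (zlaw z * h (bmin z)) * rest j f (invaded z.2))).
    apply: ler_sum => z _.
    case: (boolP (noties z.2)) => [nz|nz]; last first.
      rewrite big1 ?mul0r // => w _; case: (eqVneq (w j) z) => [wz|_]; last by rewrite mul0r.
      case: ifP => [/andP[+ /eqP wj]|]; last by rewrite mulr0.
      by rewrite notiesS wj /lbranch wz (negPf nz).
    rewrite mul1r /h.
    pose a (i : 'I_sigma) (z' : label * labeling sigma label n) : R :=
      if i == j then (z' == z)%:R * zlaw z'
      else if (bmin z < bmin z')%N then zlaw z' else 0.
    pose phi (i : 'I_sigma) (z' : label * labeling sigma label n) :=
      if i == j then Some (invaded z.2) else blevel (bmin z) z'.
    pose b (i : 'I_sigma) (y : option (hcluster sigma n)) :=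
      (if i == j then zlaw z else bblocked r q n (bmin z)) *
      (if i == j then (y == Some (invaded z.2))%:R else ylaw n y).
    have a0 i z' : 0 <= a i z' by rewrite /a; case: ifP => _; [rewrite mulr_ge0|case: ifP].
    have b0 i y : 0 <= b i y.
      by rewrite /b; case: ifP => _; rewrite mulr_ge0 ?bblocked_ge0.
    have := @dominated_prod_pushforward R _ _ _ (ole_refl (@cle_refl sigma n)) _ phi a b f a0 b0 _ f0 fm.
    move=> dom.
    apply: (@le_trans _ _ (g (bmin z) *
       \sum_(w : {ffun 'I_sigma -> label * labeling sigma label n})
         (\prod_i a i (w i)) * f [ffun i => phi i (w i)])).
      rewrite mulr_sumr; apply: ler_sum => w _.
      case: (eqVneq (w j) z) => [wz|_]; last first.
        by rewrite mul0r !mulr_ge0 // prodr_ge0.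
      rewrite mul1r; case: ifP => [|_]; last by rewrite !mulr_ge0 // prodr_ge0.
      case/andP; rewrite notiesS => /andP[_ /forallP nt] /eqP wj.
      rewrite pathminS wj /lbranch wz mulrCA mulrC -mulrA mulrCA.
      rewrite le_eqVlt; apply/orP; left; apply/eqP; congr (_ * _); congr (_ * _).
        apply: eq_bigr => i _; rewrite /a /lbranch; case: (eqVneq i j) => [->|ij].
          by rewrite wz eqxx mul1r.
        by have := nt i; rewrite wj ij /= /lbranch wz => ->.
      congr f; apply/ffunP => i; rewrite !ffunE wj /phi; case: eqP => [->|//].
        by rewrite /lbranch wz.
      by rewrite pathminS wj /lbranch wz.
    rewrite mulrCA -!mulrA; apply: ler_wpM2l => //; apply: le_trans (dom _) _.
      move=> i H H0 Hm; rewrite /a /phi /b; case: (eqVneq i j) => ij.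
        rewrite (bigD1 z) //= eqxx mul1r big1 ?addr0 => [|z' /negPf ->]; last by rewrite !mul0r.
        rewrite (bigD1 (Some (invaded z.2))) //= eqxx mulr1 big1 ?addr0 // => y /negPf ->.
        by rewrite mulr0 mul0r.
      have := blevel_dominated q0 q1 (bmin z) H0 Hm; rewrite big_mkcond mulr_sumr.
      under [in X in _ <= X -> _]eq_bigr do rewrite mulrA.
      by congr (_ <= _); apply: eq_bigr => z' _; case: ifP; rewrite ?mul0r.
    rewrite /rest !mulr_sumr; apply: ler_sum => y _.
    rewrite /b big_split /= (bigD1 j) //= eqxx.
    rewrite (eq_bigr (fun=> bblocked r q n (bmin z))); last by move=> i /negPf ->.
    by rewrite prodr_const cardC1 card_ord /= !mulrA.
  rewrite sum_lbranch mulr_sumr sum_lbranch; apply: ler_sum => l _.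
  (* For a fixed first label [l], the level of the branch is the maximum of the weight [l.+1] and
     the level of its subtree. *)
  have := IHn (rest j f) (fun k => h (maxn l.+1 k)) (@rest_ge0 _ j f f0) (@rest_mono _ j f f0 fm) (fun k => h0 _).
  move=> /(ler_wpM2l (q0 l)); rewrite mulrCA; congr (_ <= _).
    rewrite big_mkcond mulr_sumr; apply: eq_bigr => w _.
    rewrite /lbranch_law /bmin /edgemax /=; case: ifP => _; last by rewrite !(mulr0, mul0r).
    by rewrite mul1r; ring.
  rewrite -[RHS]mulr_sumr; congr (_ * _); rewrite mulr_sumr; apply: eq_bigr => w _.
  by rewrite /lbranch_law /bmin /edgemax /= mulrA.
rewrite (partition_big (@argpath r M n) xpredT) //=.
apply: le_trans (ler_sum _ (fun j _ => step j)) _.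
(* The factor [sigma] produced by the choice of the backbone child is the one absorbed by
   [sum_unique_argmin]. *)
rewrite -mulr_suml sum_rest mulrAC mulrC; apply: ler_wpM2l.
  by apply: sumr_ge0 => s _; rewrite mulr_ge0 // iic_law_ge0.
exact: sum_unique_argmin.
Qed.

End InvadedLaw.

(** * Probability of ties, for labels with atoms of mass at most [c] *)

Section Ties.
Variables (r M : nat) (R : realFieldType) (q : 'I_M.+1 -> R) (c : R).
Notation sigma := r.+1.
Notation label := 'I_M.+1.
Hypotheses (q0 : forall l, 0 <= q l) (q1 : \sum_l q l = 1) (qc : forall l, q l <= c).

Notation zlaw := (lbranch_law q).

(** The number of edges below height [n]. For positive [n], [pathmin] is the weight of one of them,
    so a union bound gives each value mass at most this number times [c]. *)
Fixpoint atom_bound n : nat := if n is n'.+1 then sigma * (atom_bound n').+1 else 0.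

Let c0 : 0 <= c. Proof. exact: le_trans (q0 ord0) (qc ord0). Qed.

Let zlaw_ge0 n (z : label * labeling sigma label n) : 0 <= zlaw z.
Proof. exact: lbranch_law_ge0. Qed.

Let zlaw1 n : \sum_(z : label * labeling sigma label n) zlaw z = 1.
Proof. exact/sum_lbranch_law/sum_lab_law. Qed.

Let sum_indic (T : finType) (F : T -> R) (P : pred T) :
  \sum_(x | P x) F x = \sum_x F x * (P x)%:R.
Proof.
by rewrite big_mkcond; apply: eq_bigr => x _; case: (P x); rewrite ?mulr1 ?mulr0.
Qed.

Let bmin_atom_of n k :
  (forall k, (0 < k)%N -> \sum_(w : labeling sigma label n | pathmin w == k)
     lab_law q w <= (atom_bound n)%:R * c) ->
  \sum_(z : label * labeling sigma label n | bmin z == k) zlaw z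
    <= (atom_bound n).+1%:R * c.
Proof.
move=> IH; case: (posnP k) => [->|k0].
  rewrite big_pred0 ?mulr_ge0 //.
  by move=> [l w]; rewrite /bmin /edgemax /= -leqn0 leqNgt leq_max ltn0Sn.
apply: (@le_trans _ _ (\sum_(z : label * labeling sigma label n)
   zlaw z * ((z.1.+1 == k)%:R + (pathmin z.2 == k)%:R))).
  rewrite sum_indic; apply: ler_sum => z _; apply: ler_wpM2l => //.
  rewrite /bmin /edgemax; case: (leqP z.1.+1 (pathmin z.2)) => _.
    by rewrite lerDr.
  by rewrite lerDl.
under eq_bigr do rewrite mulrDr.
rewrite big_split /= -natr1 mulrDl mul1r addrC; apply: lerD.
  rewrite sum_lbranch /lbranch_law /=.
  apply: (@le_trans _ _ (\sum_l q l * ((atom_bound n)%:R * c))); last by rewrite -mulr_suml q1 mul1r.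
  apply: ler_sum => l _; under eq_bigr do rewrite -mulrA.
  by rewrite -mulr_sumr ler_wpM2l // -sum_indic IH.
rewrite sum_lbranch /lbranch_law /=.
under eq_bigr => l _.
  under eq_bigr do rewrite mulrAC.
  rewrite -mulr_sumr sum_lab_law // mulr1; over.
rewrite -(sum_indic (fun l : label => q l)).
case: (pickP (fun l : label => l.+1 == k)) => [l lk|no]; last by rewrite big_pred0.
rewrite (big_pred1 l) // => l' /=; apply/eqP/eqP => [l'k|->]; last exact/eqP.
by apply/val_inj/succn_inj; rewrite /= l'k (eqP lk).
Qed.

Lemma pathmin_atom n k : (0 < k)%N ->
  \sum_(w : labeling sigma label n | pathmin w == k) lab_law q w
    <= (atom_bound n)%:R * c.
Proof.
elim: n k => [|n IHn] k k0.
  by rewrite big_pred0 ?mul0r //= => _; case: k k0.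
apply: (@le_trans _ _ (\sum_(w : {ffun 'I_sigma -> label * labeling sigma label n})
   (\prod_i zlaw (w i)) * \sum_j (bmin (w j) == k)%:R)).
  rewrite sum_indic sum_labeling; apply: ler_sum => w _; apply: ler_wpM2l.
    exact: (lab_law_ge0 q0 (w : labeling sigma label n.+1)).
  rewrite pathminS (bigD1 (argpath (w : labeling sigma label n.+1))) //= /lbranch.
  by rewrite lerDl sumr_ge0.
under eq_bigr do rewrite mulr_sumr.
rewrite exchange_big /= natrM -mulrA -[X in X%:R * _](card_ord sigma) mulr_natl -sumr_const.
apply: ler_sum => j _.
rewrite (sum_prod_marginal (zlaw1 n) j (fun z => (bmin z == k)%:R)) -sum_indic.
exact: bmin_atom_of.
Qed.

Lemma bmin_atom n k :
  \sum_(z : label * labeling sigma label n | bmin z == k) zlaw z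
    <= (atom_bound n).+1%:R * c.
Proof. exact/bmin_atom_of/pathmin_atom. Qed.

Fixpoint tie_bound n : nat :=
  if n is n'.+1 then sigma * tie_bound n' + sigma * (sigma * (atom_bound n').+1) else 0.

(** Union bound: either the subtree of the best child has a tie, which is summed over all children,
    or two distinct children have equal [bmin]; given the first child, the latter is an atom for the
    second. *)
Lemma tie_law n :
  \sum_(w : labeling sigma label n | ~~ noties w) lab_law q w <= (tie_bound n)%:R * c.
Proof.
elim: n => [|n IHn]; first by rewrite big_pred0 ?mul0r.
apply: (@le_trans _ _ (\sum_(w : {ffun 'I_sigma -> label * labeling sigma label n})
   (\prod_i zlaw (w i)) * (\sum_j (~~ noties (w j).2)%:R +
     \sum_i \sum_(j | i != j) (bmin (w i) == bmin (w j))%:R))).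
  rewrite sum_indic sum_labeling; apply: ler_sum => w _; apply: ler_wpM2l.
    exact: (lab_law_ge0 q0 (w : labeling sigma label n.+1)).
  rewrite notiesS /lbranch; set j := argpath _.
  case: (boolP (noties (w j).2)) => [_|nj] /=; last first.
    rewrite (bigD1 j) //= nj -addrA lerDl addr_ge0 ?sumr_ge0 // => i _.
    exact: sumr_ge0.
  apply: ler_wpDl; first exact: sumr_ge0.
  case: (boolP [forall i, _]) => [_|] /=.
    by apply: sumr_ge0 => i _; apply: sumr_ge0.
  rewrite negb_forall => /existsP[i]; rewrite negb_imply eq_sym => /andP[ij h].
  rewrite (bigD1 j) //= (bigD1 i) //=.
  have -> : bmin (w j) == bmin (w i).
    rewrite eqn_leq [X in _ && X]leqNgt h andbT.
    exact: (pathmin_le (w : labeling sigma label n.+1) i).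
  rewrite -addrA lerDl addr_ge0 ?sumr_ge0 // => k _; exact: sumr_ge0.
under eq_bigr do rewrite mulrDr.
rewrite big_split /= natrD mulrDl; apply: lerD.
  under eq_bigr do rewrite mulr_sumr.
  rewrite exchange_big /= natrM -mulrA -[X in X%:R * _](card_ord sigma) mulr_natl -sumr_const.
  apply: ler_sum => j _.
  rewrite (sum_prod_marginal (zlaw1 n) j (fun z => (~~ noties z.2)%:R)).
  rewrite sum_lbranch /lbranch_law /=.
  apply: (@le_trans _ _ (\sum_l q l * ((tie_bound n)%:R * c))); last by rewrite -mulr_suml q1 mul1r.
  apply: ler_sum => l _; under eq_bigr do rewrite -mulrA.
  by rewrite -mulr_sumr ler_wpM2l // -sum_indic.
under eq_bigr do rewrite mulr_sumr.
rewrite exchange_big /= natrM -mulrA -[X in X%:R * _](card_ord sigma) mulr_natl -sumr_const.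
apply: ler_sum => i _; under eq_bigr do rewrite mulr_sumr.
rewrite exchange_big /= natrM -mulrA -[X in X%:R * _](card_ord sigma) mulr_natl -sumr_const.
rewrite big_mkcond; apply: ler_sum => j _; case: ifP => [ij|_]; last by rewrite mulr_ge0.
rewrite (sum_prod_marginal2 (zlaw1 n) (fun z z' => (bmin z == bmin z')%:R)) //.
apply: (@le_trans _ _ (\sum_z @lbranch_law sigma _ _ q n z * ((atom_bound n).+1%:R * c))).
  apply: ler_sum => z _; apply: ler_wpM2l => //.
  under eq_bigr do rewrite eq_sym.
  rewrite -sum_indic; exact: bmin_atom.
by rewrite -mulr_suml zlaw1 mul1r.
Qed.

End Ties.

(** * Strassen's theorem for finite sets *)

Section Transport.
Variables (R : realFieldType) (I J : finType) (e : I -> J -> bool).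

Definition nbr (A : {set I}) : {set J} := [set j | [exists i in A, e i j]].

Lemma nbrU A B : nbr (A :|: B) = nbr A :|: nbr B.
Proof.
apply/setP => j; rewrite !inE; apply/exists_inP/orP.
  by case=> i; rewrite inE => /orP[] iA ij; [left|right]; apply/exists_inP; exists i.
by case=> /exists_inP[i iA ij]; exists i => //; rewrite inE iA ?orbT.
Qed.

Definition hall (a : I -> R) (b : J -> R) :=
  forall A : {set I}, \sum_(i in A) a i <= \sum_(j in nbr A) b j.

Definition transport (a : I -> R) (b : J -> R) (x : I -> J -> R) :=
  [/\ forall i j, 0 <= x i j, forall i j, ~~ e i j -> x i j = 0,
      forall i, \sum_j x i j = a i & forall j, \sum_i x i j <= b j].

Definition restr (T : finType) (A : {set T}) (a : T -> R) (t : T) : R :=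
  if t \in A then a t else 0.

Lemma sum_restr (T : finType) (A B : {set T}) (a : T -> R) :
  \sum_(t in B) restr A a t = \sum_(t in A :&: B) a t.
Proof.
rewrite /restr -big_mkcondr; apply: eq_bigl => t.
by rewrite inE andbC.
Qed.

Definition supp (T : finType) (a : T -> R) : {set T} := [set t | a t != 0].

Lemma transportD a a' b b' x x' : transport a b x -> transport a' b' x' ->
  transport (fun i => a i + a' i) (fun j => b j + b' j) (fun i j => x i j + x' i j).
Proof.
case=> x0 xe xa xb [x0' xe' xa' xb']; split => [i j|i j ij|i|j].
- by rewrite addr_ge0.
- by rewrite xe // xe' // addr0.
- by rewrite big_split /= xa xa'.
- by rewrite big_split lerD.
Qed.

Lemma transport_eq a a' b b' x : a =1 a' -> b =1 b' -> transport a b x -> transport a' b' x.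
Proof.
by move=> aa bb [x0 xe xa xb]; split => // [i|j]; rewrite -?aa -?bb.
Qed.

(* Move as much mass as Hall's condition allows along one edge: either a vertex is
   exhausted or some set becomes tight, and then the problem splits. *)
Lemma hall_transport (a : I -> R) (b : J -> R) : (forall i, 0 <= a i) -> (forall j, 0 <= b j) ->
  hall a b -> exists x, transport a b x.
Proof.
have [m] := ubnP (#|supp a| + #|supp b|); elim: m a b => // m IHm a b.
rewrite ltnS => ab_m a0 b0 hab.
have [a_eq0|[i ai0]] : (a =1 fun=> 0) \/ exists i, a i != 0.
  case: (pickP (fun i => a i != 0)) => [i ai|no]; [by right; exists i|left => i].
  by have /negbFE/eqP := no i.
  exists (fun _ _ => 0); split => // [i|j]; first by rewrite big1.
  by rewrite big1.
have [j [eij bj0]] : exists j, e i j /\ b j != 0.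
  have := hab [set i]; rewrite big_set1 => h.
  have : \sum_(j in nbr [set i]) b j != 0.
    by apply/eqP => h0; rewrite h0 in h; have := ai0; rewrite eq_le h a0.
  rewrite psumr_eq0 // => /allPn[j _]; rewrite negb_imply => /andP[].
  by rewrite inE => /exists_inP[i']; rewrite inE => /eqP -> ? ?; exists j.
have ai_gt0 : 0 < a i by rewrite lt_def ai0 a0.
have bj_gt0 : 0 < b j by rewrite lt_def bj0 b0.
(* The sets whose Hall inequality loses when mass moves from [i] to [j]: [j] is consumed on the
   right while [i] does not count on the left. Such a set becomes saturated when [eps] equals its
   slack. *)
pose tight (A : {set I}) := (i \notin A) && (j \in nbr A).
pose slack A := \sum_(j in nbr A) b j - \sum_(i in A) a i.
have slack0 A : 0 <= slack A by rewrite subr_ge0.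
(* The largest mass that can be moved while preserving Hall's condition. The default [a i] of the
   inner minimum is harmless, as it already bounds [eps]. *)
pose eps := Num.min (Num.min (a i) (b j)) (\big[Num.min/a i]_(A | tight A) slack A).
have eps_a : eps <= a i by rewrite /eps !ge_min lexx.
have eps_b : eps <= b j by rewrite /eps !ge_min lexx !orbT.
have eps_s A : tight A -> eps <= slack A.
  by move=> tA; rewrite /eps ge_min; apply/orP; right; exact: (bigmin_le_cond (a i) slack tA).
have eps0 : 0 <= eps.
  rewrite /eps !le_min a0 b0 /=; elim/big_rec: _ => // A x _ x0.
  by rewrite le_min slack0.
pose a' k := if k == i then a k - eps else a k.
pose b' k := if k == j then b k - eps else b k.
have a'0 k : 0 <= a' k by rewrite /a'; case: eqP => // ->; rewrite subr_ge0.
have b'0 k : 0 <= b' k by rewrite /b'; case: eqP => // ->; rewrite subr_ge0.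
have sum_a' A : \sum_(k in A) a' k = \sum_(k in A) a k - (i \in A)%:R * eps.
  have [iA|iA] := boolP (i \in A); last first.
    rewrite mul0r subr0; apply: eq_bigr => k kA; rewrite /a'.
    by case: eqP => // ki; rewrite -ki kA in iA.
  rewrite (bigD1 i) //= [in RHS](bigD1 i) //= {1}/a' eqxx mul1r addrAC.
  by congr (_ + _ - _); apply: eq_bigr => k /andP[_ /negPf ki]; rewrite /a' ki.
have sum_b' B : \sum_(k in B) b' k = \sum_(k in B) b k - (j \in B)%:R * eps.
  have [iA|iA] := boolP (j \in B); last first.
    rewrite mul0r subr0; apply: eq_bigr => k kA; rewrite /b'.
    by case: eqP => // ki; rewrite -ki kA in iA.
  rewrite (bigD1 j) //= [in RHS](bigD1 j) //= {1}/b' eqxx mul1r addrAC.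
  by congr (_ + _ - _); apply: eq_bigr => k /andP[_ /negPf ki]; rewrite /b' ki.
have hab' : hall a' b'.
  move=> A; rewrite sum_a' sum_b'.
  have [iA|iA] := boolP (i \in A).
    have -> : j \in nbr A by rewrite inE; apply/exists_inP; exists i.
    by rewrite lerD2r.
  have [jA|jA] := boolP (j \in nbr A); last by rewrite !mul0r !subr0.
  rewrite mul0r mul1r subr0 lerBrDr -lerBrDl; apply: eps_s.
  by rewrite /tight iA.
have suppa k : a' k != 0 -> a k != 0.
  by rewrite /a'; have [->|] := eqVneq k i.
have suppb k : b' k != 0 -> b k != 0.
  by rewrite /b'; have [->|] := eqVneq k j.
have suppa' : (#|supp a'| <= #|supp a|)%N by apply/subset_leq_card/fintype.subsetP => k; rewrite !inE; apply: suppa.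
have suppb' : (#|supp b'| <= #|supp b|)%N by apply/subset_leq_card/fintype.subsetP => k; rewrite !inE; apply: suppb.
suff [x' tx'] : exists x, transport a' b' x.
  have te : transport (fun k => (k == i)%:R * eps) (fun k => (k == j)%:R * eps)
      (fun k l => ((k == i) && (l == j))%:R * eps).
    split => [k l|k l|k|l].
    - by rewrite mulr_ge0.
    - by case: eqP => [->|_]; [case: eqP => [->|_]|]; rewrite ?eij ?mul0r.
    - rewrite -mulr_suml; congr (_ * _); rewrite (bigD1 j) //= eqxx andbT.
      by rewrite big1 ?addr0 // => l /negPf ->; rewrite andbF.
    - rewrite -mulr_suml (bigD1 i) //= eqxx andTb.
      by rewrite big1 ?addr0 // => k /negPf ->; rewrite andFb.
  have := transportD te tx' => t; exists (fun k l => ((k == i) && (l == j))%:R * eps + x' k l).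
  apply: transport_eq t => k; rewrite /a' /b'; case: eqP => _; rewrite ?mul1r ?mul0r ?add0r //.
    by rewrite addrC subrK.
  by rewrite addrC subrK.
(* If [eps] exhausts [i] or [j], the total support shrinks. *)
have [eq_a|ne_a] := eqVneq eps (a i).
  apply: IHm => //; apply: leq_trans ab_m; rewrite -addSn leq_add //.
  apply: proper_card; apply/properP; split; first by apply/fintype.subsetP => k; rewrite !inE; apply: suppa.
  by exists i; rewrite !inE ?ai0 // /a' eqxx eq_a subrr eqxx.
have [eq_b|ne_b] := eqVneq eps (b j).
  apply: IHm => //; apply: leq_trans ab_m; rewrite -addnS leq_add //.
  apply: proper_card; apply/properP; split; first by apply/fintype.subsetP => k; rewrite !inE; apply: suppb.
  by exists j; rewrite !inE ?bj0 // /b' eqxx eq_b subrr eqxx.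
(* Otherwise [eps] is the slack of some set [A], whose Hall inequality is now an equality; the
   problem splits into [A] against [nbr A] and the complements. *)
have [A tA sA] : exists2 A, tight A & eps = slack A.
  pose mn := \big[Num.min/a i]_(A | tight A) slack A.
  have : (eps == a i) || [exists A, tight A && (eps == slack A)].
    have : eps = a i \/ eps = b j \/ eps = mn.
      rewrite /eps -/mn; case: (leP (Num.min (a i) (b j)) mn) => _; last by right; right.
      by case: (leP (a i) (b j)) => _; [left|right; left].
    case=> [->|[eb|em]]; first by rewrite eqxx.
      by rewrite eb eqxx in ne_b.
    rewrite em /mn; elim/big_rec: _ => [|A x tA]; first by rewrite eqxx.
    case: (leP (slack A) x) => _ // _; apply/orP; right.
    by apply/existsP; exists A; rewrite tA eqxx.
  by rewrite (negPf ne_a) => /existsP[A /andP[tA /eqP sA]]; exists A.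
have /andP[iA jA] := tA.
have tightA : \sum_(k in A) a' k = \sum_(k in nbr A) b' k.
  by rewrite sum_a' sum_b' (negPf iA) jA mul0r mul1r subr0 sA /slack opprB addrC subrK.
have sub_hall : hall (restr A a') (restr (nbr A) b').
  move=> B; rewrite !sum_restr; apply: le_trans (hab' _) _.
  rewrite big_mkcond [leRHS]big_mkcond; apply: ler_sum => k _.
  case: ifP => [|_]; last by case: ifP.
  rewrite inE => /exists_inP[l]; rewrite inE => /andP[lA lB] ekl.
  by rewrite ifT // !inE; apply/andP; split; apply/exists_inP; exists l.
have compl_hall : hall (restr (~: A) a') (restr (~: nbr A) b').
  move=> B; rewrite !sum_restr -(lerD2l (\sum_(k in A) a' k)).
  (* Hall's inequality for the union with [A], from which the equality on [A] is subtracted. *)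
  have := hab' (A :|: (~: A :&: B)); rewrite nbrU.
  rewrite [X in X <= _](big_setID A) /= [X in _ <= X](big_setID (nbr A)) /=.
  rewrite !finset.setUK -tightA.
  have -> : (A :|: ~: A :&: B) :\: A = ~: A :&: B by apply/setP => k; rewrite !inE; case: (k \in A).
  move=> h; apply: le_trans h _; rewrite lerD2l.
  rewrite big_mkcond [leRHS]big_mkcond; apply: ler_sum => k _.
  case: ifP => [|_]; last by case: ifP.
  rewrite !finset.in_setD finset.in_setU => /andP[kA]; rewrite (negPf kA) /= => kB.
  rewrite ifT // inE finset.in_setC kA /=; move: kB; rewrite !inE => /exists_inP[l].
  by rewrite inE => /andP[_ lB] ekl; apply/exists_inP; exists l.
have restr0 (T : finType) (C : {set T}) (f : T -> R) : (forall t, 0 <= f t) -> forall t, 0 <= restr C f t.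
  by move=> f0 t; rewrite /restr; case: ifP.
have card_restr (T : finType) (C : {set T}) (f : T -> R) : (#|supp (restr C f)| <= #|supp f|)%N.
  by apply/subset_leq_card/fintype.subsetP => t; rewrite !inE /restr; case: ifP => //; rewrite eqxx.
have [x1 t1] : exists x, transport (restr A a') (restr (nbr A) b') x.
  apply: IHm => //; try exact: restr0.
  apply: leq_trans ab_m; rewrite -addSn leq_add //; last exact: leq_trans (card_restr _ _ _) _.
  apply: proper_card; apply/properP; split.
    apply/fintype.subsetP => k; rewrite !inE /restr; case: ifP; rewrite ?eqxx // => _; exact: suppa.
  by exists i; rewrite !inE ?ai0 // /restr (negPf iA) eqxx.
have [x2 t2] : exists x, transport (restr (~: A) a') (restr (~: nbr A) b') x.
  apply: IHm => //; try exact: restr0.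
  apply: leq_trans ab_m; rewrite -addSn leq_add //; last exact: leq_trans (card_restr _ _ _) _.
  apply: proper_card; apply/properP; split.
    apply/fintype.subsetP => k; rewrite !inE /restr; case: ifP; rewrite ?eqxx // => _; exact: suppa.
  (* The complement has smaller support because [A] still carries mass: its sum equals that of
     [nbr A], which contains [j], and [b' j] is not 0. *)
  have : \sum_(k in A) a' k != 0.
    apply/negP; rewrite tightA psumr_eq0 // => /allP /(_ j).
    rewrite mem_index_enum jA /= /b' eqxx subr_eq0 eq_sym (negPf ne_b).
    by move/(_ isT).
  rewrite psumr_eq0 // => /allPn[k _]; rewrite negb_imply => /andP[kA ak].
  by exists k; rewrite !inE ?suppa // /restr inE kA eqxx.
exists (fun k l => x1 k l + x2 k l).
apply: transport_eq (transportD t1 t2) => k; rewrite /restr finset.in_setC;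
  by case: (k \in _); rewrite ?addr0 ?add0r.
Qed.

(** Equal total masses turn the inequalities for the second marginal into equalities. *)
Lemma hall_transport_eq (a : I -> R) (b : J -> R) : (forall i, 0 <= a i) -> (forall j, 0 <= b j) ->
  \sum_i a i = \sum_j b j -> hall a b ->
  exists x, transport a b x /\ forall j, \sum_i x i j = b j.
Proof.
move=> a0 b0 ab /(hall_transport a0 b0)[x tx]; exists x; split => //.
case: tx => x0 _ xa xb.
have : \sum_j (b j - \sum_i x i j) = 0.
  rewrite sumrB exchange_big /= -ab; under [X in _ - X]eq_bigr do rewrite xa.
  by rewrite subrr.
move/eqP; rewrite psumr_eq0 => [/allP h j|j _]; last by rewrite subr_ge0.
by have /implyP/(_ isT) := h j (mem_index_enum _); rewrite subr_eq0 => /eqP.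
Qed.

End Transport.

Local Open Scope classical_set_scope.
Local Open Scope ring_scope.

(** * Traces and invasion *)

Section Trace.
Variable sigma : nat.
Implicit Types (v : vertex sigma) (eta : edge sigma -> bool).

Definition subfun (T : Type) (i : 'I_sigma) (f : edge sigma -> T) : edge sigma -> T :=
  fun e => f (i :: e.1, e.2).

(** The open cluster of the root, cut at height [n]. *)
Fixpoint trace n eta : hcluster sigma n :=
  match n return hcluster sigma n with
  | 0%N => tt
  | n'.+1 => [ffun i => if eta ([::], i) then Some (trace n' (subfun i eta)) else None]
  end.

Fixpoint read (L : finType) n (f : edge sigma -> L) : labeling sigma L n :=
  match n return labeling sigma L n with
  | 0%N => tt
  | n'.+1 => [ffun i => (f ([::], i), read n' (subfun i f))]
  end.

Fixpoint inclus n (s : hcluster sigma n) v : bool :=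
  match v, n return hcluster sigma n -> bool with
  | [::], _ => fun _ => true
  | _ :: _, 0%N => fun _ => false
  | i :: v', n'.+1 => fun s => if branch s i is Some t then inclus t v' else false
  end s.

Fixpoint openpath eta v : bool :=
  if v is i :: v' then eta ([::], i) && openpath (subfun i eta) v' else true.

Definition cluster_edges n (s : hcluster sigma n) : edge sigma -> bool :=
  fun e => inclus s (rcons e.1 e.2).

Lemma inclus_nil n (s : hcluster sigma n) : inclus s [::].
Proof. by case: n s. Qed.

Lemma inclus_trace n eta v : (size v <= n)%N -> inclus (trace n eta) v = openpath eta v.
Proof.
elim: v n eta => [|i v IHv] [|n] eta //= vn.
by rewrite /branch ffunE; case: ifP => //= _; apply: IHv.
Qed.

Lemma inclus_size n (s : hcluster sigma n) v : inclus s v -> (size v <= n)%N.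
Proof.
elim: n s v => [|n IHn] s [|i v] //=.
by case: (branch s i) => // t /IHn.
Qed.

Lemma openpath_rcons eta v i :
  openpath eta (rcons v i) = openpath eta v && eta (v, i).
Proof. by elim: v eta => [|j v IHv] eta /=; rewrite ?andbT // IHv andbA. Qed.

Lemma inclus_rcons n (s : hcluster sigma n) v i : inclus s (rcons v i) -> inclus s v.
Proof.
elim: n s v => [|n IHn] s [|j v] //=.
by case: (branch s j) => // t /IHn.
Qed.

Lemma openpath_cluster_edges n (s : hcluster sigma n) v :
  openpath (cluster_edges s) v = inclus s v.
Proof.
elim/last_ind: v => [|v i IHv]; first by case: n s.
rewrite openpath_rcons IHv /cluster_edges /=.
by apply/andP/idP => [[]//|h]; split => //; apply: inclus_rcons h.
Qed.

Lemma cleP n (s t : hcluster sigma n) :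
  reflect (forall v, inclus s v -> inclus t v) (cle s t).
Proof.
apply: (iffP idP).
  elim: n s t => [|n IHn] s t /=; first by move=> _ [].
  move=> /forallP st [|i v] //=; move: (st i); rewrite /branch.
  by case: (s i) (t i) => [a|] [b|] //= /IHn; apply.
elim: n s t => [|n IHn] s t //= st; apply/forallP => i.
have := st [:: i]; rewrite /= /branch.
case Es: (s i) => [a|] //; case Et: (t i) => [b|] //=; last first.
  by move/(_ (inclus_nil a)).
move=> _; apply: IHn => v av; have := st (i :: v).
by rewrite /= /branch Es Et; apply.
Qed.

Lemma cle_anti n : antisymmetric (@cle sigma n).
Proof.
elim: n => [|n IHn] /=; first by case=> -[].
move=> s t /andP[/forallP st /forallP ts]; apply/ffunP => i.
move: (st i) (ts i); case: (s i) (t i) => [a|] [b|] //= ab ba.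
by congr Some; apply: IHn; rewrite ab.
Qed.

Lemma eq_inclus n (s t : hcluster sigma n) : inclus s =1 inclus t -> s = t.
Proof.
by move=> st; apply: cle_anti; apply/andP; split; apply/cleP => v; rewrite st.
Qed.

Lemma trace_eq n eta eta' :
  (forall v, (size v <= n)%N -> openpath eta v = openpath eta' v) <->
  trace n eta = trace n eta'.
Proof.
split=> [h|h v vn]; last by rewrite -!(inclus_trace _ vn) h.
apply: eq_inclus => v; have [vn|vn] := leqP (size v) n.
  by rewrite !inclus_trace ?h.
by apply/idP/idP => /inclus_size; rewrite leqNgt vn.
Qed.

Lemma trace_cluster_edges n (s : hcluster sigma n) : trace n (cluster_edges s) = s.
Proof.
apply: eq_inclus => v; have [vn|vn] := leqP (size v) n.
  by rewrite inclus_trace // openpath_cluster_edges.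
by apply/idP/idP => /inclus_size; rewrite leqNgt vn.
Qed.

Lemma trace_trace n k eta : (k <= n)%N ->
  trace k (cluster_edges (trace n eta)) = trace k eta.
Proof.
move=> kn; apply/trace_eq => v vk.
by rewrite openpath_cluster_edges inclus_trace // (leq_trans vk kn).
Qed.

Lemma trace_le k eta eta' : (forall v, openpath eta v -> openpath eta' v) ->
  cle (trace k eta) (trace k eta').
Proof.
move=> h; apply/cleP => v sv; have vk := inclus_size sv.
by move: sv; rewrite !inclus_trace //; apply: h.
Qed.

Lemma connected_openpath eta v : connected_to_root eta v <-> openpath eta v.
Proof.
split.
  elim=> [//|x y e _ IHx ee].
  have h : openpath eta x -> x = rcons e.1 e.2 \/ x = e.1 -> openpath eta e.1.
    by move=> ox [xe|<- //]; move: ox; rewrite xe openpath_rcons => /andP[].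
  rewrite /endpoints /= => ex [->|->].
    by apply: h => //; case: ex; [right|left].
  rewrite openpath_rcons -surjective_pairing ee andbT.
  by apply: h => //; case: ex; [right|left].
elim/last_ind: v => [|v i IHv]; first by move=> _; apply: connected_root.
rewrite openpath_rcons => /andP[/IHv cv evi].
by apply: (connected_step (x := v) (e := (v, i))) => //; [left|right].
Qed.

Lemma reaches_heightP eta n :
  reaches_height eta n <-> (0 < frontier (trace n eta))%N.
Proof.
transitivity (exists v, size v = n /\ openpath eta v).
  by split=> -[v [vn /connected_openpath ov]]; exists v.
elim: n eta => [|n IHn] eta /=.
  by split=> // _; exists [::].
rewrite lt0n sum_nat_eq0 negb_forall; split.
  move=> [[|i v] [] //= [vn] /andP[ei ov]]; apply/existsP; exists i.
  rewrite /= /branch ffunE ei -lt0n; apply/IHn; by exists v.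
move=> /existsP[i]; rewrite /= /branch ffunE; case: ifP => //= ei.
rewrite -lt0n => /IHn[v [vn ov]]; exists (i :: v); split; first by rewrite /= vn.
by rewrite /= ei.
Qed.

(** In an open cluster of a tree, an edge is present exactly when its endpoint away from the root is
    reached, so finitely many vertices and edges are all decided by a trace of bounded height. *)
Lemma cylinder_trace (A : set (subgraph sigma)) : cylinder A ->
  exists (k : nat) (B : pred (hcluster sigma k)), forall eta,
    A (open_cluster eta) <-> B (trace k eta).
Proof.
move=> [s [t At]].
(* Any common bound on the heights involved would do; the sum of all of them is one. *)
pose k := (\sum_(v <- s) size v + \sum_(e <- t) size (rcons e.1 e.2))%N.
have sk v : v \in s -> (size v <= k)%N.
  by move=> vs; rewrite /k (big_rem v) //= -addnA leq_addr.
have tk e : e \in t -> (size (rcons e.1 e.2) <= k)%N.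
  by move=> et; rewrite /k [X in (_ + X)%N](big_rem e) //= addnCA leq_addr.
have eqA eta eta' : trace k eta = trace k eta' ->
    A (open_cluster eta) <-> A (open_cluster eta').
  move/trace_eq => h; apply: At => [v /sk vk|e /tk ek].
    by rewrite /vertices /open_cluster /= !connected_openpath h.
  have E zeta : edges (open_cluster zeta) e <-> openpath zeta (rcons e.1 e.2).
    rewrite /edges /open_cluster /= openpath_rcons -surjective_pairing.
    split=> [[-> c]|/andP[oe ee]].
      by rewrite andbT; apply/connected_openpath/c; left.
    split=> // v [] ->; apply/connected_openpath => //.
    by rewrite openpath_rcons -surjective_pairing oe ee.
  by rewrite !E h.
exists k, (fun s => `[< exists eta, trace k eta = s /\ A (open_cluster eta) >]) => eta.
split=> [Ae|/asboolP[eta' [h Ae]]]; first by apply/asboolP; exists eta.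
exact/(eqA _ _ h).
Qed.

End Trace.

Section InvasionSubset.
Variables (r M : nat).
Notation sigma := r.+1.
Implicit Types (lab : edge sigma -> 'I_M.+1) (V : set (vertex sigma)).

Let subset_at V (i : 'I_sigma) : set (vertex sigma) := [set v | V (i :: v)].

(** The optimal path starts in [V] and ends at height [n], where [V] has no vertex, so one of its
    edges leaves [V]. The inequality is strict because the label l stands for the weight l + 1. *)
Lemma exit_edge n lab V : V [::] -> (forall v, V v -> size v <> n) ->
  exists v i, [/\ V v, ~ V (rcons v i) & (lab (v, i) < pathmin (read n lab))%N].
Proof.
elim: n lab V => [|n IHn] lab V V0 Vn; first by have := Vn _ V0.
set w := read n.+1 lab; pose j := argpath w.
have wj : lbranch w j = (lab ([::], j), read n (subfun j lab)) by rewrite /lbranch ffunE.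
have mE : pathmin w = maxn (lab ([::], j)).+1 (pathmin (read n (subfun j lab))).
  by rewrite pathminS -/j wj.
have [Vj|nVj] := pselect (V [:: j]); last first.
  by exists [::], j; split => //; rewrite mE leq_maxl.
have [v [i [Vv nV lv]]] := IHn (subfun j lab) (subset_at V j) Vj
  (fun v Vv e => Vn (j :: v) Vv (congr1 succn e)).
exists (j :: v), i; split => //.
by rewrite mE; apply: leq_trans lv _; apply: leq_maxr.
Qed.

Lemma level_boundary n lab k v i : (size v < n)%N ->
  inclus (level k (read n lab)) v -> ~~ inclus (level k (read n lab)) (rcons v i) ->
  (k <= lab (v, i))%N.
Proof.
elim: n lab v => [|n IHn] lab [|j v] //=; rewrite /branch /lbranch !ffunE /=.
  by move=> _ _; case: ltnP => // _ /negP[]; apply: inclus_nil.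
by rewrite ltnS; case: ifP => // _; apply: IHn.
Qed.

(** An edge leaving [invaded] is beaten by another boundary edge of [V]. Outside the optimal branch
    its label is at least [pathmin], so the exit edge of the optimal path wins; inside that branch
    the induction applies. *)
Lemma invaded_boundary n lab V v i :
  V [::] -> (forall u j, V (rcons u j) -> V u) -> (forall u, V u -> (size u < n)%N) ->
  (forall u, V u -> inclus (invaded (read n lab)) u) ->
  V v -> ~~ inclus (invaded (read n lab)) (rcons v i) ->
  exists u j, [/\ V u, ~ V (rcons u j) & (lab (u, j) < lab (v, i))%N].
Proof.
elim: n lab V v => [|n IHn] lab V v V0 Vpre Vn VD Vv nD; first by have := Vn _ V0.
have Vn' u : V u -> size u <> n.+1 by move=> /Vn + un; rewrite un ltnn.
have [u0 [j0 [Vu0 nVu0 lu0]]] := exit_edge lab V0 Vn'.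
move: lu0 VD nD; set w := read n.+1 lab; pose j := argpath w => lu0 VD nD.
have wE a : lbranch w a = (lab ([::], a), read n (subfun a lab)) by rewrite /lbranch ffunE.
have bE a : branch (invaded w) a = if a == j then Some (invaded (read n (subfun a lab)))
    else blevel (pathmin w) (lbranch w a).
  by rewrite /branch invadedS ffunE -/j wE.
have Vcat u1 u2 : V (u1 ++ u2) -> V u1.
  elim/last_ind: u2 => [|u2 x IH]; first by rewrite cats0.
  by rewrite -rcons_cat => /Vpre.
case: v Vv nD => [|a v] Vv nD.
  exists u0, j0; split => //; apply: leq_trans lu0 _.
  move: nD; rewrite /= bE; case: eqP => [_|_]; first by move=> /negP[]; apply: inclus_nil.
  by rewrite /blevel wE /=; case: ltnP => // _ /negP[]; apply: inclus_nil.
have Va : V [:: a] by apply: (Vcat _ v).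
have [aj|aj] := eqVneq a j.
  have := IHn (subfun a lab) (subset_at V a) v Va.
  case.
  - by move=> u b; rewrite /subset_at /= -rcons_cons => /Vpre.
  - by move=> u /Vn.
  - by move=> u /VD /=; rewrite bE aj eqxx.
  - by [].
  - by move: nD; rewrite /= bE aj eqxx.
  by move=> u [b [Vu nVu l]]; exists (a :: u), b.
exists u0, j0; split => //; apply: leq_trans lu0 _.
have := VD _ Vv; move: nD; rewrite /= bE (negPf aj) /blevel wE /=.
case: ifP => // _ nD iv; apply: (level_boundary _ iv nD).
by have := Vn _ Vv.
Qed.

Variables (R : realType) (w : edge sigma -> R).

Lemma invasion_root N : vertices (invasion w N) [::].
Proof. by elim: N => [|N IHN] //=; left. Qed.

(** When the vertex set is closed under taking parents, boundary edges point away from the root. *)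
Lemma boundary_prefix (G : subgraph sigma) (e : edge sigma) :
  (forall u j, vertices G (rcons u j) -> vertices G u) -> boundary G e ->
  vertices G e.1 /\ ~ vertices G (rcons e.1 e.2).
Proof.
move=> Gpre [x [y [exy Gx Gy]]].
have ex : endpoints e x by rewrite exy; left.
have ey : endpoints e y by rewrite exy; right.
have ne : x <> y by move=> xy; rewrite xy in Gx.
case: ex => /= xE; case: ey => /= yE.
- by case: ne; rewrite xE yE.
- by rewrite -yE -xE.
- by move: Gx; rewrite xE => /Gpre; rewrite -yE.
- by case: ne; rewrite xE yE.
Qed.

Lemma prefix_boundary (G : subgraph sigma) (u : vertex sigma) j :
  vertices G u -> ~ vertices G (rcons u j) -> boundary G (u, j).
Proof. by move=> Gu nGu; exists u, (rcons u j). Qed.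

Lemma invasion_prefix N u j :
  vertices (invasion w N) (rcons u j) -> vertices (invasion w N) u.
Proof.
elim: N u j => [|N IHN] u j; first by case: u.
rewrite /invasion iterS -/(invasion w N) => -[/IHN|[e [be _]]]; first by left.
have [ve nve] := boundary_prefix IHN be.
rewrite /endpoints /= => -[e1|/rcons_inj[ue _]]; left; last by rewrite ue.
by apply: IHN (j) _; rewrite e1.
Qed.

Lemma invasionS N v : vertices (invasion w N.+1) v <->
  vertices (invasion w N) v \/
  exists2 e, min_boundary w (invasion w N) e & v = rcons e.1 e.2.
Proof.
rewrite /invasion iterS -/(invasion w N); split.
  case=> [|[e me]]; [by left|have [be _] := me].
  have [ve nve] := boundary_prefix (@invasion_prefix N) be.
  by case=> /= ->; [left|right; exists e].
by case=> [|[e me ->]]; [left|right; exists e => //; right].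
Qed.

Lemma invasion_edges N e :
  edges (invasion w N) e <-> vertices (invasion w N) (rcons e.1 e.2).
Proof.
elim: N => [|N IHN].
  by rewrite /=; split=> //; case: e => -[].
rewrite invasionS -IHN {1}/invasion iterS -/(invasion w N); split.
  by case=> h; [left|right; exists e].
case=> [h|[f mf /rcons_inj[e1 e2]]]; [by left|right].
by rewrite (surjective_pairing e) e1 e2 -surjective_pairing.
Qed.

Lemma invasion_size N v : vertices (invasion w N) v -> (size v <= N)%N.
Proof.
elim: N v => [|N IHN] v; first by move=> ->.
rewrite invasionS => -[/IHN/leqW //|[e [be _] ->]].
have [/IHN ve _] := boundary_prefix (@invasion_prefix N) be.
by rewrite size_rcons.
Qed.

(** An edge of least weight also has least label on the boundary, whereas an edge leaving [invaded]
    would be strictly beaten by [invaded_boundary]. The condition on [N] keeps the current cluster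
    below height [n] at each addition. *)
Lemma invasion_invaded lab n N v :
  (forall e f, w e <= w f -> (lab e <= lab f)%N) -> (N <= n)%N ->
  vertices (invasion w N) v -> inclus (invaded (read n lab)) v.
Proof.
move=> labw; elim: N v => [|N IHN] v Nn; first by move=> ->; apply: inclus_nil.
rewrite invasionS => -[|[e [be mine] ->]]; first by apply/IHN/ltnW.
have [ve nve] := boundary_prefix (@invasion_prefix N) be.
apply/negP => /negP nD.
have := @invaded_boundary n lab (vertices (invasion w N)) e.1 e.2 (invasion_root N)
  (@invasion_prefix N) _ _ ve nD.
case.
- by move=> u /invasion_size uN; apply: leq_ltn_trans uN Nn.
- by move=> u; apply/IHN/ltnW.
move=> u [j [Vu nVu]]; rewrite -surjective_pairing ltnNge => /negP; apply.
exact/labw/mine/prefix_boundary.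
Qed.

Definition invasion_bits (N : nat) : edge sigma -> bool :=
  fun e => `[< edges (invasion w N) e >].

Definition cluster_bits : edge sigma -> bool :=
  fun e => `[< edges (invasion_cluster w) e >].

Lemma openpath_invasion N v :
  openpath (invasion_bits N) v <-> vertices (invasion w N) v.
Proof.
elim/last_ind: v => [|v i IHv]; first by split=> // _; apply: invasion_root.
rewrite openpath_rcons; split=> [/andP[_ /asboolP]|h]; first by move/invasion_edges.
apply/andP; split; first by apply/IHv/(invasion_prefix h).
exact/asboolP/invasion_edges.
Qed.

Lemma openpath_cluster v :
  openpath cluster_bits v <-> vertices (invasion_cluster w) v.
Proof.
elim/last_ind: v => [|v i IHv]; first by split=> // _; exists 0%N => //; apply: invasion_root.
rewrite openpath_rcons; split=> [/andP[_ /asboolP]|[N _ h]].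
  by move=> [N _ /invasion_edges h]; exists N.
apply/andP; split; first by apply/IHv; exists N => //; exact: invasion_prefix h.
by apply/asboolP; exists N => //; exact/(invasion_edges N (v, i)).
Qed.

(** The invasion cluster is the open cluster of its own edge indicator, so that both random graphs
    can be studied through traces. *)
Lemma invasion_clusterE : invasion_cluster w = open_cluster cluster_bits.
Proof.
rewrite /open_cluster [LHS]surjective_pairing; congr pair.
  by apply/seteqP; split => v; rewrite /= connected_openpath openpath_cluster.
apply/seteqP; split => [e ee|e [/asboolP //]].
have ce : cluster_bits e by exact/asboolP.
have o : openpath cluster_bits (rcons e.1 e.2).
  apply/openpath_cluster; case: ee => N _ /invasion_edges h.
  by exists N.
split=> // v [] ->; apply/connected_openpath => //.
by move: o; rewrite openpath_rcons => /andP[].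
Qed.

Lemma invasion_mono N N' v : (N <= N')%N ->
  vertices (invasion w N) v -> vertices (invasion w N') v.
Proof.
move/subnK <-; elim: (N' - N)%N => [//|m IHm] h; rewrite addSn invasionS.
by left; apply: IHm.
Qed.

Lemma trace_invasion_mono k N N' : (N <= N')%N ->
  cle (trace k (invasion_bits N)) (trace k (invasion_bits N')).
Proof.
move=> NN'; apply: trace_le => v; rewrite !openpath_invasion.
exact: invasion_mono.
Qed.

Lemma trace_cluster_ge k N : cle (trace k (invasion_bits N)) (trace k cluster_bits).
Proof.
apply: trace_le => v; rewrite openpath_invasion openpath_cluster => h.
by exists N.
Qed.

(** Finitely many vertices have height at most [k], and each vertex of the cluster is invaded at a
    finite stage. *)
Lemma trace_cluster_lim k : exists N, trace k cluster_bits = trace k (invasion_bits N).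
Proof.
have [N hN] : exists N, forall v, inclus (trace k cluster_bits) v ->
    vertices (invasion w N) v.
  have [F hF] : exists F : seq (vertex sigma), forall v, (size v <= k)%N -> v \in F.
    elim: k => [|k [F hF]]; first by exists [:: [::]] => -[].
    exists ([::] :: [seq i :: v | i <- enum 'I_sigma, v <- F]) => -[//|i v] /= vk.
    by rewrite inE /=; apply/allpairsP; exists (i, v); rewrite /= mem_enum hF.
  suff [N hN] : exists N, forall v, v \in F -> inclus (trace k cluster_bits) v ->
      vertices (invasion w N) v.
    by exists N => v iv; apply: hN => //; apply/hF/(inclus_size iv).
  elim: F {hF} => [|u F [N hN]]; first by exists 0%N.
  have [iu|niu] := boolP (inclus (trace k cluster_bits) u); last first.
    by exists N => v; rewrite inE => /orP[/eqP ->|/hN//]; rewrite (negPf niu).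
  have := iu; rewrite inclus_trace ?(inclus_size iu) // openpath_cluster => -[N' _ uN'].
  exists (maxn N N') => v; rewrite inE => /orP[/eqP -> _|vF /(hN _ vF)].
    by apply: invasion_mono uN'; apply: leq_maxr.
  by apply: invasion_mono; apply: leq_maxl.
exists N; apply: cle_anti; rewrite trace_cluster_ge andbT; apply/cleP => v iv.
by rewrite inclus_trace ?(inclus_size iv) //; apply/openpath_invasion/hN.
Qed.

End InvasionSubset.

(** * Random bits *)

Section Discrete.
Variables (R : realType) (d : measure_display) (T : measurableType d).
Variable P : probability T R.

Definition pr (A : set T) : R := fine (P A).

Lemma prE A : measurable A -> P A = (pr A)%:E.
Proof. by move=> mA; rewrite /pr fineK // fin_num_measure. Qed.

Lemma pr_ge0 A : 0 <= pr A.
Proof. exact: fine_ge0. Qed.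

Lemma pr_le A B : measurable A -> measurable B -> A `<=` B -> pr A <= pr B.
Proof.
move=> mA mB AB; rewrite -lee_fin -!prE //; apply: le_measure => //; exact/mem_set.
Qed.

Lemma pr_setT : pr setT = 1.
Proof. by rewrite /pr probability_setT. Qed.

Variables (F : finType) (X : T -> F).
Hypothesis mX : forall f, measurable [set t | X t = f].

Let disc_bigcup (B : pred F) :
  [set t | B (X t)] = \bigcup_(f in [set f | B f]) [set t | X t = f].
Proof.
by apply/seteqP; split=> [t Bt|t [f Bf /= ->]] //; exists (X t).
Qed.

Lemma measurable_disc (B : pred F) : measurable [set t | B (X t)].
Proof.
by rewrite disc_bigcup; apply: fin_bigcup_measurable => //; apply: finite_finset.
Qed.

Lemma pr_disc (B : pred F) : pr [set t | B (X t)] = \sum_(f | B f) pr [set t | X t = f].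
Proof.
apply: EFin_inj; rewrite -prE; last exact: measurable_disc.
rewrite disc_bigcup measure_fin_bigcup //; last 2 first.
- exact: finite_finset.
- by move=> f g _ _ [t [/= <- <-]].
rewrite (eq_fsbigr (fun f => (pr [set t | X t = f])%:E)); last first.
  by move=> f _; rewrite -prE.
rewrite fsbig_finite; last exact: finite_finset.
rewrite sumEFin; congr (_%:E).
rewrite -[RHS]big_filter; apply: perm_big.
apply: uniq_perm; first exact: finmap.fset_uniq.
  exact/filter_uniq/index_enum_uniq.
move=> f; rewrite mem_filter mem_index_enum andbT in_fset_set; last exact: finite_finset.
by apply/idP/idP; rewrite inE.
Qed.

Lemma pr_disc1 : \sum_f pr [set t | X t = f] = 1.
Proof.
rewrite -(pr_disc xpredT) -pr_setT; congr pr.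
by apply/seteqP; split.
Qed.

End Discrete.

Section UniformInterval.
Variable R : realType.

Lemma uniform_itv (a b : R) : 0 <= a -> a <= b -> b <= 1 ->
  uniform_prob (@ltr01 R) `[a, b[%classic = (b - a)%:E.
Proof.
move=> a0 ab b1; rewrite /uniform_prob integral_uniform_pdf.
have -> : `[a, b[%classic `&` `[0, 1]%classic = `[a, b[%classic :> set R.
  apply/seteqP; split => x /=; first by case.
  rewrite !in_itv /= => /andP[ax xb]; split; first by apply/andP.
  by rewrite (le_trans a0 ax) (le_trans (ltW xb) b1).
rewrite (eq_integral (fun=> 1%:E)); last first.
  move=> x; rewrite inE /= in_itv /= => /andP[ax xb]; rewrite /uniform_pdf.
  by rewrite (le_trans a0 ax) (le_trans (ltW xb) b1) subr0 invr1.
rewrite integral_cst //= mul1e lebesgue_measure_itv /= lte_fin.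
move: ab; rewrite le_eqVlt => /orP[/eqP ->|ab]; first by rewrite ltxx subrr.
by rewrite ab EFinB.
Qed.

Lemma uniform_setI01 (A : set (measurableTypeR R)) : measurable A ->
  uniform_prob (@ltr01 R) A = uniform_prob (@ltr01 R) (A `&` `[0, 1[%classic).
Proof.
have m01 : measurable (`[0, 1[%classic : set (measurableTypeR R)) by [].
move=> mA; rewrite (measureDI (uniform_prob (@ltr01 R)) mA m01).
rewrite [X in (X + _)%E](_ : _ = 0%E) ?add0e //.
apply/eqP; rewrite eq_le measure_ge0 andbT.
have <- : uniform_prob (@ltr01 R) (~` `[0, 1[%classic) = 0%E.
  rewrite probability_setC //.
  by rewrite [X in (_ - X)%E](uniform_itv (lexx 0) ler01 (lexx 1)) subr0 subee.
apply: le_measure; rewrite ?inE; first exact: measurableD.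
  exact: measurableC.
by move=> x [].
Qed.

End UniformInterval.

Section RandomBits.
Variables (R : realType) (q : seq bool -> R).
Hypotheses (q0 : forall w, 0 <= q w) (q1 : q [::] = 1).
Hypothesis qS : forall w, q w = q (true :: w) + q (false :: w).

Let U : probability _ R := uniform_prob (@ltr01 R).

(* The words are read backwards, the last bit first: [lend w, lend w + q w) is the
   set of the points of [0, 1) whose first bits are w. *)
Fixpoint lend (w : seq bool) : R :=
  if w is b :: w' then if b then lend w' + q (false :: w') else lend w' else 0.

Fixpoint bits (x : R) (m : nat) : seq bool :=
  if m is m'.+1 then let w := bits x m' in (lend w + q (false :: w) <= x) :: w
  else [::].

Lemma size_bits x m : size (bits x m) = m.
Proof. by elim: m => //= m ->. Qed.

Lemma lend_ge0 w : 0 <= lend w.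
Proof. by elim: w => //= -[] w h //; rewrite addr_ge0. Qed.

Lemma rend_le1 w : lend w + q w <= 1.
Proof.
elim: w => [|b w]; first by rewrite /= add0r q1.
rewrite qS /=; case: b => h; apply: le_trans h.
  by rewrite -addrA [X in _ + X]addrC.
by rewrite lerD2l lerDr.
Qed.

Lemma bitsP x w : 0 <= x < 1 ->
  (bits x (size w) == w) = (lend w <= x < lend w + q w).
Proof.
move=> /andP[x0 x1]; elim: w => [|b w IHw]; first by rewrite /= q1 add0r x0 x1.
rewrite [LHS]/= eqseq_cons.
have qw : q w = q (true :: w) + q (false :: w) := qS w.
have [e|ne] := eqVneq (bits x (size w)) w; last first.
  rewrite andbF; apply/esym/negP => /andP[l1 l2].
  have /negP : ~~ (lend w <= x < lend w + q w) by rewrite -IHw.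
  apply; apply/andP; have := q0 (true :: w); have := q0 (false :: w).
  case: b l1 l2 => /= l1 l2 qt qf; split; rewrite ?qw; lra.
rewrite e eqxx in IHw; move/esym/andP: IHw => [l1 l2].
rewrite e andbT; case: b => /=.
  have -> : x < lend w + q (false :: w) + q (true :: w) by rewrite qw in l2; lra.
  by rewrite andbT eqb_id.
by rewrite eqbF_neg -ltNge l1.
Qed.

Lemma measurable_bits m (w : seq bool) : measurable [set x | bits x m = w].
Proof.
elim: m w => [|m IHm] [|b w].
- by rewrite (_ : [set _ | _] = setT) //; apply/seteqP; split.
- by rewrite (_ : [set _ | _] = set0) //; apply/seteqP; split.
- by rewrite (_ : [set _ | _] = set0) //; apply/seteqP; split.
rewrite (_ : [set _ | _] = [set x | bits x m = w] `&`
    (if b then `[lend w + q (false :: w), +oo[%classic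
     else `]-oo, lend w + q (false :: w)[%classic)).
  by apply: measurableI => //; case: b.
apply/seteqP; split => x /=.
  case=> <- <-; split => //; case: leP => /= h; rewrite in_itv /= ?andbT //.
case=> -> h; congr cons; case: b h => /=; rewrite in_itv /= ?andbT // => h.
by apply/negbTE; rewrite -ltNge.
Qed.

Lemma uniform_bits w : U [set x | bits x (size w) = w] = (q w)%:E.
Proof.
have mB := measurable_bits (size w) w.
apply: etrans (uniform_setI01 mB) _.

rewrite (_ : _ `&` _ = `[lend w, lend w + q w[%classic); last first.
  apply/seteqP; split => x /=.
    by rewrite !in_itv /= => -[/eqP + x01]; rewrite bitsP.
  rewrite !in_itv /= => h; suff x01 : 0 <= x < 1.
    by split => //; apply/eqP; rewrite bitsP.
  have := lend_ge0 w; have := rend_le1 w; move/andP: h => [? ?] ? ?; apply/andP; split; lra.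
have lr : lend w <= lend w + q w by rewrite lerDl.
by apply: (etrans (uniform_itv (lend_ge0 w) lr (rend_le1 w))); rewrite addrC addKr.
Qed.

End RandomBits.

(** * Independent uniform weights *)

(** Presents the image law as a measure known only by its values, ready for the uniqueness of
    measures agreeing on a pi-system. *)
Lemma pushforward_measure (R : realType) (d d' : measure_display)
    (T : measurableType d) (S : measurableType d') (mu : measure T R) (f : T -> S) :
  measurable_fun setT f ->
  exists m : measure S R, forall C, m C = mu (f @^-1` C).
Proof.
move=> mf; unshelve eexists; first by refine (pushforward mu f); exact: mf.
by [].
Qed.

Section Independence.
Variables (R : realType) (d d' : measure_display).
Variables (T : measurableType d) (S : measurableType d').
Variables (P : probability T R) (I : eqType) (Y : I -> T -> S).
Hypothesis mY : forall i, measurable_fun setT (Y i).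
Variable G : set (set S).
Hypotheses (GS : measurable = <<s G >>) (GI : setI_closed G) (GT : G setT).

Let indep (s : seq I) (A : I -> set S) :=
  P (\bigcap_(i in [set` s]) (Y i @^-1` A i)) = (\prod_(i <- s) P (Y i @^-1` A i))%E.

Let mpre i A : measurable A -> measurable (Y i @^-1` A).
Proof. by move=> mA; rewrite -[X in measurable X]setTI; apply: mY. Qed.

Let cap_cons (i : I) (s : seq I) (A : I -> set S) :
  \bigcap_(k in [set` i :: s]) (Y k @^-1` A k) =
  Y i @^-1` A i `&` \bigcap_(k in [set` s]) (Y k @^-1` A k).
Proof.
apply/seteqP; split=> t.
  move=> h; split=> [|k ks]; first by apply: (h i); rewrite /= inE eqxx.
  by apply: (h k); rewrite /= inE (_ : k \in s) ?orbT.
by move=> [h1 h2] k /=; rewrite inE => /orP[/eqP ->|/h2].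
Qed.

Let cap_perm (s s' : seq I) (A : I -> set S) : perm_eq s s' -> indep s A -> indep s' A.
Proof.
move=> ss'; rewrite /indep => h.
rewrite -(perm_big _ ss') -h; congr (P _).
suff -> : [set` s] = [set` s'] by [].
by apply/seteqP; split=> i /=; rewrite (perm_mem ss').
Qed.

Let Gm A : G A -> measurable A.
Proof. by move=> GA; rewrite GS; apply: sub_gen_smallest. Qed.

(** The pi-system [G] is enlarged to all measurable sets one index at a time: with the other sets
    fixed, both sides of the product formula are finite measures in the remaining set. *)
Lemma indep_extend : (forall s A, uniq s -> (forall i, G (A i)) -> indep s A) ->
  forall s A, uniq s -> (forall i, measurable (A i)) -> indep s A.
Proof.
move=> hG.
(* The indices in [s1] already carry arbitrary measurable sets, the others still carry members of
   [G]. *)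
suff ext s1 s2 A : uniq (s1 ++ s2) -> (forall i, i \in s1 -> measurable (A i)) ->
    (forall i, i \notin s1 -> G (A i)) -> indep (s1 ++ s2) A.
  move=> s A us mA.
  pose A' i := if i \in s then A i else setT.
  have := ext s [::] A'; rewrite cats0 => /(_ us) h.
  have : indep s A'.
    apply: h => [i si|i /negPf si]; first by rewrite /A' si.
    by rewrite /A' si.
  rewrite /indep (eq_big_seq (fun i => P (Y i @^-1` A i))); last first.
    by move=> i si; rewrite /A' si.
  by move=> <-; congr (P _); apply: eq_bigcapr => i /= si; rewrite /A' si.
elim: s1 s2 A => [|e s1 IH] s2 A us mA GA.
  by apply: hG => // i; apply: GA.
have hp : perm_eq (s1 ++ e :: s2) (e :: s1 ++ s2).
  by rewrite perm_catC /= perm_cons perm_catC.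
have us' : uniq (s1 ++ e :: s2) by rewrite (perm_uniq hp).
have nes1 : e \notin s1 by move: us => /= /andP[]; rewrite mem_cat negb_or => /andP[].
pose upd C i := if i == e then C else A i.
pose s := s1 ++ s2.
have es : e \notin s by case/andP: us.
have updE C i : i \in s -> upd C i = A i.
  by move=> si; rewrite /upd; case: eqP => // ie; rewrite -ie si in es.
pose B := \bigcap_(k in [set` s]) (Y k @^-1` A k).
have mA' i : i \in s -> measurable (A i).
  rewrite /s mem_cat => /orP[i1|i2].
    by apply: mA; rewrite inE i1 orbT.
  apply/Gm/GA; rewrite inE negb_or; apply/andP; split.
    by apply: contraNneq es => <-; rewrite /s mem_cat i2 orbT.
  move: us => /= /andP[_]; rewrite cat_uniq => /and3P[_ /hasPn h _]; exact: h.
have mB : measurable B.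
  apply: fin_bigcap_measurable; first exact: finite_seq.
  by move=> i si; apply/mpre/mA'.
have capE C : \bigcap_(k in [set` e :: s]) (Y k @^-1` upd C k) = Y e @^-1` C `&` B.
  rewrite cap_cons /upd eqxx; congr (_ `&` _).
  by apply: eq_bigcapr => k /= ks; rewrite -/(upd C k) updE.
have prodE C : (\prod_(k <- e :: s) P (Y k @^-1` upd C k) =
    P (Y e @^-1` C) * \prod_(k <- s) P (Y k @^-1` A k))%E.
  rewrite big_cons {1}/upd eqxx; congr (_ * _)%E.
  by apply: eq_big_seq => k ks; rewrite updE.
have hGe C : G C -> P (Y e @^-1` C `&` B) =
    (P (Y e @^-1` C) * \prod_(k <- s) P (Y k @^-1` A k))%E.
  move=> GC; rewrite -capE -prodE.
  apply: (cap_perm hp); apply: IH => // i i1; rewrite /upd.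
    by case: eqP => [_|_]; [exact: Gm | apply: mA; rewrite inE i1 orbT].
  by case: eqP => // /eqP ie; apply: GA; rewrite inE negb_or ie.
have PB : P B = (\prod_(k <- s) P (Y k @^-1` A k))%E.
  by have := hGe setT GT; rewrite preimage_setT setTI probability_setT mul1e.
have mAe : measurable (A e) by apply: mA; rewrite inE eqxx.
suff : P (Y e @^-1` A e `&` B) = (P (Y e @^-1` A e) * P B)%E.
  by rewrite PB /indep /= => h; rewrite cap_cons big_cons -/s -h.
(* As functions of [C], [m1] is the law of [Y e] restricted to [B], and [m2] is the law of [Y e]
   scaled by the mass of [B]. *)
pose pB : {nonneg R} := NngNum (fine_ge0 (measure_ge0 P B)).
have [m1 m1E'] := pushforward_measure (mrestr P mB) (mY e).
have [m2' m2E'] := pushforward_measure P (mY e).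
pose m2 : measure S R := mscale pB m2'.
have m1E C : m1 C = P (Y e @^-1` C `&` B) by rewrite m1E'.
have m2E C : m2 C = (P (Y e @^-1` C) * P B)%E.
  transitivity ((fine (P B))%:E * m2' C)%E; first by [].
  by rewrite m2E' muleC fineK // fin_num_measure.
rewrite -m1E -m2E.
apply: (measure_unique G (fun=> setT) GS GI) => //.
- by rewrite bigcup_const //; exists 0%N.
- by move=> C GC; rewrite m1E m2E hGe // PB.
- move=> _; rewrite m1E; apply: (@le_lt_trans _ _ 1%E); last exact: ltry.
  apply: probability_le1; apply: measurableI => //; exact: mpre.
Qed.

End Independence.

Section Words.
Implicit Types (eta : nat -> bool) (w : seq bool).

(** The prefix of length [m], last bit first as in [bits]. *)
Fixpoint word eta (m : nat) : seq bool :=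
  if m is m'.+1 then eta m' :: word eta m' else [::].

Lemma size_word eta m : size (word eta m) = m.
Proof. by elim: m => //= m ->. Qed.

Lemma eq_word eta eta' m :
  word eta m = word eta' m <-> forall n, (n < m)%N -> eta n = eta' n.
Proof.
elim: m => [|m IHm] //=; split=> [[em /IHm h] n|h].
  by rewrite ltnS leq_eqVlt => /orP[/eqP ->|/h].
by congr cons; [apply: h | apply/IHm => n nm; apply/h/ltnW].
Qed.

Definition digit w (n : nat) : bool := nth false (rev w) n.

Lemma word_digit w : word (digit w) (size w) = w.
Proof.
elim: w => [|b w IHw] //=; congr cons.
  by rewrite /digit rev_cons nth_rcons size_rev ltnn eqxx.
rewrite -[RHS]IHw; apply/eq_word => n nw.
by rewrite /digit rev_cons nth_rcons size_rev nw.
Qed.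

(** Prefixes as elements of a finite type, so that events on them reduce to the finite sums of
    [pr_disc]. *)
Definition block m eta : {ffun 'I_m -> bool} := [ffun i : 'I_m => eta i].

Definition unblock m (f : {ffun 'I_m -> bool}) (n : nat) : bool :=
  if insub n is Some i then f i else false.

Lemma unblockK m eta n : (n < m)%N -> unblock (block m eta) n = eta n.
Proof. by move=> nm; rewrite /unblock insubT ffunE. Qed.

Lemma word_block m eta : word (unblock (block m eta)) m = word eta m.
Proof. by apply/eq_word => n /unblockK ->. Qed.

Lemma blockP m eta (f : {ffun 'I_m -> bool}) :
  block m eta = f <-> word eta m = word (unblock f) m.
Proof.
rewrite eq_word; split=> [<- n /unblockK -> //|h].
by apply/ffunP => i; rewrite ffunE h // /unblock valK.
Qed.

Definition cyl w : set (nat -> bool) := [set eta | word eta (size w) = w].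

(** The empty set is included to make the family stable under intersection: two cylinders are nested
    or disjoint. *)
Definition cyls : set (set (nat -> bool)) := [set A | A = set0 \/ exists w, A = cyl w].

Definition bitseqs := g_sigma_algebraType cyls.

Lemma cylsT : cyls setT.
Proof. by right; exists [::]; apply/seteqP; split. Qed.

Lemma cylsI : setI_closed cyls.
Proof.
have cyl_sub w w' : (size w <= size w')%N -> cyls (cyl w `&` cyl w').
  move=> ww'; have [[eta [e1 e2]]|no] := pselect (cyl w `&` cyl w' !=set0).
    right; exists w'; apply/seteqP; split=> eta' [] // e3; split => //.
    have /eq_word e : word eta' (size w') = word eta (size w') by rewrite e2.
    by rewrite /cyl /= -[RHS]e1; apply/eq_word => n nw; apply/e/(leq_trans nw).
  by left; apply/seteqP; split => // eta ee; apply: no; exists eta.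
move=> A B [-> _|[w ->]] ; first by left; rewrite set0I.
move=> [->|[w' ->]]; first by left; rewrite setI0.
have [/cyl_sub //|/ltnW/cyl_sub] := leqP (size w) (size w').
by rewrite setIC.
Qed.

Lemma measurable_cyl w : measurable (cyl w : set bitseqs).
Proof. by apply: sub_sigma_algebra; right; exists w. Qed.

End Words.

Section MeasurableBits.
Variables (d : measure_display) (T : measurableType d) (beta : T -> nat -> bool).
Hypothesis mbeta : forall n, measurable [set t | beta t n].

Lemma measurable_word m w : measurable [set t | word (beta t) m = w].
Proof.
elim: m w => [|m IHm] [|b w].
- by rewrite (_ : [set _ | _] = setT) //; apply/seteqP; split.
- by rewrite (_ : [set _ | _] = set0) //; apply/seteqP; split.
- by rewrite (_ : [set _ | _] = set0) //; apply/seteqP; split.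
rewrite (_ : [set _ | _] = [set t | word (beta t) m = w] `&`
    (if b then [set t | beta t m] else ~` [set t | beta t m])).
  by apply: measurableI => //; case: b => //; apply: measurableC.
apply/seteqP; split => t /=.
  by case=> <- <-; split => //; case: ifP => //= ->.
by case=> -> h; congr cons; case: b h => //= /negP/negbTE.
Qed.

Lemma measurable_block m f : measurable [set t | block m (beta t) = f].
Proof.
rewrite (_ : [set _ | _] = [set t | word (beta t) m = word (unblock f) m]).
  exact: measurable_word.
by apply/seteqP; split => t /=; rewrite blockP.
Qed.

Lemma measurable_fun_bitseqs : measurable_fun setT (beta : T -> bitseqs).
Proof.
apply: (@measurability d _ T bitseqs setT beta cyls erefl) => _ [A [->|[w ->]] <-].
  by rewrite preimage_set0 setI0.
by rewrite setTI; apply: measurable_word.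
Qed.

End MeasurableBits.

Lemma measurable_fun_disc (d d' : measure_display) (T : measurableType d)
    (S : measurableType d') (F : finType) (X : T -> F) (g : F -> S) :
  (forall f, measurable [set t | X t = f]) -> measurable_fun setT (g \o X).
Proof.
move=> mX _ A mA; rewrite setTI.
rewrite (_ : _ @^-1` _ = [set t | [pred f | `[< A (g f) >]] (X t)]).
  exact: measurable_disc.
by apply/seteqP; split => t /= /asboolP.
Qed.

Section ConsistentBits.
Variables (R : realType) (q : seq bool -> R).

Definition bit (x : R) (n : nat) : bool := head false (bits q x n.+1).

Lemma bitsE x m : bits q x m = word (bit x) m.
Proof. by elim: m => // m IHm; rewrite /= -IHm. Qed.

Lemma measurable_bit n : measurable [set x : measurableTypeR R | bit x n].
Proof.
rewrite (_ : [set _ | _] = \bigcup_(w in [set w : n.-tuple bool | true])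
    [set x | bits q x n.+1 = true :: w]).
  apply: fin_bigcup_measurable; first exact: finite_finset.
  by move=> w _; apply: measurable_bits.
apply/seteqP; split=> [x bx|x [w _] /=]; last by rewrite /bit /= => -[->].
have sz : size (bits q x n) == n by rewrite size_bits.
by exists (Tuple sz) => //=; congr cons; apply: bx.
Qed.

Hypotheses (q0 : forall w, 0 <= q w) (q1 : q [::] = 1).
Hypothesis qS : forall w, q w = q (true :: w) + q (false :: w).

Lemma uniform_word w :
  uniform_prob (@ltr01 R) [set x | word (bit x) (size w) = w] = (q w)%:E.
Proof.
rewrite -(uniform_bits q0 q1 qS); congr (uniform_prob _ _).
by apply/seteqP; split => x /=; rewrite bitsE.
Qed.

Lemma pr_block m (f : {ffun 'I_m -> bool}) :
  pr (uniform_prob (@ltr01 R)) [set x | block m (bit x) = f] = q (word (unblock f) m).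
Proof.
rewrite /pr (_ : [set _ | _] =
   [set x | word (bit x) (size (word (unblock f) m)) = word (unblock f) m]).
  by rewrite [X in fine X]uniform_word.
by apply/seteqP; split => x /=; rewrite size_word blockP.
Qed.

End ConsistentBits.

Section FairBits.
Variable R : realType.

Definition fair (w : seq bool) : R := 2^-1 ^+ size w.

Lemma fair_ge0 w : 0 <= fair w.
Proof. by rewrite exprn_ge0 // invr_ge0. Qed.

Lemma fair_nil : fair [::] = 1. Proof. by []. Qed.

Lemma fairS w : fair w = fair (true :: w) + fair (false :: w).
Proof.
by rewrite /fair /= !exprS -mulrDl -[in LHS](mul1r (_ ^+ _)) {1}(splitr 1) div1r.
Qed.

Let U : probability _ R := uniform_prob (@ltr01 R).

Definition fair_bit : R -> nat -> bool := bit fair.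

Lemma bits_indep (s : seq nat) (b : nat -> bool) : uniq s ->
  pr U [set x | forall n, n \in s -> fair_bit x n = b n] = 2^-1 ^+ size s.
Proof.
move=> us; pose m := (\max_(n <- s) n.+1)%N.
have sm n : n \in s -> (n < m)%N.
  by move=> ns; apply: (leq_bigmax_seq _ ns).
pose B := [pred f : {ffun 'I_m -> bool} | all (fun n => unblock f n == b n) s].
rewrite (_ : [set _ | _] = [set x | B (block m (fair_bit x))]); last first.
  apply/seteqP; split=> x /= h.
    by apply/allP => n ns; rewrite unblockK ?h ?sm.
  by move=> n ns; move/allP: h => /(_ _ ns); rewrite unblockK ?sm // => /eqP.
rewrite pr_disc; last by move=> f; apply: (measurable_block (measurable_bit fair)).
rewrite (eq_bigr (fun=> 2^-1 ^+ m)); last first.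
  move=> f _; apply: etrans (pr_block fair_ge0 fair_nil fairS f) _.
  by rewrite /fair size_word.
(* Summed over [c], this factor is 1/2 at a prescribed position and 1 at a free one. *)
pose a (i : 'I_m) (c : bool) : R := (((i : nat) \in s) ==> (c == b i))%:R * 2^-1.
transitivity (\sum_(f : {ffun 'I_m -> bool}) \prod_i a i (f i)).
  rewrite big_mkcond; apply: eq_bigr => f _; rewrite big_split /= prodr_const card_ord.
  case: ifP => [/allP h|/negbT/allPn[n ns nb]].
    rewrite big1 ?mul1r // => i _; case: (boolP ((i : nat) \in s)) => //= si.
    by have := h _ si; rewrite /unblock valK => ->.
  rewrite (bigD1 (Ordinal (sm _ ns))) //= ns /=.
  have -> : (f (Ordinal (sm _ ns)) == b n) = false.
    by apply/negbTE; move: nb; rewrite /unblock (@insubT nat (fun k => k < m)%N _ n (sm _ ns)).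
  by rewrite !mul0r.
rewrite -(bigA_distr_bigA a).
rewrite (eq_bigr (fun i : 'I_m => if (i : nat) \in s then 2^-1 else 1 : R)); last first.
  move=> i _; rewrite big_bool /a; case: ifP => _ /=; first by case: (b i) => /=; lra.
  by lra.
rewrite -big_mkcond /= prodr_const; congr (_ ^+ _).
rewrite cardE -(size_map val); apply/esym/perm_size/uniq_perm => //.
  by rewrite (map_inj_uniq val_inj) enum_uniq.
move=> n; apply/idP/mapP => [ns|[i + ->]]; last by rewrite mem_enum.
by exists (Ordinal (sm _ ns)); rewrite ?mem_enum.
Qed.

End FairBits.

Section IidUniform.
Variable R : realType.
Let U : probability (measurableTypeR R) R := uniform_prob (@ltr01 R).

Notation lendw m := (fun eta => lend (@fair R) (word eta m)).

(** The number with binary digits [eta], as the limit of the left endpoints of its dyadic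
    intervals. *)
Definition psi (eta : nat -> bool) : R := limn (fun m => lendw m eta).

Lemma cvg_psi eta : (fun m => lendw m eta) @ \oo --> psi eta.
Proof.
apply: nondecreasing_is_cvgn.
  apply/nondecreasing_seqP => m /=; case: (eta m) => //.
  by rewrite lerDl fair_ge0.
exists 1 => _ [m _ <-]; apply: le_trans (rend_le1 (@fair_ge0 R) (@fair_nil R) (@fairS R) (word eta m)).
by rewrite lerDl fair_ge0.
Qed.

Lemma psi_bit x : 0 <= x < 1 -> psi (@fair_bit R x) = x.
Proof.
move=> x01; apply/cvg_lim => //.
have xm m : lendw m (fair_bit x) <= x < lendw m (fair_bit x) + 2^-1 ^+ m.
  have := bitsP (@fair_ge0 R) (@fair_nil R) (@fairS R) (bits (@fair R) x m) x01.
  by rewrite size_bits eqxx /fair size_bits bitsE => <-.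
apply: (@squeeze_cvgr _ _ _ _ (fun m => x - 2^-1 ^+ m) (fun=> x)).
- near=> m; have /andP[h1 h2] := xm m.
  by rewrite h1 andbT; lra.
- rewrite -[X in _ --> X]subr0; apply: cvgB; first exact: cvg_cst.
  by apply: cvg_expr; rewrite ger0_norm ?invr_ge0 // invf_lt1 // ltr1n.
- exact: cvg_cst.
Unshelve. all: by end_near. Qed.

Lemma measurable_psi : measurable_fun setT (psi : bitseqs -> R).
Proof.
apply: (@measurable_realfun.measurable_fun_cvg _ _ _ _ (fun m (eta : bitseqs) => lendw m eta)); last first.
  by move=> eta _; apply: cvg_psi.
move=> m.
have mb n : measurable [set eta : bitseqs | eta n].
  rewrite (_ : [set _ | _] = \bigcup_(f in [set f : {ffun 'I_n.+1 -> bool} | f ord_max])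
     cyl (word (unblock f) n.+1)).
    by apply: fin_bigcup_measurable => [|f _]; [exact: finite_finset|exact: measurable_cyl].
  apply/seteqP; split => [eta en|eta [f fn]].
    exists (block n.+1 eta); first by rewrite /= ffunE.
    by rewrite word_block /cyl /mkset size_word.
  rewrite /cyl /mkset size_word => /eq_word /(_ n (ltnSn n)) ->.
  rewrite /unblock (@insubT nat (fun k => k < n.+1)%N _ n (ltnSn n)).
  by rewrite (_ : Sub _ _ = ord_max) //; apply: val_inj.
rewrite (_ : (fun eta => _) =
   (fun f : {ffun 'I_m -> bool} => lendw m (unblock f)) \o block m); last first.
  by apply/funext => eta /=; rewrite word_block.
by apply: measurable_fun_disc => f; apply: (@measurable_block _ bitseqs id mb).
Qed.

Variable I : countType.

(** The digits of one uniform number are dealt out along the injection [pickle], which gives each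
    index of [I] its own sequence; disjoint digits make the sequences independent. *)
Definition ibit (i : I) (x : R) (j : nat) : bool := fair_bit x (pickle (i, j)).

Lemma measurable_ibit i : measurable_fun setT (ibit i : R -> bitseqs).
Proof. by apply: measurable_fun_bitseqs => n; apply: (measurable_bit (@fair R)). Qed.

Lemma ibit_words (s : seq I) (w : I -> seq bool) : uniq s ->
  pr U [set x | forall i, i \in s -> cyl (w i) (ibit i x)] =
  \prod_(i <- s) fair R (w i).
Proof.
move=> us.
(* The positions of all the prescribed digits, distinct because [pickle] is injective; [b] decodes
   the digit prescribed at each. *)
pose idx := flatten [seq [seq pickle (i, j) | j <- iota 0 (size (w i))] | i <- s].
pose b n := if unpickle n is Some ij then digit (w ij.1) ij.2 else false : bool.
have b_pickle i j : b (pickle (i, j)) = digit (w i) j by rewrite /b pickleK.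
have uidx : uniq idx.
  rewrite /idx; elim: (s) us => //= i s' IH /andP[is' us'].
  rewrite cat_uniq IH // andbT; apply/andP; split.
    rewrite map_inj_uniq ?iota_uniq // => j k /(pcan_inj pickleK); by case.
  apply/hasPn => n /flattenP[_ /mapP[i' i's' ->] /mapP[j _ ->]].
  apply/negP => /mapP[k _ /(pcan_inj pickleK) [ii' _]].
  by rewrite -ii' i's' in is'.
have := bits_indep R b uidx.
rewrite (_ : [set x | forall n, n \in idx -> fair_bit x n = b n] =
    [set x | forall i, i \in s -> cyl (w i) (ibit i x)]); last first.
  apply/seteqP; split => x /= h.
    move=> i is_; rewrite /cyl /= -[RHS]word_digit; apply/eq_word => j jw.
    rewrite -b_pickle; apply: h; apply/flattenP.
    exists [seq pickle (i, j) | j <- iota 0 (size (w i))]; first exact: map_f.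
    by apply: map_f; rewrite mem_iota.
  move=> n /flattenP[_ /mapP[i is_ ->] /mapP[j + ->]].
  rewrite mem_iota => /= jw; rewrite b_pickle.
  have := h _ is_; rewrite /cyl /= -[X in _ = X]word_digit => /eq_word; exact.
move=> ->; rewrite size_flatten /shape -map_comp sumnE big_map /fair.
rewrite (eq_bigr (fun i => size (w i))); last by move=> i _; rewrite /= size_map size_iota.
by rewrite -expr_sum.
Qed.

Lemma ibit_cyl i w : U (ibit i @^-1` cyl w) = (fair R w)%:E.
Proof.
have := @ibit_words [:: i] (fun=> w) isT; rewrite big_seq1 => <-.
rewrite -prE.
  congr (U _); apply/seteqP; split => x /=; first by move=> h _ /[!inE] /eqP ->.
  by apply; rewrite inE.
rewrite (_ : [set _ | _] = ibit i @^-1` cyl w).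
  by rewrite -[X in measurable X]setTI; apply: measurable_ibit => //; exact: measurable_cyl.
apply/seteqP; split => x /=; last by move=> h _ /[!inE] /eqP ->.
by apply; rewrite inE.
Qed.

Lemma ibit_law i (A : set bitseqs) : measurable A ->
  U (ibit i @^-1` A) = U (@fair_bit R @^-1` A).
Proof.
move=> mA.
have [m1 m1E] := pushforward_measure U (measurable_ibit i).
have [m2 m2E] := pushforward_measure U (measurable_fun_bitseqs (measurable_bit (@fair R))).
rewrite -m1E -m2E.
apply: (@measure_unique _ R bitseqs cyls (fun=> setT) erefl cylsI (fun=> cylsT)) => //.
- by rewrite bigcup_const //; exists 0%N.
- move=> C [->|[w ->]]; first by rewrite !measure0.
  rewrite m1E m2E; apply: etrans (ibit_cyl i w) _.
  by rewrite -(uniform_word (@fair_ge0 R) (@fair_nil R) (@fairS R)).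
- move=> _; rewrite m1E preimage_setT.
  by apply: le_lt_trans (ltry 1); apply: (@probability_le1 _ _ _ U).
Qed.

Definition iweight (i : I) (x : R) : R := psi (ibit i x).

Lemma measurable_iweight i : measurable_fun setT (iweight i).
Proof. exact: measurableT_comp measurable_psi (measurable_ibit i). Qed.

Lemma iweight_law i (A : set R) : measurable A -> U (iweight i @^-1` A) = U A.
Proof.
move=> mA.
have mpA : measurable (psi @^-1` A : set bitseqs).
  by rewrite -[X in measurable X]setTI; apply: measurable_psi.
rewrite (ibit_law i mpA).
have mB : measurable (@fair_bit R @^-1` (psi @^-1` A)).
  rewrite -[X in measurable X]setTI.
  exact: (measurable_fun_bitseqs (measurable_bit (@fair R))).
apply: etrans (uniform_setI01 mB) _; apply: etrans (esym (uniform_setI01 mA)).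
congr (U _).
by apply/seteqP; split => x /= []; rewrite in_itv /= => + x01; rewrite psi_bit.
Qed.

Lemma iid_uniform : exists W : I -> {RV U >-> R}, iid W (uniform_prob (@ltr01 R)).
Proof.
exists (fun i => @mfun_Sub _ _ (measurableTypeR R) R (iweight i)
  (mem_set (measurable_iweight i))).
split; first by move=> i A mA; apply: iweight_law.
move=> s A us mA.
have := @indep_extend R _ _ (measurableTypeR R) bitseqs U I ibit measurable_ibit cyls erefl cylsI cylsT _ s
   (fun i => psi @^-1` A i) us.
apply; last first.
  by move=> i; rewrite -[X in measurable X]setTI; apply: measurable_psi.
move=> {us mA A s} s A us cA.
have [[i [is_ Ai0]]|no] := pselect (exists i, i \in s /\ A i = set0).
  rewrite (big_rem i) //= Ai0 preimage_set0 measure0 mul0e.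
  rewrite (_ : \bigcap_(_ in _) _ = set0) ?measure0 //.
  by apply/seteqP; split => // x /(_ i is_) /=; rewrite Ai0.
have [w wA] : exists w : I -> seq bool, forall i, i \in s -> A i = cyl (w i).
  have : forall i, exists w, i \in s -> A i = cyl w.
    move=> i; case: (cA i) => [A0|[w Aw]]; last by exists w.
    by exists [::] => is_; case: no; exists i.
  by move/choice => [w wA]; exists w.
rewrite (eq_big_seq (fun i => (fair R (w i))%:E)); last first.
  by move=> i is_; rewrite wA // ibit_cyl.
rewrite prodEFin -ibit_words // -prE; last first.
  rewrite (_ : [set _ | _] = \bigcap_(i in [set` s]) (ibit i @^-1` cyl (w i))) //.
  apply: fin_bigcap_measurable; first exact: finite_seq.
  move=> i _; rewrite -[X in measurable X]setTI; apply: measurable_ibit => //.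
  exact: measurable_cyl.
congr (U _); apply/seteqP; split => x /= h i is_; have := h i is_; by rewrite /= wA.
Qed.

End IidUniform.

(** * The incipient infinite cluster *)

Section Read.
Variables (sigma : nat) (L : finType).
Implicit Types (f : edge sigma -> L).

Fixpoint ball_edges (n : nat) : seq (edge sigma) :=
  if n is n'.+1 then
    flatten [seq ([::], i) :: [seq (i :: e.1, e.2) | e <- ball_edges n'] | i <- enum 'I_sigma]
  else [::].

Lemma mem_ball_edges n v i : ((v, i) \in ball_edges n) = (size v < n)%N.
Proof.
elim: n v => [|n IHn] [|j v] //=.
  apply/flattenP; eexists; first by apply/mapP; exists i => //; rewrite mem_enum.
  by rewrite inE eqxx.
rewrite ltnS -IHn; apply/flattenP/idP => [[_ /mapP[k _ ->]]|vi].
  by rewrite inE => /orP[/eqP[]//|/mapP[[u l] ul] [_ -> ->]].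
eexists; first by apply/mapP; exists j => //; rewrite mem_enum.
by rewrite inE; apply/orP; right; apply/mapP; exists (v, i).
Qed.

Lemma uniq_ball_edges n : uniq (ball_edges n).
Proof.
elim: n => [|n IHn] //=; elim: (enum 'I_sigma) (enum_uniq 'I_sigma) => //= i s IHs /andP[is_ us].
rewrite -cons_uniq -cat_cons cat_uniq IHs // andbT cons_uniq map_inj_uniq ?IHn; last by move=> [u k] [v l] [-> ->].
rewrite andbT.
apply/andP; split; first by apply/negP => /mapP[[]].
apply/hasPn => e /flattenP[_ /mapP[k ks ->]] ek.
have ki : k != i by apply: contraNneq is_ => <-.
apply/negP => ei; move: ek ei; rewrite !inE => /orP[/eqP ->|/mapP[g _ ->]].
  by move=> /orP[/eqP[e1]|/mapP[[]//]]; rewrite e1 eqxx in ki.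
by move=> /orP[/eqP//|/mapP[g' _ [e1]]]; rewrite e1 eqxx in ki.
Qed.

Lemma eq_read n f f' :
  read n f = read n f' <-> (forall e, e \in ball_edges n -> f e = f' e).
Proof.
transitivity (forall v i, (size v < n)%N -> f (v, i) = f' (v, i)); last first.
  split=> h => [[v i]|v i vn]; first by rewrite mem_ball_edges; apply: h.
  by apply: h; rewrite mem_ball_edges.
elim: n f f' => [|n IHn] f f' /=; first by split.
split=> [/ffunP h v i|h].
  case: v => [|j v]; first by have := h i; rewrite !ffunE => -[].
  by have := h j; rewrite !ffunE ltnS => -[_ /IHn h'] vn; apply: h'.
apply/ffunP => i; rewrite !ffunE; congr pair; first exact: h.
by apply/IHn => v j vn; apply: h.
Qed.

(** A configuration with prescribed labels below height [n]; the default [l0] fills the edges that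
    [read n] does not see. *)
Fixpoint unread (l0 : L) n (w : labeling sigma L n) (v : vertex sigma) (i : 'I_sigma) : L :=
  match n, v return labeling sigma L n -> L with
  | 0%N, _ => fun _ => l0
  | n'.+1, [::] => fun w => (lbranch w i).1
  | n'.+1, j :: v' => fun w => unread l0 (lbranch w j).2 v' i
  end w.

Lemma unreadK l0 n (w : labeling sigma L n) :
  read n (fun e => unread l0 w e.1 e.2) = w.
Proof.
elim: n w => [|n IHn] w /=; first by case: w.
apply/ffunP => i; rewrite ffunE /= [RHS]surjective_pairing; congr pair.
exact: (IHn (lbranch w i).2).
Qed.

Lemma lab_law_read (R : realFieldType) (q : L -> R) n f :
  lab_law q (read n f) = \prod_(e <- ball_edges n) q (f e).
Proof.
elim: n f => [|n IHn] f; first by rewrite big_nil.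
rewrite /= big_flatten big_map big_enum /=; apply: eq_bigr => i _.
by rewrite /lbranch ffunE /= IHn big_cons big_map.
Qed.

End Read.

Section IidRead.
Variables (R : realType) (d : measure_display) (T : measurableType d).
Variables (P : probability T R) (d' : measure_display) (T' : measurableType d').
Variables (sigma : nat) (X : edge sigma -> {RV P >-> T'}) (mu : set T' -> \bar R).
Hypothesis iidX : iid X mu.
Variables (L : finType) (l0 : L) (h : T' -> L) (q : L -> R).
Hypotheses (mh : forall l, measurable (h @^-1` [set l])).
Hypothesis muq : forall l, mu (h @^-1` [set l]) = (q l)%:E.

Let read_cap n f : [set t | read n (fun e => h (X e t)) = read n f] =
  \bigcap_(e in [set` ball_edges sigma n]) (X e @^-1` (h @^-1` [set f e])).
Proof.
by apply/seteqP; split => t /=; rewrite eq_read.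
Qed.

Lemma measurable_read n w : measurable [set t | read n (fun e => h (X e t)) = w].
Proof.
rewrite -(unreadK l0 w) read_cap; apply: fin_bigcap_measurable; first exact: finite_seq.
by move=> e _; rewrite -[X in measurable X]setTI; apply: measurable_funP.
Qed.

Lemma pr_read n w : pr P [set t | read n (fun e => h (X e t)) = w] = lab_law q w.
Proof.
rewrite -(unreadK l0 w) /pr read_cap; case: iidX => [Xl Xi].
rewrite (Xi _ (fun e => h @^-1` [set unread l0 w e.1 e.2])) ?uniq_ball_edges //.
rewrite lab_law_read (eq_bigr (fun e => (q (unread l0 w e.1 e.2))%:E)).
  by rewrite prodEFin.
by move=> e _; rewrite -muq; apply: Xl.
Qed.

End IidRead.

Section TraceLaw.
Variables (sigma : nat) (R : realFieldType) (p : R).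

Fixpoint btrace n : labeling sigma bool n -> hcluster sigma n :=
  match n return labeling sigma bool n -> hcluster sigma n with
  | 0%N => fun w => w
  | n'.+1 => fun w => [ffun i => if (lbranch w i).1 then
                          Some (@btrace n' (lbranch w i).2) else None]
  end.

Lemma trace_read n eta : trace n eta = btrace (read n eta) :> hcluster sigma n.
Proof.
elim: n eta => [|n IHn] eta //=; apply/ffunP => i.
by rewrite !ffunE /lbranch ?ffunE /= -?IHn.
Qed.

Definition bern (b : bool) : R := if b then p else 1 - p.

Lemma btrace_law n (F : hcluster sigma n -> R) :
  \sum_(w : labeling sigma bool n) lab_law bern w * F (btrace w) =
  \sum_s perc_law p s * F s.
Proof.
elim: n F => [|n IHn] F; first by [].
pose phi (z : bool * labeling sigma bool n) := if z.1 then Some (btrace z.2) else None.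
rewrite sum_labeling sum_cluster.
have := sum_prod_pushforward (fun=> phi) (fun _ : 'I_sigma => @lbranch_law sigma _ R bern n) F.
congr (_ = _); apply: eq_bigr => y _; congr (_ * _); apply: eq_bigr => i _.
rewrite big_mkcond sum_lbranch big_bool /phi /lbranch_law /= /branch.
case: (y i) => [t|] /=; last first.
  rewrite big1 ?add0r; last by [].
  rewrite -mulr_sumr sum_lab_law ?mulr1 //.
  by rewrite big_bool /= addrC subrK.
rewrite [X in _ + X]big1 ?addr0; last by [].
transitivity (p * \sum_(w : labeling sigma bool n) lab_law bern w * (btrace w == t)%:R).
  rewrite mulr_sumr; apply: eq_bigr => w _; rewrite (inj_eq (@Some_inj _)).
  by case: eqP; rewrite ?mulr1 ?mulr0.
rewrite (IHn (fun s => (s == t)%:R)) (bigD1 t) //= eqxx mulr1 big1 ?addr0 // => s /negPf ->.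
by rewrite mulr0.
Qed.

End TraceLaw.

Section RandomTrace.
Variables (sigma : nat) (d : measure_display) (T : measurableType d).
Variable eta : T -> edge sigma -> bool.
Hypothesis meta : forall e, measurable [set t | eta t e].

Lemma measurable_random_trace n s : measurable [set t | trace n (eta t) = s].
Proof.
rewrite (_ : [set _ | _] = [set t | [pred w | btrace w == s] (read n (eta t))]); last first.
  by apply/seteqP; split => t /=; rewrite trace_read => /eqP.
apply: measurable_disc => w; rewrite -(unreadK false w).
rewrite (_ : [set _ | _] = \bigcap_(e in [set` ball_edges sigma n])
    [set t | eta t e = unread false w e.1 e.2]); last first.
  by apply/seteqP; split => t /=; rewrite eq_read.
apply: fin_bigcap_measurable; first exact: finite_seq.
move=> e _; case: (unread _ _ _ _); first exact: meta.
rewrite (_ : [set _ | _] = ~` [set t | eta t e]); first exact: measurableC.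
by apply/seteqP; split => t /=; [move=> -> | move/negP/negbTE].
Qed.

End RandomTrace.

(** * Branching property and consistency of the laws at different heights *)

Section Restriction.
Variables (sigma : nat) (R : realFieldType) (p : R).

(** Stated at height [k + m] so that the recursion on [k] exposes the branches by computation. *)
Fixpoint prune k m : hcluster sigma (k + m) -> hcluster sigma k :=
  match k return hcluster sigma (k + m) -> hcluster sigma k with
  | 0%N => fun _ => tt
  | k'.+1 => fun s => [ffun i => omap (@prune k' m) (branch s i)]
  end.

Lemma prune_trace k m eta : prune (trace (k + m) eta) = trace k eta.
Proof.
elim: k eta => [|k IHk] eta //=; apply/ffunP => i.
by rewrite !ffunE /branch ?ffunE; case: ifP => //= _; rewrite IHk.
Qed.

Lemma pruneE k m (s : hcluster sigma (k + m)) :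
  prune s = trace k (cluster_edges s).
Proof. by rewrite -[in LHS](trace_cluster_edges s) prune_trace. Qed.

(** The generating function of the number of vertices reached at height [m]; its value at 0 is the
    probability of not reaching that height. *)
Definition genf m (x : R) : R := \sum_(s : hcluster sigma m) perc_law p s * x ^+ frontier s.

Lemma prod_frontier n (s : hcluster sigma n.+1) (x : R) :
  perc_law p s * x ^+ frontier s =
  \prod_i branch_law p (fun t : hcluster sigma n => perc_law p t * x ^+ frontier t) (branch s i).
Proof.
rewrite /= expr_sum -big_split /=; apply: eq_bigr => i _.
by case: (branch s i) => [t|] /=; rewrite ?mulrA // expr0 mulr1.
Qed.

Lemma sum_branch_fiber k m (F : hcluster sigma (k + m) -> R) (G : hcluster sigma k -> R)
    (y : option (hcluster sigma k)) :
  (forall s, \sum_(s' | prune s' == s) F s' = G s) ->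
  \sum_(y' | omap (@prune k m) y' == y) branch_law p F y' = branch_law p G y.
Proof.
move=> FG; rewrite big_mkcond sum_option /=; case: y => [t|] /=.
  by rewrite add0r -big_mkcond -FG mulr_sumr.
by rewrite big1 ?addr0.
Qed.

Lemma sum_prune k m (a : 'I_sigma -> option (hcluster sigma (k + m)) -> R) (s : hcluster sigma k.+1) :
  \sum_(s' : hcluster sigma (k + m).+1 | @prune k.+1 m s' == s)
     \prod_i a i (branch s' i) =
  \prod_i \sum_(y | omap (@prune k m) y == branch s i) a i y.
Proof.
rewrite bigA_distr_big_dep /=; apply: eq_bigl => s'.
apply/eqP/familyP => [<- i|h]; first by rewrite /branch ffunE unfold_in.
by apply/ffunP => i; rewrite ffunE; apply/eqP/h.
Qed.

(** Branching property: above each frontier vertex of [s] grows an independent percolation of height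
    [m]. *)
Lemma genf_prune k m (s : hcluster sigma k) x :
  \sum_(s' : hcluster sigma (k + m) | prune s' == s) perc_law p s' * x ^+ frontier s' =
  perc_law p s * genf m x ^+ frontier s.
Proof.
elim: k s => [|k IHk] s.
  by rewrite /= mul1r expr1; apply: eq_bigl => s'; case: s.
under eq_bigr do rewrite prod_frontier.
rewrite (sum_prune (fun=> branch_law p
  (fun t : hcluster sigma (k + m) => perc_law p t * x ^+ frontier t))) prod_frontier.
apply: eq_bigr => i _.
exact: sum_branch_fiber.
Qed.

Lemma genf0 x : genf 0 x = x.
Proof. by rewrite /genf (bigD1 tt) //= big1 ?addr0 ?mul1r //; case. Qed.

Lemma genfS m x : genf m.+1 x = (1 - p + p * genf m x) ^+ sigma.
Proof.
rewrite /genf; under eq_bigr do rewrite prod_frontier.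
rewrite sum_cluster -(bigA_distr_bigA (fun=> branch_law p
  (fun t : hcluster sigma m => perc_law p t * x ^+ frontier t))).
by rewrite prodr_const card_ord sum_option /= mulr_sumr.
Qed.

Lemma perc_prune k m (s : hcluster sigma k) :
  \sum_(s' : hcluster sigma (k + m) | prune s' == s) perc_law p s' = perc_law p s.
Proof.
have := @genf_prune k m s 1.
under eq_bigr do rewrite expr1n mulr1.
move=> ->; rewrite (_ : genf m 1 = 1) ?expr1n ?mulr1 //.
rewrite /genf; under eq_bigr do rewrite expr1n mulr1.
exact: sum_perc_law.
Qed.

Lemma avoid_prune k m (s : hcluster sigma k) :
  \sum_(s' : hcluster sigma (k + m) | (prune s' == s) && (frontier s' == 0%N)) perc_law p s' =
  perc_law p s * genf m 0 ^+ frontier s.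
Proof.
rewrite -genf_prune big_mkcondr; apply: eq_bigr => s' _.
by rewrite expr0n; case: eqP; rewrite ?mulr1 ?mulr0.
Qed.

Hypothesis psigma : p * sigma%:R = 1.

(** Expand the frontier over the children: term [j] is the case where the backbone goes through
    child [j]. *)
Lemma iic_branch n (s : hcluster sigma n.+1) : iic_law p s =
  \sum_j \prod_i (if i == j then (if branch s i is Some t then p * iic_law p t else 0)
                  else branch_law p (@perc_law sigma R p n) (branch s i)).
Proof.
rewrite /iic_law /= natr_sum mulr_sumr; apply: eq_bigr => j _.
rewrite (bigD1 j) //= [RHS](bigD1 j) //= eqxx.
rewrite [in RHS](eq_bigr (fun i => branch_law p (@perc_law sigma R p n) (branch s i))); last first.
  by move=> i /negPf ->.
by case: (branch s j) => [t|] /=; rewrite ?mulr0 ?mul0r // mulrAC mulrA.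
Qed.

Lemma sum_iic_law n : \sum_(s : hcluster sigma n) iic_law p s = 1.
Proof.
elim: n => [|n IHn]; first by rewrite (bigD1 tt) //= big1 ?addr0 /iic_law /= ?mulr1 //; case.
under eq_bigr do rewrite iic_branch.
rewrite exchange_big /= -[RHS]psigma mulrC -[in RHS](card_ord sigma) mulr_natl -sumr_const.
apply: eq_bigr => j _.
rewrite sum_cluster -(bigA_distr_bigA (fun i y => if i == j then
   (if y is Some t then p * iic_law p t else 0) else branch_law p (@perc_law sigma R p n) y)).
rewrite (bigD1 j) //= eqxx sum_option /= add0r -mulr_sumr IHn mulr1 big1 ?mulr1 //.
by move=> i /negPf ->; apply/sum_branch_law/sum_perc_law.
Qed.

(** Consistency follows the backbone: the branches off it are restricted as plain percolation and
    the induction handles the backbone branch. At its end the mean size of a critical generation, 1,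
    is used. *)
Lemma iic_prune k m (s : hcluster sigma k) :
  \sum_(s' : hcluster sigma (k + m) | prune s' == s) iic_law p s' = iic_law p s.
Proof.
elim: k s => [|k IHk] s.
  rewrite [RHS]mulr1 -[RHS](sum_iic_law m); apply: eq_bigl => s'.
  by case: s.
under eq_bigr do rewrite iic_branch.
rewrite exchange_big [RHS]iic_branch; apply: eq_bigr => j _.
rewrite (sum_prune (fun i y => if i == j then
   (if y is Some t then p * iic_law p t else 0) else branch_law p (@perc_law sigma R p (k + m)) y)).
apply: eq_bigr => i _; case: (eqVneq i j) => _; last first.
  by apply: sum_branch_fiber => t; apply: perc_prune.
rewrite big_mkcond sum_option; case: (branch s i) => [t|] /=.
  by rewrite add0r -big_mkcond -IHk mulr_sumr.
by rewrite big1 // addr0.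
Qed.

End Restriction.

Section CvgSum.
Variables (R : realType) (T : Type) (F : set_system T).
Hypothesis FF : Filter F.

Lemma cvg_sumr (I : Type) (r : seq I) (Q : pred I) (u : I -> T -> R) (l : I -> R) :
  (forall i, u i @ F --> l i) ->
  (fun t => \sum_(i <- r | Q i) u i t) @ F --> \sum_(i <- r | Q i) l i.
Proof.
move=> ul; elim: r => [|i r IHr].
  rewrite big_nil (_ : (fun _ => _) = fun=> 0); first exact: cvg_cst.
  by apply/funext => t; rewrite big_nil.
rewrite big_cons (_ : (fun _ => _) = fun t => if Q i then u i t + \sum_(j <- r | Q j) u j t
    else \sum_(j <- r | Q j) u j t); last by apply/funext => t; rewrite big_cons.
by case: (Q i) => //; apply: cvgD.
Qed.

Lemma cvg_exprn (n : nat) (u : T -> R) (l : R) :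
  u @ F --> l -> (fun t => u t ^+ n) @ F --> l ^+ n.
Proof.
move=> ul; elim: n => [|n IHn].
  rewrite (_ : (fun _ => _) = fun=> 1); first exact: cvg_cst.
  by apply/funext => t; rewrite expr0.
rewrite exprS (_ : (fun _ => _) = fun t => u t * u t ^+ n); first exact: cvgM.
by apply/funext => t; rewrite exprS.
Qed.

End CvgSum.

(** * Survival probability of critical percolation *)

Section Survival.
Variables (sigma : nat) (R : realType).
Hypothesis hsigma : (2 <= sigma)%N.

Let p : R := sigma%:R^-1.

Let sigma0 : 0 < sigma%:R :> R. Proof. by rewrite ltr0n; case: sigma hsigma. Qed.
Let p0 : 0 < p. Proof. by rewrite invr_gt0. Qed.
Let p1 : p <= 1. Proof. by rewrite invf_le1 // ler1n; case: sigma hsigma. Qed.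
Let ps : p * sigma%:R = 1. Proof. by rewrite mulVf // gt_eqF. Qed.

Let ratio_le1 t : 0 <= t <= 1 -> p * \sum_(i < sigma) (1 - p * t) ^+ i <= 1.
Proof.
move=> /andP[t0 t1]; apply: (@le_trans _ _ (p * sigma%:R)); last by rewrite ps.
apply: ler_wpM2l; first exact: ltW.
have -> : sigma%:R = \sum_(i < sigma) 1 :> R by rewrite sumr_const card_ord.
apply: ler_sum => i _; apply: exprn_ile1.
  by rewrite subr_ge0 mulr_ile1 // ltW.
by rewrite lerBlDr lerDl mulr_ge0 // ltW.
Qed.

Definition survival m : R := 1 - genf sigma p m 0.
Notation theta := survival.

Definition survival_ratio m : R := p * \sum_(i < sigma) (1 - p * theta m) ^+ i.

Lemma survivalS m : theta m.+1 = theta m * survival_ratio m.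
Proof.
rewrite /survival_ratio; set S := \sum_(i < sigma) _.
have gE : 1 - p + p * genf sigma p m 0 = 1 - p * theta m by rewrite /theta; ring.
rewrite {1}/theta genfS gE.
have := subrX1 (1 - p * theta m) sigma; rewrite -/S => h.
by rewrite -opprB h; ring.
Qed.

Lemma survival_itv m : 0 < theta m <= 1.
Proof.
elim: m => [|m /andP[t0 t1]]; first by rewrite /theta genf0 subr0 ltr01 lexx.
have a0 : 0 <= 1 - p * theta m by rewrite subr_ge0 mulr_ile1 // ltW.
have r0 : 0 < survival_ratio m.
  rewrite /survival_ratio mulr_gt0 //.
  case: sigma hsigma => // s _; rewrite big_ord_recl expr0.
  by rewrite ltr_pwDl // sumr_ge0 // => i _; apply: exprn_ge0.
rewrite survivalS mulr_gt0 //= mulr_ile1 // ?(ltW t0) ?(ltW r0) //.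
by apply: ratio_le1; rewrite ltW.
Qed.

Lemma survival_ratio_le1 m : survival_ratio m <= 1.
Proof. by have /andP[t0 t1] := survival_itv m; apply: ratio_le1; rewrite ltW. Qed.

Lemma cvg_ratio (u : nat -> R) (l : R) : u @ \oo --> l ->
  (fun m => p * \sum_(i < sigma) (1 - p * u m) ^+ i) @ \oo -->
  p * \sum_(i < sigma) (1 - p * l) ^+ i.
Proof.
move=> ul; apply: cvgM; first exact: cvg_cst.
apply: cvg_sumr => i; apply: cvg_exprn.
by apply: cvgB; [exact: cvg_cst | apply: cvgM => //; exact: cvg_cst].
Qed.

(** The monotone limit [l] is a fixed point of the recursion; if it were positive, the ratio at [l]
    would be less than p sigma = 1. *)
Lemma cvg_survival : theta @ \oo --> (0 : R).
Proof.
have noninc : {homo theta : n m / (n <= m)%N >-> m <= n}.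
  apply/nonincreasing_seqP => m; rewrite survivalS.
  have /andP[t0 _] := survival_itv m.
  by rewrite ler_piMr ?survival_ratio_le1 // ltW.
have cv : cvgn theta.
  apply: nonincreasing_is_cvgn => //; exists 0 => _ [m _ <-].
  by have /andP[/ltW] := survival_itv m.
pose l := limn theta.
have tl : theta @ \oo --> l by [].
have l0 : 0 <= l.
  by apply: limr_ge => //; apply: nearW => m; have /andP[/ltW] := survival_itv m.
have l1 : l <= 1.
  by apply: limr_le => //; apply: nearW => m; have /andP[] := survival_itv m.
suff -> : 0 = l by [].
have : l = l * (p * \sum_(i < sigma) (1 - p * l) ^+ i).
  have h1 : (fun m => theta m.+1) @ \oo --> l by move: tl; rewrite -cvg_shiftS.
  have h2 : (fun m => theta m.+1) @ \oo --> l * (p * \sum_(i < sigma) (1 - p * l) ^+ i).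
    rewrite (_ : (fun m => theta m.+1) = (fun m => theta m * survival_ratio m)).
      by apply: cvgM => //; apply: cvg_ratio.
    by apply/funext => m; rewrite survivalS.
  exact: (cvg_unique _ h1 h2).
move=> lE; apply/esym/eqP; apply: contraT => ln0.
have lpos : 0 < l by rewrite lt_def ln0.
have : p * \sum_(i < sigma) (1 - p * l) ^+ i < 1.
  apply: (@lt_le_trans _ _ (p * sigma%:R)); last by rewrite ps.
  rewrite ltr_pM2l //.
  have a0 : 0 <= 1 - p * l by rewrite subr_ge0 mulr_ile1 // ltW.
  have a1 : 1 - p * l < 1 by rewrite ltrBlDr ltrDl mulr_gt0.
  (* Strictness comes from the term of index 1, present because [sigma] is at least 2. *)
  case: sigma hsigma => [//|[//|s]] _; rewrite 2!big_ord_recl expr0 /= expr1.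
  have -> : s.+2%:R = 1 + (1 + s%:R) :> R by rewrite -!natr1; ring.
  rewrite ltrD2l; apply: ltr_leD => //.
  have -> : s%:R = \sum_(i < s) 1 :> R by rewrite sumr_const card_ord.
  by apply: ler_sum => i _; apply: exprn_ile1 => //; apply: ltW.
move=> h; have : l < l by rewrite {1}lE -[ltRHS]mulr1 ltr_pM2l.
by rewrite ltxx.
Qed.

(** One step in height multiplies the survival probability by a ratio tending to p sigma = 1, as
    that probability tends to 0; here [k] steps are composed. *)
Lemma cvg_survival_ratio k : (fun m => theta m / theta (k + m)) @ \oo --> (1 : R).
Proof.
have tn0 m : theta m != 0 by have /andP[t0 _] := survival_itv m; rewrite gt_eqF.
elim: k => [|k IHk].
  by rewrite (_ : (fun _ => _) = fun=> 1); [exact: cvg_cst | apply/funext => m; rewrite divff].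
have rn0 m : survival_ratio m != 0.
  by have := tn0 m.+1; rewrite survivalS mulf_eq0 negb_or => /andP[].
rewrite (_ : (fun _ => _) = (fun m => theta m / theta (k + m) * (survival_ratio (k + m))^-1)); last first.
  by apply/funext => m; rewrite addSn survivalS invfM mulrA.
rewrite -[X in _ --> X]mulr1; apply: cvgM => //.
rewrite -[X in _ --> X]invr1; apply: cvgV; first exact: oner_neq0.
have : survival_ratio @ \oo --> p * \sum_(i < sigma) (1 - p * 0) ^+ i.
  exact: cvg_ratio cvg_survival.
rewrite mulr0 subr0 (eq_bigr (fun=> 1)); last by move=> i _; rewrite expr1n.
rewrite sumr_const card_ord ps => h.
by under eq_fun do rewrite addnC; move: h; rewrite -(cvg_shiftn k).
Qed.

End Survival.

Section IIC.
Variables (sigma : nat) (R : realType).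
Hypothesis hsigma : (2 <= sigma)%N.
Let p : R := sigma%:R^-1.
Let p01 : 0 <= p <= 1.
Proof. by rewrite invr_ge0 ler0n invf_le1 ?ler1n ?ltr0n; case: sigma hsigma. Qed.

Variables (d : measure_display) (T : measurableType d) (P : probability T R).
Variable X : edge sigma -> {RV P >-> bool}.
Hypothesis iidX : iid X (bernoulli_prob p).

Let eta t : edge sigma -> bool := fun e => X e t.

Let bernE (b : bool) : bernoulli_prob p (id @^-1` [set b]) = (bern p b)%:E.
Proof.
rewrite preimage_id bernoulli_probE // !diracE !classical_sets.in_set1 -!EFinM -EFinD; congr (_%:E).
by case: b; rewrite /= ?mulr1 ?mulr0 ?addr0 ?add0r.
Qed.

Let meta e : measurable [set t | eta t e].
Proof.
rewrite (_ : [set _ | _] = X e @^-1` [set true]); last by apply/seteqP; split.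
by rewrite -[Y in measurable Y]setTI; apply: measurable_funP.
Qed.

Lemma pr_trace n s : pr P [set t | trace n (eta t) = s] = perc_law p s.
Proof.
rewrite (_ : [set _ | _] = [set t | [pred w | btrace w == s] (read n (eta t))]); last first.
  by apply/seteqP; split => t /=; rewrite trace_read => /eqP.
rewrite pr_disc; last first.
  move=> w; exact: (@measurable_read _ _ _ _ _ _ _ X bool false id (fun _ => I) n w).
rewrite (eq_bigr (fun w => lab_law (bern p) w)); last first.
  by move=> w _; exact: (@pr_read _ _ _ _ _ _ _ X _ iidX bool false id (bern p) (fun _ => I) bernE n w).
have := btrace_law p (fun s' : hcluster sigma n => (s' == s)%:R).
rewrite [RHS](bigD1 s) //= eqxx mulr1 [X in _ = _ + X -> _]big1 ?addr0 => [|s' /negPf ->]; last by rewrite mulr0.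
move=> <-; rewrite big_mkcond; apply: eq_bigr => w _ /=.
by case: eqP; rewrite ?mulr1 ?mulr0.
Qed.

Lemma pr_trace_in n (C : pred (hcluster sigma n)) :
  pr P [set t | C (trace n (eta t))] = \sum_(s | C s) perc_law p s.
Proof.
by rewrite pr_disc; [apply: eq_bigr => s _; apply: pr_trace | exact: (measurable_random_trace meta)].
Qed.

(** With x = [genf sigma p m 0], a trace with frontier size F dies out before height [k + m] with
    probability x^F. Factoring 1 - x^F as (1 - x) times a geometric sum isolates the survival
    probability. *)
Lemma pr_trace_reaches k m (B : pred (hcluster sigma k)) :
  pr P ([set t | B (trace k (eta t))] `&` [set t | reaches_height (eta t) (k + m)]) =
    survival sigma R m *
    \sum_(s | B s) perc_law p s * \sum_(i < frontier s) genf sigma p m 0 ^+ i.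
Proof.
rewrite (_ : _ `&` _ = [set t | [pred s' : hcluster sigma (k + m) |
    B (prune s') && (0 < frontier s')%N] (trace (k + m) (eta t))]); last first.
  apply/seteqP; split=> t /=; rewrite prune_trace reaches_heightP; first by case=> -> ->.
  by move/andP.
rewrite pr_trace_in (partition_big (@prune sigma k m) B) /=; last by move=> s' /andP[].
rewrite mulr_sumr; apply: eq_bigr => s Bs.
transitivity (perc_law p s - perc_law p s * genf sigma p m 0 ^+ frontier s).
  rewrite -avoid_prune -(perc_prune p m s).
  apply/eqP; rewrite eq_sym subr_eq (bigID (fun s' : hcluster sigma (k + m) => frontier s' == 0%N)) /=.
  rewrite addrC; apply/eqP; congr (_ + _); apply: eq_bigl => s'; rewrite lt0n andbC.
  by case: (eqVneq (prune s') s) => [->|]; rewrite ?Bs ?andbF ?andbT.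
have := subrX1 (genf sigma p m 0) (frontier s); set S := \sum_(i < _) _ => h.
by rewrite /survival -[X in X - _]mulr1 -mulrBr -opprB h; ring.
Qed.

Lemma pr_reaches n : pr P [set t | reaches_height (eta t) n] = survival sigma R n.
Proof.
have := @pr_trace_reaches 0 n xpredT.
have -> : [set t | xpredT (trace 0 (eta t))] = setT by apply/seteqP; split.
rewrite setTI.
move=> ->; rewrite (bigD1 tt) //= [X in _ * (_ + X)]big1; last by case.
by rewrite big_ord1 expr0 addr0 !mulr1.
Qed.

(** Here the size bias appears: as survival tends to 0, each of the [frontier s] terms of the
    geometric sum tends to 1, while the quotient of survival probabilities also tends to 1. *)
Lemma iic_limit k (B : pred (hcluster sigma k)) :
  cond_prob P [set t | B (trace k (eta t))] [set t | reaches_height (eta t) n]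
    @[n --> \oo] --> \sum_(s | B s) iic_law p s.
Proof.
rewrite -(cvg_shiftn k) /=.
rewrite (_ : (fun n => _) = fun m => (\sum_(s | B s) perc_law p s *
    \sum_(i < frontier s) (1 - survival sigma R m) ^+ i) *
    (survival sigma R m / survival sigma R (k + m))); last first.
  apply/funext => m; rewrite /cond_prob addnC -/(pr P _) pr_trace_reaches.
  rewrite -/(pr P _) pr_reaches mulrAC mulrC; congr (_ * _); apply: eq_bigr => s _.
  by rewrite /survival opprB addrC subrK.
rewrite -[\sum_(s | B s) iic_law p s]mulr1; apply: cvgM; last exact: cvg_survival_ratio.
apply: cvg_sumr => s; apply: cvgM; first exact: cvg_cst.
rewrite (_ : (frontier s)%:R = \sum_(i < frontier s) 1 ^+ i); last first.
  by rewrite (eq_bigr (fun=> 1)) ?sumr_const ?card_ord // => i _; rewrite expr1n.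
apply: cvg_sumr => i; apply: cvg_exprn.
rewrite -[X in _ --> X]subr0; apply: cvgB; first exact: cvg_cst.
exact: cvg_survival.
Qed.

End IIC.

(** * The invasion percolation cluster *)

Section CountableMeasurable.
Variables (d : measure_display) (T : measurableType d) (I : countType).

Lemma measurable_exists (A : I -> set T) :
  (forall i, measurable (A i)) -> measurable [set t | exists i, A i t].
Proof.
move=> mA; rewrite (_ : [set _ | _] =
    \bigcup_n (if unpickle n is Some i then A i else set0)).
  by apply: bigcup_measurable => n _; case: (unpickle n).
apply/seteqP; split=> t /= [n]; first by exists (pickle n) => //; rewrite pickleK.
by move=> _; case: (unpickle n) => // i At; exists i.
Qed.

Lemma measurable_forall (A : I -> set T) :
  (forall i, measurable (A i)) -> measurable [set t | forall i, A i t].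
Proof.
move=> mA; rewrite (_ : [set _ | _] = ~` [set t | exists i, (~` A i) t]).
  by apply: measurableC; apply: measurable_exists => i; apply: measurableC.
apply/seteqP; split=> t /= h; first by move=> [i]; apply.
by move=> i; apply: contrapT => nA; apply: h; exists i.
Qed.

Lemma measurable_prop (Q : Prop) : measurable [set t : T | Q].
Proof.
have [q|nq] := pselect Q.
  by rewrite (_ : [set _ | _] = setT) //; apply/seteqP; split.
by rewrite (_ : [set _ | _] = set0) //; apply/seteqP; split.
Qed.

End CountableMeasurable.

Section Labels.
Variables (R : realType) (M : nat).

Let reached (x : R) (l : 'I_M.+1) : bool := (l == ord0) || (l%:R / M.+1%:R <= x).

(** On [0, 1) this is the integer part of (M + 1) x; other values are clamped, so that the map is
    monotone on all of [R]. *)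
Definition label (x : R) : 'I_M.+1 := [arg max_(l > ord0 | reached x l) (l : nat)].

Lemma leq_label x (l : 'I_M.+1) : (l <= label x)%N = reached x l.
Proof.
rewrite /label; case: arg_maxnP => [|m rm mmax]; first by rewrite /reached eqxx.
apply/idP/idP; last exact: mmax.
rewrite /reached; case: (eqVneq l ord0) => //= l0 lm.
move: rm; rewrite /reached => /orP[/eqP m0|]; last first.
  by apply: le_trans; rewrite ler_pM2r ?invr_gt0 ?ltr0n // ler_nat.
by move: l0; rewrite -val_eqE /= -leqn0 (leq_trans lm) // m0.
Qed.

Lemma label_mono x y : x <= y -> (label x <= label y)%N.
Proof.
move=> xy; rewrite leq_label /reached.
have : reached x (label x) by rewrite -leq_label.
by case/orP => [->//|h]; rewrite (le_trans h xy) orbT.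
Qed.

Let label_geE (l : nat) : (l <= M.+1)%N -> [set x : R | (l <= label x)%N] =
  if (l == 0)%N then setT else if (l == M.+1)%N then set0 else `[l%:R / M.+1%:R, +oo[%classic.
Proof.
move=> lM; case: eqP => [->|/eqP l0]; first by apply/seteqP; split.
case: eqP => [->|/eqP lM1].
  by apply/seteqP; split => // x /=; rewrite leqNgt ltn_ord.
have lM' : (l < M.+1)%N by rewrite ltn_neqAle lM1 lM.
apply/seteqP; split => x /=; rewrite (leq_label x (Ordinal lM')) /reached -val_eqE /= (negPf l0) /=;
  by rewrite in_itv /= andbT.
Qed.

Lemma measurable_label l : measurable (label @^-1` [set l]).
Proof.
have mge (k : nat) : (k <= M.+1)%N -> measurable [set x : R | (k <= label x)%N].
  by move=> kM; rewrite label_geE //; case: ifP => // _; case: ifP.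
rewrite (_ : _ @^-1` _ = [set x : R | (l <= label x)%N] `\` [set x : R | (l.+1 <= label x)%N]).
  by apply: measurableD; apply: mge => //; apply: ltnW.
apply/seteqP; split => x /=.
  by move=> ->; split => //; rewrite ltnn.
by move=> [h1 /negP]; rewrite -leqNgt => h2; apply/val_inj/eqP; rewrite eqn_leq h2 h1.
Qed.

Lemma uniform_label l : uniform_prob (@ltr01 R) (label @^-1` [set l]) = (M.+1%:R^-1)%:E.
Proof.
apply: etrans (uniform_setI01 (measurable_label l)) _.
have M0 : 0 < M.+1%:R :> R by rewrite ltr0n.
have lM : (l%:R : R) <= M.+1%:R by rewrite ler_nat ltnW.
have lM1 : (l.+1%:R : R) <= M.+1%:R by rewrite ler_nat.
rewrite (_ : _ `&` _ = `[l%:R / M.+1%:R, l.+1%:R / M.+1%:R[%classic); last first.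
  have lt_label x : 0 <= x < 1 -> (l < label x)%N = (l.+1%:R / M.+1%:R <= x).
    move=> /andP[x0 x1]; have [lM'|] := ltnP l.+1 M.+1.
      by rewrite (leq_label x (Ordinal lM')).
    move=> Ml; apply/idP/idP => [h|]; first by have := leq_trans Ml h; rewrite leqNgt ltn_ord.
    have -> : l.+1 = M.+1 by apply/eqP; rewrite eqn_leq Ml ltn_ord.
    by rewrite divff ?gt_eqF // leNgt x1.
  have le_label x : 0 <= x < 1 -> (l <= label x)%N = (l%:R / M.+1%:R <= x).
    move=> /andP[x0 x1]; rewrite leq_label /reached; case: eqP => //= ->.
    by rewrite mul0r x0.
  have labelE x : (label x = l) <-> (l <= label x)%N /\ ~~ (l < label x)%N.
    split=> [->|[h1 h2]]; first by rewrite ltnn.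
    by apply/val_inj/eqP; rewrite eqn_leq leqNgt h2 h1.
  apply/seteqP; split => x /=; rewrite !in_itv /=.
    by move=> [/labelE[h1 h2] x01]; rewrite -le_label // h1 ltNge -lt_label.
  move=> /andP[h1 h2].
  have x0 : 0 <= x by apply: le_trans h1; rewrite divr_ge0 // ltW.
  have x1 : x < 1 by apply: (lt_le_trans h2); rewrite ler_pdivrMr // mul1r.
  have x01 : 0 <= x < 1 by rewrite x0 x1.
  by split => //; apply/labelE; rewrite le_label // lt_label // h1 -ltNge.
rewrite [LHS](uniform_itv _ _ _).
- by rewrite -natr1 mulrDl addrC addKr mul1r.
- by rewrite divr_ge0 // ltW.
- by rewrite ler_pM2r ?invr_gt0 // ler_nat.
- by rewrite ler_pdivrMr // mul1r.
Qed.

End Labels.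

Section RandomInvasion.
Variables (R : realType) (r : nat).
Notation sigma := r.+1.
Variables (d : measure_display) (T : measurableType d) (P : probability T R).
Variable W : edge sigma -> {RV P >-> R}.

Let w t : edge sigma -> R := fun e => W e t.

Let measurable_weight_le e f : measurable [set t | w t e <= w t f].
Proof.
rewrite (_ : [set _ | _] = setT `&` (fun t => W e t <= W f t) @^-1` [set true]).
  exact: (measurable_realfun.measurable_fun_ler (measurable_funP (W e)) (measurable_funP (W f))).
by rewrite setTI; apply/seteqP; split.
Qed.

Lemma measurable_invasion N v : measurable [set t | vertices (invasion (w t) N) v].
Proof.
elim: N v => [|N IHN] v.
  exact: (measurable_prop _ (v = Defs.root sigma)).
have mb e : measurable [set t | boundary (invasion (w t) N) e].
  rewrite (_ : [set _ | _] = [set t | vertices (invasion (w t) N) e.1] `\`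
     [set t | vertices (invasion (w t) N) (rcons e.1 e.2)]); first exact: measurableD.
  apply/seteqP; split=> t /= [].
    by move=> x [y b]; apply: boundary_prefix; [exact: invasion_prefix | exists x, y].
  by move=> ve nve; rewrite [e]surjective_pairing; apply: prefix_boundary.
rewrite (_ : [set _ | _] = [set t | vertices (invasion (w t) N) v] `|`
   [set t | exists e, ([set t | boundary (invasion (w t) N) e] `&`
      [set t | forall f, (~` [set t | boundary (invasion (w t) N) f] `|` [set t | w t e <= w t f]) t] `&`
      [set t | v = rcons e.1 e.2]) t]); last first.
  apply/seteqP; split=> t /=.
    case/invasionS => [|[e [be mine] ve]]; [by left | right; exists e; split => //; split => // f].
    by have [bf|nbf] := pselect (boundary (invasion (w t) N) f); [right; apply: mine | left].
  case=> [h|[e [[be mine] ve]]]; apply/invasionS; [by left | right; exists e => //].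
  by split => // f bf; case: (mine f).
apply: measurableU; first exact: IHN.
apply: measurable_exists => e; apply: measurableI; first apply: measurableI => //.
  by apply: measurable_forall => f; apply: measurableU => //; apply: measurableC.
exact: measurable_prop.
Qed.

Lemma measurable_invasion_bits N e : measurable [set t | invasion_bits (w t) N e].
Proof.
rewrite (_ : [set _ | _] = [set t | vertices (invasion (w t) N) (rcons e.1 e.2)]).
  exact: measurable_invasion.
by apply/seteqP; split=> t /=; [move=> /asboolP/invasion_edges | move=> h; apply/asboolP/invasion_edges].
Qed.

Lemma measurable_cluster_bits e : measurable [set t | cluster_bits (w t) e].
Proof.
rewrite (_ : [set _ | _] = \bigcup_N [set t | invasion_bits (w t) N e]).
  by apply: bigcup_measurable => N _; apply: measurable_invasion_bits.
apply/seteqP; split=> t /=.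
  by move=> /asboolP [N _ h]; exists N => //; apply/asboolP.
by move=> [N _ /asboolP h]; apply/asboolP; exists N.
Qed.

Hypothesis iidW : iid W (uniform_prob (@ltr01 R)).
Let p : R := sigma%:R^-1.
Let psigma : p * sigma%:R = 1. Proof. by rewrite mulVf // pnatr_eq0. Qed.

Variables (k : nat) (U : pred (hcluster sigma k)).
Hypothesis upU : forall s t, cle s t -> U s -> U t.

Let prune_mono m (s t : hcluster sigma (k + m)) : cle s t -> cle (prune s) (prune t).
Proof.
move=> /cleP st; rewrite !pruneE; apply: trace_le => v.
by rewrite !openpath_cluster_edges; apply: st.
Qed.

(** Without ties this is [invaded_dominated] for the indicator of the up-set and the constant weight
    1; the ties are bounded by their whole probability. *)
Lemma invaded_upset M m :
  \sum_(v : labeling sigma 'I_M.+1 (k + m) | U (prune (invaded v)))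
     lab_law (fun=> M.+1%:R^-1 : R) v <=
  \sum_(s | U s) iic_law p s + (tie_bound r (k + m))%:R * M.+1%:R^-1.
Proof.
set q : 'I_M.+1 -> R := fun=> _.
have q0 l : 0 <= q l by rewrite invr_ge0.
have q1 : \sum_l q l = 1.
  by rewrite /q sumr_const card_ord -[LHS]mulr_natr mulVf // pnatr_eq0.
rewrite (bigID (@noties r M (k + m))) /=; apply: lerD; last first.
  have qc l : q l <= M.+1%:R^-1 by [].
  have := tie_law r q0 q1 qc (k + m); apply: le_trans.
  rewrite [leLHS]big_mkcond [leRHS]big_mkcond; apply: ler_sum => v _.
  by case: (U _) => //=; case: ifP => // _; apply: lab_law_ge0.
have h : \sum_(v : labeling sigma 'I_M.+1 (k + m) | noties v)
      lab_law q v * ((U (prune (invaded v)))%:R * 1) <=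
    (\sum_(s : hcluster sigma (k + m)) iic_law p s * (U (prune s))%:R) * 1.
  have E : \sum_(v : labeling sigma 'I_M.+1 (k + m)) lab_law q v * 1 = 1.
    by under eq_bigr do rewrite mulr1; apply: sum_lab_law.
  rewrite -[X in _ <= _ * X]E.
  apply: (invaded_dominated q0 q1 (f := fun s => (U (prune s))%:R) (g := fun=> 1)) => //.
  move=> s t st; rewrite ler_nat.
  by case: (boolP (U (prune s))) => // /(upU (prune_mono st)) ->.
apply: (@le_trans _ _ _ _ _ _ (le_trans h _)).
  rewrite le_eqVlt; apply/orP; left; apply/eqP.
  rewrite [LHS]big_mkcond [RHS]big_mkcond; apply: eq_bigr => v _.
  by case: (U _); case: (noties v); rewrite /= ?mulr1 ?mulr0.
rewrite mulr1 le_eqVlt; apply/orP; left; apply/eqP.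
transitivity (\sum_(s : hcluster sigma (k + m) | U (prune s)) iic_law p s).
  by rewrite [RHS]big_mkcond; apply: eq_bigr => s _; case: (U _); rewrite ?mulr1 ?mulr0.
rewrite (partition_big (@prune sigma k m) U) //; apply: eq_bigr => s Us.
rewrite -(iic_prune psigma m s); apply: eq_bigl => s'.
by case: eqP => [->|]; rewrite ?Us ?andbF.
Qed.

(** Two limits in this order: the mesh tends to 0 at a fixed stage [N] of the invasion, then [N]
    tends to infinity by continuity from below. *)
Lemma ipc_upset :
  pr P [set t | U (trace k (cluster_bits (w t)))] <= \sum_(s | U s) iic_law p s.
Proof.
pose E N := [set t | U (trace k (invasion_bits (w t) N))].
have mE N : measurable (E N).
  apply: measurable_disc; apply: measurable_random_trace => e; exact: measurable_invasion_bits.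
have EE : [set t | U (trace k (cluster_bits (w t)))] = \bigcup_N E N.
  apply/seteqP; split=> t /=.
    by have [N ->] := trace_cluster_lim (w t) k => UN; exists N.
  by move=> [N _]; apply: upU; apply: trace_cluster_ge.
have mUE : measurable (\bigcup_N E N) by apply: bigcup_measurable.
have Ebound N : pr P (E N) <= \sum_(s | U s) iic_law p s.
  (* At height [k + N] the first [N] stages of the invasion are contained in [invaded]. *)
  have bM M : pr P (E N) <= \sum_(s | U s) iic_law p s + (tie_bound r (k + N))%:R * M.+1%:R^-1.
    apply: le_trans (invaded_upset M N).
    pose lab t := fun e => label M (W e t).
    have mr := measurable_read W ord0 (@measurable_label R M).
    apply: (@le_trans _ _ (pr P [set t | U (prune (invaded (read (k + N) (lab t))))])).
      apply: pr_le => //.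
        exact: (@measurable_disc _ _ _ _ (mr (k + N)%N) (fun v => U (prune (invaded v)))).
      move=> t; apply: upU; rewrite pruneE; apply: trace_le => v.
      rewrite openpath_cluster_edges => /openpath_invasion.
      apply: invasion_invaded; last exact: leq_addl.
      by move=> e f; apply: label_mono.
    rewrite (@pr_disc _ _ _ _ _ _ (mr (k + N)%N) (fun v => U (prune (invaded v)))).
    rewrite le_eqVlt; apply/orP; left; apply/eqP; apply: eq_bigr => v _.
    exact: (pr_read iidW ord0 (@measurable_label R M) (@uniform_label R M)).
  rewrite leNgt; apply/negP => lt_ba.
  set c : R := (tie_bound r (k + N))%:R in bM.
  have c0 : 0 < c.
    rewrite ltr0n lt0n; apply: contraTneq lt_ba => c0.
    by have := bM 0%N; rewrite /c c0 mul0r addr0 -leNgt.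
  have [M] : exists M : nat, (\sum_(s | U s) iic_law p s) / c + M.+1%:R^-1 < pr P (E N) / c.
    by apply: ltr_add_invr; rewrite ltr_pM2r ?invr_gt0.
  rewrite -(ltr_pM2r c0) divfK ?gt_eqF // mulrDl divfK ?gt_eqF // => lt1.
  by have := lt_le_trans lt1 (bM M); rewrite (mulrC c) ltxx.
rewrite EE -lee_fin -prE //.
have homoE : {homo E : n m / (n <= m)%N >-> (n <= m)%O}.
  move=> n m nm; rewrite subsetEset => t; apply: upU.
  exact: trace_invasion_mono.
have cv := nondecreasing_cvg_mu (mu := P) mE mUE homoE.
rewrite -(cvg_lim _ cv) //; apply: lime_le; first by apply/cvg_ex; exists (P (\bigcup_N E N)).
by apply: nearW => N; rewrite /= prE // lee_fin.
Qed.

End RandomInvasion.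

(** * Kolmogorov extension *)

Section Kolmogorov.
Variables (R : realType) (I : countType) (ell : set (I -> bool) -> R).
Hypotheses (ell0 : forall A, 0 <= ell A) (ell1 : ell setT = 1).
Hypothesis ellD : forall (F : finType) (Y : (I -> bool) -> F) (B : pred F),
  ell [set y | B (Y y)] = \sum_(f | B f) ell [set y | Y y = f].

Let U : probability (measurableTypeR R) R := uniform_prob (@ltr01 R).

(** Positions that code no index carry [false], so that a configuration becomes a sequence of
    bits. *)
Let ext (y : I -> bool) (n : nat) : bool := if unpickle n is Some i then y i else false.

Let q (w : seq bool) : R := ell [set y | word (ext y) (size w) = w].

Let q0 w : 0 <= q w. Proof. exact: ell0. Qed.

Let q1 : q [::] = 1.
Proof. by rewrite -ell1; congr ell; apply/seteqP; split. Qed.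

Let qS w : q w = q (true :: w) + q (false :: w).
Proof.
pose Y y := (word (ext y) (size w) == w, ext y (size w)).
have := ellD Y (fun f => f.1).
rewrite (_ : [set y | (Y y).1] = [set y | word (ext y) (size w) = w]); last first.
  by apply/seteqP; split => y /eqP.
rewrite -/(q w) => ->.
rewrite (bigD1 (true, true)) //= (bigD1 (true, false)) //= big1 ?addr0; last by case=> [[] []].
have E b : ell [set y | Y y = (true, b)] = q (b :: w).
  congr ell; apply/seteqP; split => y /=.
    by rewrite /Y => -[/eqP yw ->]; rewrite yw.
  by rewrite /Y => -[-> ->]; rewrite eqxx.
by rewrite !E.
Qed.

Definition sample (i : I) (x : R) : bool := bit q x (pickle i).

Lemma measurable_sample i : measurable [set x : measurableTypeR R | sample i x].
Proof. exact: measurable_bit. Qed.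

(** [ell] is only finitely additive on finite-valued observables, so agreement is claimed for events
    depending on finitely many coordinates. *)
Lemma pr_sample (A : set (I -> bool)) (m : nat) :
  (forall y z, (forall i, (pickle i < m)%N -> y i = z i) -> (A y <-> A z)) ->
  pr U [set x | A (sample ^~ x)] = ell A.
Proof.
move=> Am.
pose sel (f : {ffun 'I_m -> bool}) (i : I) := unblock f (pickle i).
pose B f := `[< A (sel f) >].
have selE y : A y <-> B (block m (ext y)).
  rewrite (Am y (sel (block m (ext y)))); last first.
    by move=> i im; rewrite /sel unblockK // /ext pickleK.
  by split=> /asboolP.
rewrite (_ : [set x | _] = [set x | B (block m (bit q x))]); last first.
  apply/seteqP; split => x /=; rewrite /B asboolE => /Am; apply=> i im;
    by rewrite /sel unblockK.
rewrite pr_disc; last by move=> f; apply: (measurable_block (measurable_bit q)).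
rewrite (_ : A = [set y | B (block m (ext y))]); last first.
  by apply/seteqP; split => y /= /selE.
rewrite ellD; apply: eq_bigr => f _.
rewrite (pr_block q0 q1 qS) /q; congr ell.
by apply/seteqP; split => y /=; rewrite size_word blockP.
Qed.

End Kolmogorov.

Section UltraLimit.
Variable R : realType.

(* Limit points of laws on finite sets, taken along an ultrafilter so that all the
   finitely additive relations pass to the limit at once. *)
Lemma ultra_limit (Y : Type) (law : nat -> set Y -> R) :
  (forall n A, 0 <= law n A <= 1) ->
  (forall n (F : finType) (Z : Y -> F) (B : pred F),
    law n [set y | B (Z y)] = \sum_(f | B f) law n [set y | Z y = f]) ->
  exists ell : set Y -> R,
    [/\ forall A, 0 <= ell A,
        forall (F : finType) (Z : Y -> F) (B : pred F),
          ell [set y | B (Z y)] = \sum_(f | B f) ell [set y | Z y = f] &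
        forall k A c, (forall n, (k <= n)%N -> law n A = c) -> ell A = c].
Proof.
move=> law01 lawD.
have [G [GU oG]] := ultraFilterLemma (@eventually_filter).
have GF : ProperFilter G by apply: ultra_proper.
have cv A : exists l : R, law ^~ A @ G --> l.
  (* Compactness of [0, 1] gives a cluster point, and along an ultrafilter a cluster point is a
     limit. *)
  have [l [_ lcl]] : `[0, 1]%classic `&` cluster (law ^~ A @ G) !=set0.
    apply: (@segment_compact R 0 1).
    have h : G (fun n => 0 <= law n A <= 1) by apply: filterS filterT => n _; apply: law01.
    change (G (law ^~ A @^-1` `[0, 1]%classic)).
    by apply: filterS h => n h; rewrite /= in_itv.
  exists l => V Vl.
  have [//|nV] := in_ultra_setVsetC (law ^~ A @^-1` V) GU.
  have := lcl (~` V) V nV Vl.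
  by move=> [x [nVx Vx]].
move/choice: cv => [ell lawell]; exists ell; split.
- move=> A; rewrite -(cvg_lim _ (lawell A)) //; apply: limr_ge; first by apply/cvg_ex; exists (ell A).
  by apply: nearW => n; have /andP[] := law01 n A.
- move=> F Z B.
  have h1 := lawell [set y | B (Z y)].
  have h2 : (fun n => \sum_(f | B f) law n [set y | Z y = f]) @ G -->
      \sum_(f | B f) ell [set y | Z y = f].
    by apply: cvg_sumr => f; apply: lawell.
  have E : law ^~ [set y | B (Z y)] = (fun n => \sum_(f | B f) law n [set y | Z y = f]).
    by apply/funext => n.
  by rewrite E in h1; apply: (cvg_unique _ h1 h2).
- move=> k A c Ac.
  have nearc : G [set n | law n A = c] by apply: oG; exists k => // n; apply: Ac.
  have h2 : law ^~ A @ G --> c by apply: cvg_near_cst; apply: filterS nearc.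
  exact: (cvg_unique _ (lawell A) h2).
Qed.

End UltraLimit.

(** * The coupling *)

Section BernoulliOfUniform.
Variables (R : realType) (d : measure_display) (T : measurableType d).
Variables (P : probability T R) (I : eqType) (W : I -> {RV P >-> R}) (p : R).
Hypotheses (iidW : iid W (uniform_prob (@ltr01 R))) (p01 : 0 <= p <= 1).

Let below (x : R) : bool := x < p.

Let measurable_below : measurable_fun setT below.
Proof.
apply: (@measurable_realfun.measurable_fun_ltr _ _ R setT id (cst p)) => //.
Qed.

Let uniform_below (A : set bool) :
  uniform_prob (@ltr01 R) (below @^-1` A) = bernoulli_prob p A.
Proof.
pose B : {mfun (measurableTypeR R) >-> bool} :=
  @mfun_Sub _ _ (measurableTypeR R) bool below (mem_set measurable_below).
rewrite -(@eq_bernoulli R p (distribution (uniform_prob (@ltr01 R)) B)) //.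
have mB : measurable (below @^-1` [set true]).
  by rewrite -[X in measurable X]setTI; apply: measurable_below.
apply: etrans (uniform_setI01 mB) _.
have /andP[p0 p1] := p01.
rewrite (_ : _ `&` _ = `[0, p[%classic).
  by apply: etrans (uniform_itv (lexx 0) p0 p1) _; rewrite subr0.
apply/seteqP; split => x /=; rewrite !in_itv /= /below.
  by move=> [-> /andP[-> _]].
by move=> /andP[x0 xp]; rewrite xp x0 (lt_le_trans xp p1).
Qed.

Lemma iid_bernoulli : exists X : I -> {RV P >-> bool}, iid X (bernoulli_prob p).
Proof.
have mX i : measurable_fun setT (below \o W i).
  exact: measurableT_comp measurable_below (measurable_funP (W i)).
exists (fun i => mfun_Sub (mem_set (mX i))); case: iidW => [Wl Wi].
have mb A : measurable (below @^-1` A).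
  by rewrite -[X in measurable X]setTI; apply: measurable_below.
split => [i A _|s A us _].
  by rewrite -uniform_below -(Wl i).
exact: (Wi s (fun i => below @^-1` A i)).
Qed.

End BernoulliOfUniform.

Section Subgraphs.
Variable sigma : nat.

Lemma cylinderT : cylinder (setT : set (subgraph sigma)).
Proof. by exists [::], [::]. Qed.

Lemma cylinderI : setI_closed (@cylinder sigma).
Proof.
move=> A B [s [t At]] [s' [t' Bt']]; exists (s ++ s'), (t ++ t') => G H GHv GHe.
have hA : A G <-> A H.
  by apply: At => [v vs|e et]; [apply: GHv|apply: GHe]; rewrite mem_cat ?vs ?et.
have hB : B G <-> B H.
  by apply: Bt' => [v vs|e et]; [apply: GHv|apply: GHe]; rewrite mem_cat ?vs ?et orbT.
by split=> -[/hA AH /hB BH].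
Qed.

Lemma measurable_open_cluster (d : measure_display) (T : measurableType d)
    (eta : T -> edge sigma -> bool) :
  (forall e, measurable [set t | eta t e]) ->
  measurable_fun setT (fun t => open_cluster (eta t) : subgraph_space sigma).
Proof.
move=> meta; apply: (@measurability d _ T (subgraph_space sigma) setT _ (@cylinder sigma) erefl).
move=> _ [A cA <-]; have [k [B AB]] := cylinder_trace cA; rewrite setTI.
rewrite (_ : _ @^-1` _ = [set t | B (trace k (eta t))]).
  by apply: measurable_disc; apply: measurable_random_trace.
by apply/seteqP; split => t /= /AB.
Qed.

Lemma is_subgraph_open_cluster (eta eta' : edge sigma -> bool) :
  (forall k, cle (trace k eta) (trace k eta')) ->
  is_subgraph (open_cluster eta) (open_cluster eta').
Proof.
move=> h; have ho v : openpath eta v -> openpath eta' v.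
  move: (h (size v)) => /cleP /(_ v).
  by rewrite !inclus_trace.
split=> [v /connected_openpath/ho/connected_openpath //|e [ee ce]].
have o : openpath eta' (rcons e.1 e.2).
  apply: ho; rewrite openpath_rcons -surjective_pairing ee andbT.
  by apply/connected_openpath/ce; left.
split=> [|v [] ->]; last 2 first.
- by apply/connected_openpath; move: o; rewrite openpath_rcons => /andP[].
- exact/connected_openpath.
by move: o; rewrite openpath_rcons -surjective_pairing => /andP[].
Qed.

End Subgraphs.

Section Coupling.
Variables (R : realType) (r : nat).
Notation sigma := r.+2.
Let p : R := sigma%:R^-1.

Let p01 : 0 <= p <= 1.
Proof. by rewrite invr_ge0 ler0n invf_le1 ?ler1n ?ltr0n. Qed.

Let psigma : p * sigma%:R = 1. Proof. by rewrite mulVf // pnatr_eq0. Qed.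

Variables (d : measure_display) (T : measurableType d) (P : probability T R).
Variable W : edge sigma -> {RV P >-> R}.
Hypothesis iidW : iid W (uniform_prob (@ltr01 R)).

Let C t : edge sigma -> bool := cluster_bits (fun e => W e t).

Let mC k s : measurable [set t | trace k (C t) = s].
Proof. by apply: measurable_random_trace => e; apply: measurable_cluster_bits. Qed.

Definition ipc_law k (s : hcluster sigma k) : R := pr P [set t | trace k (C t) = s].

Lemma ipc_law_restriction n k (s : hcluster sigma k) : (k <= n)%N ->
  \sum_(s' : hcluster sigma n | trace k (cluster_edges s') == s) ipc_law s' = ipc_law s.
Proof.
move=> kn; rewrite -(pr_disc P (mC (k := n)) (fun s' => trace k (cluster_edges s') == s)).
congr pr; apply/seteqP; split => t /=; rewrite trace_trace //; first by move/eqP.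
by move=> ->.
Qed.

Lemma iic_law_restriction n k (s : hcluster sigma k) : (k <= n)%N ->
  \sum_(s' : hcluster sigma n | trace k (cluster_edges s') == s) iic_law p s' = iic_law p s.
Proof.
move=> /subnKC <-; rewrite -[RHS](iic_prune psigma (n - k)).
by apply: eq_bigl => s'; rewrite pruneE.
Qed.

Let coupling n (x : hcluster sigma n -> hcluster sigma n -> R) :=
  [/\ forall s t, 0 <= x s t, forall s t, ~~ cle s t -> x s t = 0,
      forall s, \sum_t x s t = ipc_law s & forall t, \sum_s x s t = iic_law p t].

(** The neighbours of a set [A] form the up-set it generates, which contains [A]; Hall's condition
    thus reduces to [ipc_upset]. *)
Lemma hcluster_coupling n : exists x, @coupling n x.
Proof.
have h : hall (@cle sigma n) (@ipc_law n) (fun s => iic_law p s).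
  move=> A; pose U := [pred t | t \in nbr (@cle sigma n) A].
  apply: le_trans (_ : _ <= pr P [set t | U (trace n (C t))]) _.
    rewrite (pr_disc P (mC (k := n)) U) [leLHS]big_mkcond [leRHS]big_mkcond; apply: ler_sum => s _.
    case: ifP => sA; last by case: ifP => // _; apply: pr_ge0.
    rewrite ifT //= inE; apply/existsP; exists s; rewrite sA; exact: cle_refl.
  apply: (ipc_upset iidW (U := U)) => s t st.
  rewrite /U /= !inE => /existsP[u /andP[uA us]].
  by apply/existsP; exists u; rewrite uA; apply: cle_trans st.
have := hall_transport_eq _ _ _ h; case.
- by move=> s; apply: pr_ge0.
- by move=> s; apply: iic_law_ge0.
- by rewrite sum_iic_law // pr_disc1.
by move=> x [[x0 xe xa _] xb]; exists x.
Qed.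

Let pair_bits n (st : hcluster sigma n * hcluster sigma n) (be : bool * edge sigma) : bool :=
  cluster_edges (if be.1 then st.2 else st.1) be.2.

(** The index [false] stands for the invasion cluster and [true] for the incipient one. From height
    [k] on, the marginal laws of the traces at [k] are constant and the inclusion of these traces
    fails with probability 0, so both facts survive the limit. *)
Lemma coupling_functional : exists ell : set (bool * edge sigma -> bool) -> R,
  [/\ forall A, 0 <= ell A, ell setT = 1,
      forall (F : finType) (Z : (bool * edge sigma -> bool) -> F) (B : pred F),
        ell [set y | B (Z y)] = \sum_(f | B f) ell [set y | Z y = f],
      forall k (s : hcluster sigma k),
        ell [set y | trace k (fun e => y (false, e)) = s] = ipc_law s /\
        ell [set y | trace k (fun e => y (true, e)) = s] = iic_law p s &
      forall k, ell [set y | ~~ cle (trace k (fun e => y (false, e)))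
                                    (trace k (fun e => y (true, e)))] = 0].
Proof.
have [x xP] : exists x : forall n, hcluster sigma n -> hcluster sigma n -> R,
    forall n, @coupling n (x n).
  by exists (fun n => sval (cid (hcluster_coupling n))) => n; case: cid.
(* The law of the pair of configurations drawn from the coupling at height [n], each extended by
   closed edges above that height. *)
pose law n (A : set (bool * edge sigma -> bool)) : R :=
  \sum_s \sum_t x n s t * `[< A (pair_bits (s, t)) >]%:R.
have x0 n s t : 0 <= x n s t by have [h _ _ _] := xP n; exact: (h s t).
have lawT n : law n setT = 1.
  rewrite /law -[RHS](pr_disc1 P (mC (k := n))); apply: eq_bigr => s _.
  have [_ _ xs _] := xP n; rewrite -[RHS]/(ipc_law s) -xs; apply: eq_bigr => t _.
  by rewrite asboolT // mulr1.
have [|n F Z B|ell [ell0 ellD ellc]] := @ultra_limit R _ law.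
- move=> n A; apply/andP; split.
    by apply: sumr_ge0 => s _; apply: sumr_ge0 => t _; apply: mulr_ge0.
  rewrite -[leRHS](lawT n); apply: ler_sum => s _; apply: ler_sum => t _.
  apply: ler_wpM2l => //.
  have -> : `[< setT (pair_bits (s, t)) >] = true by exact/asboolP.
  by rewrite ler_nat; case: `[< A _ >].
- rewrite /law [RHS]exchange_big; apply: eq_bigr => s _.
  rewrite [RHS]exchange_big; apply: eq_bigr => t _.
  rewrite -mulr_sumr; congr (_ * _).
  set z := Z (pair_bits (s, t)).
  have -> : `[< [set y | B (Z y)] (pair_bits (s, t)) >] = B z.
    by apply/asboolP/idP.
  have E f : `[< [set y | Z y = f] (pair_bits (s, t)) >] = (z == f).
    by apply/asboolP/eqP.
  under [RHS]eq_bigr do rewrite E.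
  rewrite [RHS]big_mkcond (bigD1 z) //= eqxx [X in _ + X]big1 ?addr0.
    by case: (B z).
  by move=> f /negPf fz; rewrite eq_sym fz; case: (B f).
exists ell; split => //.
- by apply: (ellc 0%N) => n _; apply: lawT.
- move=> k s; split; apply: (ellc k) => n kn.
    rewrite -(ipc_law_restriction s kn) [RHS]big_mkcond; apply: eq_bigr => s' _.
    have E t : `[< [set y | trace k (fun e => y (false, e)) = s] (pair_bits (s', t)) >] =
        (trace k (cluster_edges s') == s) by apply/asboolP/eqP.
    have [_ _ <- _] := xP n; under eq_bigr do rewrite E.
    rewrite -mulr_suml; by case: eqP => _; rewrite ?mulr1 ?mulr0.
  rewrite -(iic_law_restriction s kn) [RHS]big_mkcond /law exchange_big; apply: eq_bigr => t _.
  have E s' : `[< [set y | trace k (fun e => y (true, e)) = s] (pair_bits (s', t)) >] =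
      (trace k (cluster_edges t) == s) by apply/asboolP/eqP.
  have [_ _ _ <-] := xP n; under eq_bigr do rewrite E.
  by rewrite -mulr_suml; case: eqP => _; rewrite ?mulr1 ?mulr0.
- move=> k; apply: (ellc k) => n kn.
  rewrite /law big1 // => s _; rewrite big1 // => t _.
  have [st|nst] := boolP (cle s t); last first.
    by case: (xP n) => _ -> //; rewrite mul0r.
  rewrite asboolF ?mulr0 //= => /negP; apply.
  apply: trace_le => v; rewrite !openpath_cluster_edges.
  by move: v; apply/cleP.
Qed.

End Coupling.

Section Domination.
Variables (R : realType) (r : nat).
Notation sigma := r.+2.
Let p : R := sigma%:R^-1.
Let V : probability (measurableTypeR R) R := uniform_prob (@ltr01 R).

Lemma domination : exists Cinf C : {RV V >-> subgraph_space sigma},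
  [/\ IIC_law (distribution V Cinf), IPC_law (distribution V C) &
      {ae V, forall omega, is_subgraph (C omega) (Cinf omega)}].
Proof.
have p01 : 0 <= p <= 1 by rewrite invr_ge0 ler0n invf_le1 ?ler1n ?ltr0n.
have [W iidW] := iid_uniform R (edge sigma).
have [X iidX] := iid_bernoulli iidW p01.
have [ell [ell0 ell1 ellD elllaw ellcle]] := coupling_functional iidW.
pose bits_of (b : bool) x (e : edge sigma) := sample ell (b, e) x.
have mbits b e : measurable [set x | bits_of b x e] by apply: measurable_sample.
(* A statement on the two traces at height [k] depends on finitely many coordinates; [m] exceeds the
   codes of all of them. *)
have prE2 k (Q : hcluster sigma k -> hcluster sigma k -> Prop) :
    pr V [set x | Q (trace k (bits_of false x)) (trace k (bits_of true x))] =
    ell [set y | Q (trace k (fun e => y (false, e))) (trace k (fun e => y (true, e)))].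
  pose m := (\max_(e <- ball_edges sigma k)
     maxn (pickle (false, e)).+1 (pickle (true, e)).+1)%N.
  have em (b : bool) (e : edge sigma) : e \in ball_edges sigma k -> (pickle (b, e) < m)%N.
    move=> ek; apply: leq_trans _ (leq_bigmax_seq _ ek isT).
    by case: b; [exact: leq_maxr|exact: leq_maxl].
  apply: (@pr_sample _ _ _ ell0 ell1 ellD _ m) => y z yz.
  have E b : trace k (fun e => y (b, e)) = trace k (fun e => z (b, e)).
    by rewrite !trace_read; congr btrace; apply/eq_read => e ek; apply/yz/em.
  by rewrite /= !E.
pose G b x : subgraph_space sigma := open_cluster (bits_of b x).
have mG b : measurable_fun setT (G b : measurableTypeR R -> _).
  by apply: measurable_open_cluster => e; apply: mbits.
pose Gm b : {RV V >-> subgraph_space sigma} :=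
  @mfun_Sub _ _ (measurableTypeR R) _ (G b) (mem_set (mG b)).
exists (Gm true), (Gm false); split.
- exists _, _, V, X; split => // A cA; have [k [B AB]] := cylinder_trace cA.
  have -> : fine (distribution V (Gm true) A) = \sum_(s | B s) iic_law p s.
    transitivity (pr V [set x | B (trace k (bits_of true x))]).
      by rewrite /pr; congr (fine (V _)); apply/seteqP; split => x /= /AB.
    rewrite (prE2 k (fun _ t => B t)) (ellD _ (fun y => trace k (fun e => y (true, e)))).
    by apply: eq_bigr => s _; have [_] := elllaw k s.
  rewrite (_ : [set t | A _] = [set t | B (trace k (fun e => X e t))]); last first.
    by apply/seteqP; split => t /= /AB.
  exact: iic_limit.
(* The sampled cluster is not the invasion of [W]; only the laws agree, first on cylinders through
   the traces, then everywhere by uniqueness of measures. *)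
- exists _, _, V, W; split => // A mA.
  pose Cb (t : measurableTypeR R) : edge sigma -> bool := cluster_bits (fun e => W e t).
  have mCb e : measurable [set t | Cb t e] by apply: measurable_cluster_bits.
  have [m2 m2E] := pushforward_measure V (measurable_open_cluster mCb).
  transitivity (m2 A); last first.
    by rewrite m2E; congr (V _); apply/seteqP; split => t /=; rewrite invasion_clusterE.
  apply: (@measure_unique _ R (subgraph_space sigma) (@cylinder sigma) (fun=> setT) erefl
    (@cylinderI sigma) (fun=> cylinderT sigma)) => //.
  + by rewrite bigcup_const //; exists 0%N.
  + move=> D cD; have [k [B DB]] := cylinder_trace cD.
    rewrite m2E.
    have mB (eta : measurableTypeR R -> edge sigma -> bool) :
        (forall e, measurable [set t | eta t e]) -> measurable [set t | B (trace k (eta t))].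
      by move=> meta; apply: measurable_disc; apply: measurable_random_trace.
    transitivity (V [set x | B (trace k (bits_of false x))]).
      by congr (V _); apply/seteqP; split => x /= /DB.
    transitivity (V [set t | B (trace k (Cb t))]); last first.
      by congr (V _); apply/seteqP; split => x /= /DB.
    rewrite (prE _ (mB _ (mbits false))) (prE _ (mB _ mCb)); congr (_%:E).
    rewrite (prE2 k (fun s _ => B s)) (ellD _ (fun y => trace k (fun e => y (false, e)))).
    rewrite (pr_disc V (@measurable_random_trace _ _ _ _ mCb k) B).
    by apply: eq_bigr => s _; have [] := elllaw k s.
  + move=> _; apply: (@le_lt_trans _ _ 1%E); last exact: ltry.
    exact: probability_le1.
(* Inclusion of the clusters is inclusion of their traces at every height, so the exceptional set
   lies in a countable union of null sets. *)
- have neg k : V.-negligible [set x | ~~ cle (trace k (bits_of false x)) (trace k (bits_of true x))].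
    pose Z x := (trace k (bits_of false x), trace k (bits_of true x)).
    have mZ st : measurable [set x : measurableTypeR R | Z x = st].
      rewrite (_ : [set x | _] = [set x | trace k (bits_of false x) = st.1] `&`
         [set x | trace k (bits_of true x) = st.2]).
        by apply: measurableI; apply: measurable_random_trace => e; apply: mbits.
      by apply/seteqP; split => x /=; [move=> <- | case: st => a b /= [<- <-]].
    have mN := measurable_disc mZ (fun st => ~~ cle st.1 st.2).
    apply/negligibleP => //; apply: etrans (prE V mN) _.
    by rewrite (prE2 k (fun s t => ~~ cle s t)) ellcle.
  apply: negligibleS (negligible_bigcup neg) => x /= nsub.
  apply: contrapT => ncup; apply: nsub; apply: is_subgraph_open_cluster => k.
  by apply/negPn/negP => nc; apply: ncup; exists k.
Qed.

End Domination.

Theorem theorem1p1 (R : realType) (sigma : nat) (hsigma : (2 <= sigma)%N) :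
  exists (d : measure_display) (Omega : measurableType d)
    (P : probability Omega R) (Cinf C : {RV P >-> subgraph_space sigma}),
    [/\ IIC_law (distribution P Cinf),
        IPC_law (distribution P C) &
        {ae P, forall omega, is_subgraph (C omega) (Cinf omega)}].
Proof.
case: sigma hsigma => [|[|r]] // _.
by have [Cinf [C h]] := domination R r; exists _, _, _, Cinf, C.
Qed.
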